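(* (1) Let $V=\mathbb{C}x\oplus\mathbb{C}y\oplus\mathbb{C}d$ for formal symbols $x,y,d$, and let $I$ be the two-sided ideal of the tensor algebra $T(V)$ generated by $[x,y]$, $[d,x]+\frac13 y$ and $[d,y]+\frac12 x\otimes x$. Then $T(V)/I$ is isomorphic to $\mathcal{R}$ as $\mathbb{C}$-algebras. (2) Let $J$ be the left $\mathcal{R}$-submodule of $\mathcal{R}\otimes_{\mathbb{C}}\mathbb{C}$ generated by $\delta\otimes1$. Then $(\mathcal{R}\otimes_{\mathbb{C}}\mathbb{C})/J$ is isomorphic to $\mathcal{M}$ as left $\mathcal{R}$-modules. (3) Let $J'$ be the left $\mathcal{R}$-submodule of $\mathcal{R}\otimes_{\mathbb{C}}\mathbb{C}\Delta$ generated by $\delta\otimes\Delta$. Then $(\mathcal{R}\otimes_{\mathbb{C}}\mathbb{C}\Delta)/J'$ is isomorphic to $\mathcal{S}$ as left $\mathcal{R}$-modules. (4) There is a $\mathbb{C}$-algebra embedding of $\mathcal{R}$ into the Weyl algebra $A_2(\mathbb{C})$ generated by $x,y,\partial/\partial x,\partial/\partial y$.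
   Context: Let $\mathrm{Hol}$ be the space of holomorphic functions on the upper half plane, $q=e^{2\pi iz}$, $f'=\frac{1}{2\pi i}\frac{df}{dz}$, and $E_2,E_4,E_6$ the Eisenstein series with constant term $1$; $\Delta=\frac{1}{1728}(E_4^3-E_6^2)$. For $k\in\mathbb{R}$ let $D_kf=f'-\frac{k}{12}E_2f$. Let $H=\bigoplus_{n\in\mathbb{R}}H_n$ where each $H_n$ is a copy of $\mathrm{Hol}$, elements of $H_n$ being written $(f,n)$; $H$ is a graded commutative $\mathbb{C}$-algebra via $(f,n)(g,m)=(fg,n+m)$. Let $\mathrm{End}(H)=\bigoplus_{i\in\mathbb{R}}\mathrm{End}^i(H)$, where $\mathrm{End}^i(H)$ consists of the $\mathbb{C}$-linear maps sending $H_n$ into $H_{n+i}$ for all $n$. Define $\delta(f,n)=(D_nf,n+2)$, $e_4(f,n)=(E_4f,n+4)$, $e_6(f,n)=(E_6f,n+6)$, and let $\mathcal{R}$ be the $\mathbb{C}$-subalgebra of $\mathrm{End}(H)$ generated by $\delta,e_4,e_6$; $H$ is a left $\mathcal{R}$-module. $\mathcal{M}=\mathbb{C}[E_4,E_6]=\bigoplus_n\mathcal{M}_n$ (holomorphic modular forms of level one, $\mathcal{M}_n$ viewed inside $H_n$) and $\mathcal{S}=\Delta\mathcal{M}$ (cusp forms) are left $\mathcal{R}$-submodules of $H$. In (2), $\mathcal{R}\otimes_{\mathbb{C}}\mathbb{C}$ carries the left $\mathcal{R}$-module structure by left multiplication, with $\mathbb{C}=\mathcal{M}_0$; in (3), $\mathbb{C}\Delta\subset\mathcal{M}_{12}$.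 *)

(* Defs.v *)
From Stdlib Require Import Reals List Arith ClassicalEpsilon.
From Coquelicot Require Import Coquelicot.
Open Scope C_scope.

Definition UHP (z : C) : Prop := (0 < Im z)%R.

Definition cdiff (f : C -> C) (z : C) : Prop :=
  @ex_derive C_AbsRing C_NormedModule f z.

(* d/dz (chosen by classical choice; it is the genuine complex derivative
   wherever f is complex differentiable) *)
Definition cderiv (f : C -> C) (z : C) : C :=
  epsilon (inhabits (RtoC 0%R))
    (fun l => @is_derive C_AbsRing C_NormedModule f z l).

(* Hol: holomorphic functions on the upper half plane.  A function on the
   upper half plane is represented by any f : C -> C; only its values on UHP
   matter (equality in Hol is equality on UHP, see [Heq] below). *)
Definition isHol (f : C -> C) : Prop := forall z, UHP z -> cdiff f z.

Definition csum (a : nat -> C) : C :=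
  (Series (fun n => Re (a n)), Series (fun n => Im (a n))).

(* q^n = e^{2 pi i n z} *)
Definition qpow (n : nat) (z : C) : C :=
  (exp (- 2 * PI * INR n * Im z) * cos (2 * PI * INR n * Re z),
   exp (- 2 * PI * INR n * Im z) * sin (2 * PI * INR n * Re z))%R.

Definition sigma (k n : nat) : R :=
  sum_f_R0 (fun d => if Nat.eqb (n mod (S d)) 0 then (INR (S d) ^ k)%R else 0%R)
           (n - 1).

Definition E2 (z : C) : C :=
  RtoC 1 + RtoC (-24) * csum (fun n => RtoC (sigma 1 (S n)) * qpow (S n) z).
Definition E4 (z : C) : C :=
  RtoC 1 + RtoC 240 * csum (fun n => RtoC (sigma 3 (S n)) * qpow (S n) z).
Definition E6 (z : C) : C :=
  RtoC 1 + RtoC (-504) * csum (fun n => RtoC (sigma 5 (S n)) * qpow (S n) z).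
Definition Delta (z : C) : C :=
  RtoC (1 / 1728) * (E4 z * E4 z * E4 z - E6 z * E6 z).

(* f' = (1 / 2 pi i) df/dz, and D_k f = f' - (k/12) E2 f *)
Definition dq (f : C -> C) (z : C) : C :=
  ((0%R, (- / (2 * PI))%R) : C) * cderiv f z.
Definition Dk (k : R) (f : C -> C) (z : C) : C :=
  dq f z - RtoC (k / 12) * (E2 z * f z).

(* raw elements: h n is the H_n-component *)
Definition RawH := R -> C -> C.

Definition isH (h : RawH) : Prop :=
  (forall n, isHol (h n)) /\
  (exists s : list R, forall n, ~ In n s -> forall z, UHP z -> h n z = RtoC 0).

Definition Heq (h h' : RawH) : Prop := forall n z, UHP z -> h n z = h' n z.

Definition Hzero : RawH := fun _ _ => RtoC 0.
Definition Hadd (h h' : RawH) : RawH := fun n z => h n z + h' n z.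
Definition Hscale (c : C) (h : RawH) : RawH := fun n z => c * h n z.

Definition RawOp := RawH -> RawH.

(* delta (f, n) = (D_n f, n + 2) *)
Definition delta : RawOp := fun h m => Dk (m - 2) (h (m - 2)%R).
(* e4 (f, n) = (E4 f, n + 4),  e6 (f, n) = (E6 f, n + 6) *)
Definition e4 : RawOp := fun h m z => E4 z * h (m - 4)%R z.
Definition e6 : RawOp := fun h m z => E6 z * h (m - 6)%R z.

Definition opid : RawOp := fun h => h.
Definition opzero : RawOp := fun _ => Hzero.
Definition opadd (P Q : RawOp) : RawOp := fun h => Hadd (P h) (Q h).
Definition opscale (c : C) (P : RawOp) : RawOp := fun h => Hscale c (P h).
Definition opcomp (P Q : RawOp) : RawOp := fun h => P (Q h).

Inductive inR : RawOp -> Prop :=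
| inR_scal (c : C) : inR (opscale c opid)
| inR_delta : inR delta
| inR_e4 : inR e4
| inR_e6 : inR e6
| inR_add P Q : inR P -> inR Q -> inR (opadd P Q)
| inR_comp P Q : inR P -> inR Q -> inR (opcomp P Q).

Definition opeq (P Q : RawOp) : Prop := forall h, isH h -> Heq (P h) (Q h).

Definition Rsum (l : list RawH) : RawH := fold_right Hadd Hzero l.

Definition monoM (a b : nat) : RawH :=
  fun n z => if Req_EM_T n (INR (4 * a + 6 * b)) then E4 z ^ a * E6 z ^ b
             else RtoC 0.
Definition monoS (a b : nat) : RawH :=
  fun n z => if Req_EM_T n (INR (12 + 4 * a + 6 * b))
             then Delta z * (E4 z ^ a * E6 z ^ b) else RtoC 0.

Definition inM (h : RawH) : Prop :=
  exists l : list (C * nat * nat),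
    Heq h (Rsum (map (fun t => let '(c, a, b) := t in Hscale c (monoM a b)) l)).
Definition inS (h : RawH) : Prop :=
  exists l : list (C * nat * nat),
    Heq h (Rsum (map (fun t => let '(c, a, b) := t in Hscale c (monoS a b)) l)).

(* noncommutative polynomials: coefficient functions on words; letters
   0 = x, 1 = y, 2 = d *)
Definition NCP := list nat -> C.

Definition isNCP (p : NCP) : Prop :=
  (exists s : list (list nat), forall w, ~ In w s -> p w = RtoC 0) /\
  (forall w, p w <> RtoC 0 -> List.Forall (fun i : nat => (i < 3)%nat) w).

Fixpoint sumC (f : nat -> C) (n : nat) : C :=
  match n with O => RtoC 0 | S m => sumC f m + f m end.

Definition ncadd (p q : NCP) : NCP := fun w => p w + q w.
Definition ncscale (c : C) (p : NCP) : NCP := fun w => c * p w.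
Definition ncmul (p q : NCP) : NCP :=
  fun w => sumC (fun k => p (firstn k w) * q (skipn k w)) (S (length w)).
Definition ncword (u : list nat) : NCP :=
  fun w => if list_eq_dec Nat.eq_dec w u then RtoC 1 else RtoC 0.
Definition ncone : NCP := ncword nil.
Definition ncx : NCP := ncword (0 :: nil)%nat.
Definition ncy : NCP := ncword (1 :: nil)%nat.
Definition ncd : NCP := ncword (2 :: nil)%nat.
Definition ncsub (p q : NCP) : NCP := ncadd p (ncscale (RtoC (-1)) q).
Definition nccomm (p q : NCP) : NCP := ncsub (ncmul p q) (ncmul q p).

Definition rel (j : nat) : NCP :=
  match j with
  | O => nccomm ncx ncy
  | 1 => ncadd (nccomm ncd ncx) (ncscale (RtoC (1 / 3)) ncy)
  | _ => ncadd (nccomm ncd ncy) (ncscale (RtoC (1 / 2)) (ncmul ncx ncx))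
  end.

Inductive inI : NCP -> Prop :=
| inI_zero : inI (fun _ => RtoC 0)
| inI_gen (a b : NCP) (j : nat) :
    isNCP a -> isNCP b -> (j < 3)%nat -> inI (ncmul (ncmul a (rel j)) b)
| inI_add p q : inI p -> inI q -> inI (ncadd p q).

(* A_2(C) realized (faithfully) as the algebra of operators on C[[x,y]]
   generated by x, y, d/dx, d/dy; a series is its coefficient array. *)
Definition PS := nat -> nat -> C.
Definition WOp := PS -> PS.

Definition Wx : WOp := fun f i j => match i with O => RtoC 0 | S i' => f i' j end.
Definition Wy : WOp := fun f i j => match j with O => RtoC 0 | S j' => f i j' end.
Definition Wdx : WOp := fun f i j => RtoC (INR (S i)) * f (S i) j.
Definition Wdy : WOp := fun f i j => RtoC (INR (S j)) * f i (S j).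
Definition Wscale (c : C) (P : WOp) : WOp := fun f i j => c * P f i j.
Definition Wadd (P Q : WOp) : WOp := fun f i j => P f i j + Q f i j.
Definition Wcomp (P Q : WOp) : WOp := fun f => P (Q f).
Definition Wid : WOp := fun f => f.

Inductive inA2 : WOp -> Prop :=
| inA2_scal (c : C) : inA2 (Wscale c Wid)
| inA2_x : inA2 Wx
| inA2_y : inA2 Wy
| inA2_dx : inA2 Wdx
| inA2_dy : inA2 Wdy
| inA2_add P Q : inA2 P -> inA2 Q -> inA2 (Wadd P Q)
| inA2_comp P Q : inA2 P -> inA2 Q -> inA2 (Wcomp P Q).

(* Main.v *)
(* The relations of T(V)/I hold in R by Ramanujan's identities D_4 E_4 = -E_6/3 and
   D_6 E_6 = -E_4^2/2; compared coefficientwise these are formulas for the convolution sums of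
   sigma_1 * sigma_3, sigma_1 * sigma_5 and sigma_3 * sigma_3, which follow from a bijection between
   solutions of ax + by = n.  Composing delta with itself also requires that the derivative of an
   arbitrary holomorphic function be holomorphic (Goursat and Cauchy on a rectangle).

   Modulo I every element is a combination of the monomials x^a y^b d^k.  Commuting with x lowers
   the degree in d and multiplies the leading coefficient by a nonzero multiple of y, so a two-sided
   ideal that contains I and meets C[x,y] in 0 equals I.  The kernel of T(V) -> R is such an ideal
   because E_4 and E_6 are algebraically independent, and so is the kernel of the map to A_2(C)
   with x |-> x, y |-> y, d |-> -(y/3) d/dx - (x^2/2) d/dy; this gives (1) and (4).  In (2) and (3)
   delta kills the generator u (1 or Delta), and splitting p = p_0(x,y) + p_1 d shows that p u = 0
   forces p_0 = 0. *)

Require Import Defs.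
From Stdlib Require Import Reals List Arith Lra Lia Permutation ClassicalEpsilon FunctionalExtensionality.
From Coquelicot Require Import Coquelicot.
Import ListNotations.
Open Scope C_scope.

(** E2, E4 and E6 enter only as q-series with coefficients of polynomial growth, so Ramanujan's
    identities become identities between divisor sums. The summed polynomials, powers of u^2 - uv +
    v^2 and the square of uv(u - v), are invariant under (u,v) -> (v,u) and (u,v) -> (u,u - v),
    which is what the bijection asks for; their parts odd in v contain the wanted products.

    T(V)/I is the Ore extension of C[x,y] by the derivation D with D x = -y/3 and D y = -x^2/2. This
    accounts for the normal monomials with d on the right, and for the map to the Weyl algebra,
    which sends d to D itself.

    Operators in R are compared only on elements of H, and functions only on the upper half plane,
    so R is a quotient by [opeq]. The embedding in (4) is therefore defined by choosing a preimage
    in T(V); the choice is harmless because both maps out of T(V) have the kernel I. The grading of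
    H is what splits a relation between E4 and E6 into isobaric relations. *)

Notation prop_dec := excluded_middle_informative.
Tactic Notation "funext" ident(x) := apply functional_extensionality; intros x.
Ltac C_ring := apply injective_projections; simpl; ring.
Ltac C_field := apply injective_projections; simpl; field.

(** * Complex differentiability *)

Lemma Cmod_le_abs (z : C) : (Cmod z <= Rabs (Re z) + Rabs (Im z))%R.
Proof.
  replace z with (RtoC (Re z) + (Ci * RtoC (Im z))) at 1
    by (destruct z as [a b]; C_ring).
  eapply Rle_trans. { apply Cmod_triangle. }
  rewrite Cmod_mult, !Cmod_R, Cmod_Ci. lra.
Qed.

Lemma im_le_Cmod (z : C) : (Rabs (Im z) <= Cmod z)%R.
Proof. destruct z; apply Rle_trans with (2 := Rmax_Cmod _). apply Rmax_r. Qed.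

(** The increment h = 0 is not excluded, so [ctend g l] forces [g 0 = l]: this is continuity at 0,
    as Caratheodory's slope functions require, and not a punctured limit. *)
Definition ctend (g : C -> C) (l : C) : Prop :=
  forall eps : R, (0 < eps)%R -> exists d : R, (0 < d)%R /\
    forall h : C, (Cmod h < d)%R -> (Cmod (g h - l) < eps)%R.

Lemma ctend_const c : ctend (fun _ => c) c.
Proof.
  intros e He. exists 1%R. split; [lra|]. intros h _.
  replace (c - c) with (RtoC 0) by ring. rewrite Cmod_0. lra.
Qed.

Lemma ctend_id : ctend (fun h => h) (RtoC 0).
Proof.
  intros e He. exists e. split; [lra|]. intros h Hh.
  now replace (h - RtoC 0) with h by ring.
Qed.

Lemma ctend_filterlim g l : ctend g l <->
  filterlim g (@locally (AbsRing_UniformSpace C_AbsRing) (RtoC 0)) (@locally (AbsRing_UniformSpace C_AbsRing) l).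
Proof.
  assert (B : forall d (h : C), @ball (AbsRing_UniformSpace C_AbsRing) (RtoC 0) d h <-> (Cmod h < d)%R).
  { intros d h. change (Cmod (h - 0) < d <-> Cmod h < d)%R. now replace (h - 0) with h by ring. }
  split.
  - intros H. apply (proj2 (@filterlim_locally C (AbsRing_UniformSpace C_AbsRing) _ _ g l)). intros e. destruct (H e (cond_pos e)) as [d [D E]].
    exists (mkposreal d D). intros h Hh. apply E. now apply B.
  - intros H e He. destruct (proj1 (@filterlim_locally C (AbsRing_UniformSpace C_AbsRing) _ _ g l) H (mkposreal e He)) as [d E].
    exists d. split; [apply cond_pos|]. intros h Hh. apply E. now apply B.
Qed.

Lemma ctend_plus f g a b : ctend f a -> ctend g b -> ctend (fun h => f h + g h) (a + b).
Proof.
  rewrite !ctend_filterlim. intros F G.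
  exact (filterlim_comp_2 _ _ _ F G (@filterlim_plus C_AbsRing (AbsRing_NormedModule C_AbsRing) a b)).
Qed.

Lemma ctend_mult f g a b : ctend f a -> ctend g b -> ctend (fun h => f h * g h) (a * b).
Proof.
  rewrite !ctend_filterlim. intros F G. exact (filterlim_comp_2 _ _ _ F G (@filterlim_mult C_AbsRing a b)).
Qed.

Lemma ctend_inv f (a : C) : a <> 0 -> ctend f a -> ctend (fun h => / f h) (/ a).
Proof.
  intros Ha Hf e He.
  assert (P : (0 < Cmod a)%R) by (apply Cmod_gt_0; assumption).
  destruct (Hf (Rmin (Cmod a / 2) (e * (Cmod a * Cmod a) / 2))%R) as [d [D H]].
  { apply Rmin_pos; [lra|]. assert (0 < e * (Cmod a * Cmod a))%R by (repeat apply Rmult_lt_0_compat; assumption). lra. }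
  exists d; split; [auto|]. intros h Hh. specialize (H h Hh).
  pose proof (Rmin_l (Cmod a / 2) (e * (Cmod a * Cmod a) / 2)).
  pose proof (Rmin_r (Cmod a / 2) (e * (Cmod a * Cmod a) / 2)).
  assert (Q : (Cmod a / 2 < Cmod (f h))%R).
  { assert (Cmod a <= Cmod (f h) + Cmod (f h - a))%R; [|lra].
    rewrite <- (Cmod_opp (f h - a)).
    replace a with (f h + - (f h - a)) at 1 by ring. apply Cmod_triangle. }
  assert (N : f h <> 0) by (apply Cmod_gt_0; lra).
  replace (/ f h - / a) with (- (f h - a) * (/ f h * / a)) by (field; auto).
  rewrite !Cmod_mult, Cmod_opp, !Cmod_inv by auto.
  set (u := Cmod (f h - a)) in *. set (A := Cmod a) in *. set (F := Cmod (f h)) in *.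
  apply Rmult_lt_reg_r with (F * A)%R. { nra. }
  replace (u * (/ F * / A) * (F * A))%R with u by (field; lra).
  assert (e * (A * A) / 2 < e * (F * A))%R; [|lra].
  assert (A * A < 2 * (F * A))%R by nra.
  assert (e * (A * A) < e * (2 * (F * A)))%R by (apply Rmult_lt_compat_l; lra). lra.
Qed.

Lemma ctend_near f g l d : (0 < d)%R -> (forall h : C, (Cmod h < d)%R -> f h = g h) ->
  ctend f l -> ctend g l.
Proof.
  intros Hd E Hf e He. destruct (Hf e He) as [d1 [D1 H1]].
  exists (Rmin d d1). split. { now apply Rmin_pos. }
  intros h Hh. rewrite <- E.
  - apply H1. eapply Rlt_le_trans; [exact Hh|apply Rmin_r].
  - eapply Rlt_le_trans; [exact Hh|apply Rmin_l].
Qed.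

(* Caratheodory's form of complex differentiability. *)
Definition cder (f : C -> C) (z l : C) : Prop :=
  exists phi, (exists d, (0 < d)%R /\ forall h : C, (Cmod h < d)%R -> f (z + h)%C = f z + phi h * h)
    /\ ctend phi l.

Lemma cder_estim f z l : cder f z l -> forall eps, (0 < eps)%R ->
  exists d, (0 < d)%R /\ forall h : C, (Cmod h < d)%R ->
    (Cmod (f (z + h)%C - f z - l * h) <= eps * Cmod h)%R.
Proof.
  intros [phi [[d [D E]] T]] e He.
  destruct (T e He) as [d1 [D1 H1]].
  exists (Rmin d d1). split. { now apply Rmin_pos. }
  intros h Hh. rewrite E by (eapply Rlt_le_trans; [exact Hh|apply Rmin_l]).
  replace (f z + phi h * h - f z - l * h) with ((phi h - l) * h) by ring.
  rewrite Cmod_mult. apply Rmult_le_compat_r. { apply Cmod_ge_0. }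
  left. apply H1. eapply Rlt_le_trans; [exact Hh|apply Rmin_r].
Qed.

Lemma cder_of_estim f z l : (forall eps, (0 < eps)%R ->
  exists d, (0 < d)%R /\ forall h : C, (Cmod h < d)%R ->
    (Cmod (f (z + h)%C - f z - l * h) <= eps * Cmod h)%R) -> cder f z l.
Proof.
  intros H.
  exists (fun h : C => if prop_dec (h = 0) then l else (f (z + h)%C - f z) / h).
  split.
  - exists 1%R. split; [lra|]. intros h _.
    destruct (prop_dec (h = 0)) as [->|N].
    + rewrite Cplus_0_r. ring.
    + field; auto.
  - intros e He. destruct (H (e / 2)%R) as [d [D E]]; [lra|].
    exists d. split; [auto|]. intros h Hh.
    destruct (prop_dec (h = 0)) as [->|N].
    + replace (l - l) with (RtoC 0) by ring. rewrite Cmod_0; auto.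
    + assert (P : (0 < Cmod h)%R) by (apply Cmod_gt_0; assumption).
      replace ((f (z + h)%C - f z) / h - l) with ((f (z + h)%C - f z - l * h) * / h) by (field; auto).
      rewrite Cmod_mult, Cmod_inv by auto.
      specialize (E h Hh).
      apply Rmult_lt_reg_r with (Cmod h); auto.
      rewrite Rmult_assoc, Rinv_l by lra. nra.
Qed.

(** Differentiation under the integral sign and termwise differentiation both deliver a remainder of
    second order; this lemma turns it into a derivative. *)
Lemma cder_quadratic f z l d K : (0 < d)%R -> (0 <= K)%R ->
  (forall h : C, (Cmod h < d)%R -> (Cmod (f (z + h)%C - f z - l * h) <= K * (Cmod h * Cmod h))%R) ->
  cder f z l.
Proof.
  intros Hd HK H. apply cder_of_estim. intros e He.
  exists (Rmin d (e / (K + 1))). split.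
  { apply Rmin_pos; auto. apply Rdiv_lt_0_compat; lra. }
  intros h Hh. eapply Rle_trans.
  { apply H. eapply Rlt_le_trans; [exact Hh|apply Rmin_l]. }
  assert (Cmod h < e / (K + 1))%R by (eapply Rlt_le_trans; [exact Hh|apply Rmin_r]).
  assert ((e / (K + 1)) * (K + 1) = e)%R by (field; lra).
  pose proof (Cmod_ge_0 h). rewrite <- Rmult_assoc. apply Rmult_le_compat_r; auto.
  nra.
Qed.

Lemma Cplus_minus_r (z y : C) : z + (y - z) = y.
Proof. ring. Qed.

Lemma cder_is_derive f z l : cder f z l <-> @is_derive C_AbsRing C_NormedModule f z l.
Proof.
  split.
  - intros H. split.
    + apply @is_linear_scal_l.
    + intros x Hx e.
      assert (Ex : z = x).
      { apply (@is_filter_lim_locally_unique C_AbsRing (AbsRing_NormedModule C_AbsRing) z x). exact Hx. }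
      subst x.
      destruct (cder_estim _ _ _ H e (cond_pos e)) as [d [D E]].
      exists (mkposreal d D). intros y Hy.
      specialize (E (y - z)). rewrite (Cplus_minus_r z y) in E.
      assert (Hy' : (Cmod (y - z) < d)%R) by exact Hy.
      specialize (E Hy').
      change (Cmod (f y - f z - (y - z) * l) <= e * Cmod (y - z))%R.
      rewrite (Cmult_comm _ l). exact E.
  - intros [_ H]. apply cder_of_estim. intros e He.
    specialize (H z).
    destruct (H (fun P HP => HP) (mkposreal e He)) as [d Hd].
    exists d. split; [apply cond_pos|]. intros h Hh.
    specialize (Hd (z + h)).
    assert (B : @ball (AbsRing_UniformSpace C_AbsRing) z d (z + h)).
    { change (Cmod (z + h - z) < d)%R. now replace (z + h - z) with h by ring. }
    specialize (Hd B).
    change (Cmod (f (z + h)%C - f z - (z + h - z) * l) <= e * Cmod (z + h - z))%R in Hd.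
    replace (z + h - z) with h in Hd by ring. now rewrite (Cmult_comm l).
Qed.

Lemma cder_unique f z l l' : cder f z l -> cder f z l' -> l = l'.
Proof.
  intros H H'. apply cder_is_derive in H, H'.
  rewrite <- (is_C_derive_unique f z l), <- (is_C_derive_unique f z l'); auto.
Qed.

Lemma cder_cderiv f z l : cder f z l -> cderiv f z = l.
Proof.
  intros H. apply (cder_unique f z); auto. apply cder_is_derive.
  unfold cderiv. apply epsilon_spec. exists l. now apply cder_is_derive.
Qed.

Lemma cdiff_cder f z : cdiff f z <-> exists l, cder f z l.
Proof.
  split; intros [l H]; exists l; now apply cder_is_derive.
Qed.

Lemma cder_ctend f z l : cder f z l -> ctend (fun h => f (z + h)%C) (f z).
Proof.
  intros [phi [[d [D E]] T]].
  apply ctend_near with (f := fun h => f z + phi h * h) (d := d); auto.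
  - intros h Hh. symmetry. auto.
  - assert (R : ctend (fun h => f z + phi h * h) (f z + l * RtoC 0)).
    { apply ctend_plus; [apply ctend_const|]. apply ctend_mult; auto. apply ctend_id. }
    now replace (f z + l * RtoC 0) with (f z) in R by ring.
Qed.

Lemma cder_near f g z l d : (0 < d)%R -> (forall h : C, (Cmod h < d)%R -> f (z + h)%C = g (z + h)%C) ->
  cder f z l -> cder g z l.
Proof.
  intros Hd E [phi [[d1 [D1 E1]] T]].
  exists phi; split; auto. exists (Rmin d d1). split. { now apply Rmin_pos. }
  intros h Hh.
  assert (E0 : f z = g z).
  { specialize (E 0). rewrite Cplus_0_r in E. apply E. now rewrite Cmod_0. }
  rewrite <- E, <- E0.
  - apply E1. eapply Rlt_le_trans; [exact Hh|apply Rmin_r].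
  - eapply Rlt_le_trans; [exact Hh|apply Rmin_l].
Qed.

Lemma cder_const c z : cder (fun _ => c) z 0.
Proof.
  exists (fun _ => RtoC 0). split; [|apply ctend_const].
  exists 1%R. split; [lra|]. intros; ring.
Qed.

Lemma cder_id z : cder (fun w => w) z 1.
Proof.
  exists (fun _ => RtoC 1). split; [|apply ctend_const].
  exists 1%R. split; [lra|]. intros; ring.
Qed.

Lemma cder_plus f g z a b : cder f z a -> cder g z b -> cder (fun w => f w + g w) z (a + b).
Proof.
  intros [phi [[d [D E]] T]] [psi [[d1 [D1 E1]] T1]].
  exists (fun h => phi h + psi h). split; [|now apply ctend_plus].
  exists (Rmin d d1). split. { now apply Rmin_pos. }
  intros h Hh. rewrite E, E1. ring.
  - eapply Rlt_le_trans; [exact Hh|apply Rmin_r].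
  - eapply Rlt_le_trans; [exact Hh|apply Rmin_l].
Qed.

Lemma cder_mult f g z a b : cder f z a -> cder g z b ->
  cder (fun w => f w * g w) z (a * g z + f z * b).
Proof.
  intros Hf Hg. pose proof (cder_ctend _ _ _ Hg) as Cg.
  destruct Hf as [phi [[d [D E]] T]]. destruct Hg as [psi [[d1 [D1 E1]] T1]].
  exists (fun h => phi h * g (z + h)%C + f z * psi h). split.
  - exists (Rmin d d1). split. { now apply Rmin_pos. }
    intros h Hh. rewrite E, E1. ring.
    + eapply Rlt_le_trans; [exact Hh|apply Rmin_r].
    + eapply Rlt_le_trans; [exact Hh|apply Rmin_l].
  - apply ctend_plus; apply ctend_mult; auto. apply ctend_const.
Qed.

Lemma cder_inv (f : C -> C) z a : f z <> 0 -> cder f z a -> cder (fun w => / f w) z (- a * / (f z * f z)).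
Proof.
  intros N Hf. pose proof (cder_ctend _ _ _ Hf) as Cf.
  destruct Hf as [phi [[d [D E]] T]].
  destruct (Cf (Cmod (f z))) as [d1 [D1 H1]]. { apply Cmod_gt_0; assumption. }
  exists (fun h => - (1) * phi h * / (f z * f (z + h)%C)). split.
  - exists (Rmin d d1). split. { now apply Rmin_pos. }
    intros h Hh.
    assert (N1 : f (z + h)%C <> 0).
    { intros A. specialize (H1 h (Rlt_le_trans _ _ _ Hh (Rmin_r _ _))).
      rewrite A in H1. replace (0 - f z) with (- f z) in H1 by ring.
      rewrite Cmod_opp in H1. lra. }
    assert (P : phi h * h = f (z + h)%C - f z).
    { rewrite E. ring. eapply Rlt_le_trans; [exact Hh|apply Rmin_l]. }
    replace (- (1) * phi h * / (f z * f (z + h)%C) * h)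
      with (- (1) * (phi h * h) * / (f z * f (z + h)%C)) by ring.
    rewrite P. field. auto.
  - replace (- a * / (f z * f z)) with (- (1) * a * / (f z * f z)) by ring.
    apply ctend_mult. { apply ctend_mult; auto. apply ctend_const. }
    apply ctend_inv. { now apply Cmult_neq_0. }
    apply ctend_mult; auto. apply ctend_const.
Qed.

Lemma cder_eq f z l l' : cder f z l -> l = l' -> cder f z l'.
Proof. now intros H <-. Qed.

Lemma cder_scale c f z a : cder f z a -> cder (fun w => c * f w) z (c * a).
Proof.
  intros H. eapply cder_eq. { apply cder_mult. apply cder_const. exact H. } cbv beta. ring.
Qed.

(** * Goursat's theorem *)

Definition cint (p : R -> C) (a b : R) : C :=
  (RInt (fun t => Re (p t)) a b, RInt (fun t => Im (p t)) a b).

Definition ccont (p : R -> C) (t : R) : Prop :=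
  continuous (fun t => Re (p t)) t /\ continuous (fun t => Im (p t)) t.

Definition ccont_on (p : R -> C) (a b : R) : Prop := forall t, (a <= t <= b)%R -> ccont p t.

Lemma ccont_on_ex p a b : (a <= b)%R -> ccont_on p a b ->
  ex_RInt (fun t => Re (p t)) a b /\ ex_RInt (fun t => Im (p t)) a b.
Proof.
  intros H C; split; apply @ex_RInt_continuous; rewrite Rmin_left, Rmax_right by auto; intros z Hz.
  - exact (proj1 (C z Hz)).
  - exact (proj2 (C z Hz)).
Qed.

Lemma cint_plus p q a b : (a <= b)%R -> ccont_on p a b -> ccont_on q a b ->
  cint (fun t => p t + q t) a b = cint p a b + cint q a b.
Proof.
  intros H P Q.
  destruct (ccont_on_ex _ _ _ H P). destruct (ccont_on_ex _ _ _ H Q).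
  apply injective_projections; simpl; symmetry.
  - rewrite <- (RInt_plus (V:=R_CompleteNormedModule)); auto.
  - rewrite <- (RInt_plus (V:=R_CompleteNormedModule)); auto.
Qed.

Lemma cint_scale c p a b : (a <= b)%R -> ccont_on p a b ->
  cint (fun t => c * p t) a b = c * cint p a b.
Proof.
  intros H P.
  destruct (ccont_on_ex _ _ _ H P) as [E1 E2]. destruct c as [u v].
  apply injective_projections; simpl.
  - transitivity (RInt (fun t => minus (scal u (Re (p t))) (scal v (Im (p t)))) a b).
    { reflexivity. }
    rewrite (RInt_minus (V:=R_CompleteNormedModule)), !(RInt_scal (V:=R_CompleteNormedModule)); auto;
      now apply @ex_RInt_scal.
  - transitivity (RInt (fun t => plus (scal u (Im (p t))) (scal v (Re (p t)))) a b).
    { reflexivity. }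
    rewrite (RInt_plus (V:=R_CompleteNormedModule)), !(RInt_scal (V:=R_CompleteNormedModule)); auto;
      now apply @ex_RInt_scal.
Qed.

Lemma cint_Chasles p a b c : (a <= b)%R -> (b <= c)%R -> ccont_on p a c ->
  cint p a c = cint p a b + cint p b c.
Proof.
  intros H1 H2 P.
  assert (P1 : ccont_on p a b) by (intros t Ht; apply P; lra).
  assert (P2 : ccont_on p b c) by (intros t Ht; apply P; lra).
  destruct (ccont_on_ex _ _ _ H1 P1). destruct (ccont_on_ex _ _ _ H2 P2).
  apply injective_projections; simpl; symmetry;
  apply (RInt_Chasles (V:=R_CompleteNormedModule)); auto.
Qed.

Lemma cint_ext p q a b : (a <= b)%R -> (forall t, (a <= t <= b)%R -> p t = q t) -> cint p a b = cint q a b.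
Proof.
  intros H E. apply injective_projections; simpl; apply RInt_ext;
  rewrite Rmin_left, Rmax_right by auto; intros x Hx; rewrite E; auto; lra.
Qed.

(** The factor 2 comes from bounding real and imaginary part separately. *)
Lemma cint_bound p a b M : (a <= b)%R -> ccont_on p a b ->
  (forall t, (a <= t <= b)%R -> (Cmod (p t) <= M)%R) -> (Cmod (cint p a b) <= 2 * M * (b - a))%R.
Proof.
  intros H P B. destruct (ccont_on_ex _ _ _ H P) as [E1 E2].
  eapply Rle_trans. { apply Cmod_le_abs. }
  unfold cint. simpl.
  assert (Rabs (RInt (fun t => Re (p t)) a b) <= M * (b - a))%R.
  { rewrite Rmult_comm. apply abs_RInt_le_const; auto. intros t Ht. eapply Rle_trans. apply re_le_Cmod. auto. }
  assert (Rabs (RInt (fun t => Im (p t)) a b) <= M * (b - a))%R.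
  { rewrite Rmult_comm. apply abs_RInt_le_const; auto. intros t Ht. eapply Rle_trans. apply im_le_Cmod. auto. }
  lra.
Qed.

Lemma RInt_affine u v a b : RInt (fun t => u + v * t)%R a b = ((u * b + v * b * b / 2) - (u * a + v * a * a / 2))%R.
Proof.
  apply is_RInt_unique.
  apply (is_RInt_derive (V:=R_CompleteNormedModule) (fun t => u * t + v * t * t / 2)%R).
  - intros x _. auto_derive; auto. field.
  - intros x _. apply @continuous_plus. apply continuous_const.
    apply (continuous_scal_r (V:=R_NormedModule) v (fun t => t)). apply continuous_id.
Qed.

Lemma cint_affine (u v : C) a b :
  cint (fun t => u + v * RtoC t) a b = u * RtoC (b - a) + v * RtoC ((b * b - a * a) / 2).
Proof.
  destruct u as [u1 u2], v as [v1 v2].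
  apply injective_projections; simpl.
  - rewrite (RInt_ext _ (fun t => u1 + v1 * t)%R) by (intros; simpl; ring).
    rewrite RInt_affine. field.
  - rewrite (RInt_ext _ (fun t => u2 + v2 * t)%R) by (intros; simpl; ring).
    rewrite RInt_affine. field.
Qed.

(** * Integrals along the boundary of a rectangle *)

Definition contR (f : C -> C) (x1 x2 y1 y2 : R) : Prop :=
  forall x y, (x1 <= x <= x2)%R -> (y1 <= y <= y2)%R -> ctend (fun h => f ((x, y) + h)%C) (f (x, y)).

Lemma ctend_ccont (p : R -> C) t :
  (forall e, (0 < e)%R -> exists d, (0 < d)%R /\ forall s, (Rabs (s - t) < d)%R -> (Cmod (p s - p t) < e)%R) ->
  ccont p t.
Proof.
  intros H. split; apply (proj2 (filterlim_locally (F := locally t) _ _));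
  intros e; destruct (H e (cond_pos e)) as [d [D E]]; exists (mkposreal d D);
  intros s Hs; specialize (E s Hs).
  - eapply Rle_lt_trans; [|exact E]. change (Rabs (Re (p s) - Re (p t)) <= Cmod (p s - p t))%R.
    apply (re_le_Cmod (p s - p t)).
  - eapply Rle_lt_trans; [|exact E]. change (Rabs (Im (p s) - Im (p t)) <= Cmod (p s - p t))%R.
    apply (im_le_Cmod (p s - p t)).
Qed.

Lemma Cmod_axis_x a : Cmod (a, 0%R) = Rabs a.
Proof. apply Cmod_R. Qed.

Lemma Cmod_axis_y a : Cmod (0%R, a) = Rabs a.
Proof.
  replace (0%R, a) with (Ci * RtoC a) by (C_ring).
  rewrite Cmod_mult, Cmod_Ci, Cmod_R. ring.
Qed.

Lemma ctend_slice_H f a b y : (forall t, (a <= t <= b)%R -> ctend (fun h => f ((t, y) + h)%C) (f (t, y))) ->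
  ccont_on (fun t => f (t, y)) a b.
Proof.
  intros C x Hx. apply ctend_ccont. intros e He.
  destruct (C x Hx e He) as [d [D E]]. exists d. split; auto.
  intros s Hs. specialize (E ((s - x)%R, 0%R)). rewrite Cmod_axis_x in E.
  specialize (E Hs). replace ((x, y) + ((s - x)%R, 0%R)) with (s, y) in E; auto.
  C_ring.
Qed.

Lemma ctend_slice_V f a b x : (forall t, (a <= t <= b)%R -> ctend (fun h => f ((x, t) + h)%C) (f (x, t))) ->
  ccont_on (fun t => f (x, t)) a b.
Proof.
  intros C y Hy. apply ctend_ccont. intros e He.
  destruct (C y Hy e He) as [d [D E]]. exists d. split; auto.
  intros s Hs. specialize (E (0%R, (s - y)%R)). rewrite Cmod_axis_y in E.
  specialize (E Hs). replace ((x, y) + (0%R, (s - y)%R)) with (x, s) in E; auto.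
  C_ring.
Qed.

Lemma contR_H f x1 x2 y1 y2 y : contR f x1 x2 y1 y2 -> (y1 <= y <= y2)%R ->
  ccont_on (fun t => f (t, y)) x1 x2.
Proof. intros C Hy. apply ctend_slice_H. intros; apply C; auto. Qed.

Lemma contR_V f x1 x2 y1 y2 x : contR f x1 x2 y1 y2 -> (x1 <= x <= x2)%R ->
  ccont_on (fun t => f (x, t)) y1 y2.
Proof. intros C Hx. apply ctend_slice_V. intros; apply C; auto. Qed.

Definition bdry (x1 x2 y1 y2 x y : R) : Prop :=
  (x1 <= x <= x2)%R /\ (y1 <= y <= y2)%R /\ (x = x1 \/ x = x2 \/ y = y1 \/ y = y2).

(** Continuity is asked at boundary points only, because it must also hold for kernels such as 1/(z
    - w) with a pole inside the rectangle. *)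
Definition bcont (f : C -> C) (x1 x2 y1 y2 : R) : Prop :=
  forall x y, bdry x1 x2 y1 y2 x y -> ctend (fun h => f ((x, y) + h)%C) (f (x, y)).

Lemma contR_bcont f x1 x2 y1 y2 : contR f x1 x2 y1 y2 -> bcont f x1 x2 y1 y2.
Proof. intros C x y (A & B & _). now apply C. Qed.

Lemma bcont_edges f x1 x2 y1 y2 : (x1 <= x2)%R -> (y1 <= y2)%R -> bcont f x1 x2 y1 y2 ->
  ccont_on (fun t => f (t, y1)) x1 x2 /\ ccont_on (fun t => f (t, y2)) x1 x2 /\
  ccont_on (fun t => f (x1, t)) y1 y2 /\ ccont_on (fun t => f (x2, t)) y1 y2.
Proof.
  intros Hx Hy B.
  split; [apply ctend_slice_H|split; [apply ctend_slice_H|split; apply ctend_slice_V]];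
    intros t Ht; apply B; repeat split; try lra; tauto.
Qed.

Lemma contR_sub f x1 x2 y1 y2 a1 a2 b1 b2 : contR f x1 x2 y1 y2 ->
  (x1 <= a1)%R -> (a2 <= x2)%R -> (y1 <= b1)%R -> (b2 <= y2)%R -> contR f a1 a2 b1 b2.
Proof. intros C ? ? ? ? x y Hx Hy. apply C; lra. Qed.

(** The contour runs counterclockwise: bottom, right, top, left. The factor [Ci] is dz/dt on the
    vertical edges. *)
Definition oint (f : C -> C) (x1 x2 y1 y2 : R) : C :=
  cint (fun t => f (t, y1)) x1 x2 + Ci * cint (fun t => f (x2, t)) y1 y2
  - cint (fun t => f (t, y2)) x1 x2 - Ci * cint (fun t => f (x1, t)) y1 y2.

Lemma oint_split_x f x1 m x2 y1 y2 : (x1 <= m)%R -> (m <= x2)%R -> (y1 <= y2)%R ->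
  contR f x1 x2 y1 y2 -> oint f x1 x2 y1 y2 = oint f x1 m y1 y2 + oint f m x2 y1 y2.
Proof.
  intros H1 H2 Hy C. unfold oint.
  rewrite (cint_Chasles (fun t => f (t, y1)) x1 m x2), (cint_Chasles (fun t => f (t, y2)) x1 m x2); auto.
  - ring.
  - apply (contR_H f x1 x2 y1 y2); auto; lra.
  - apply (contR_H f x1 x2 y1 y2); auto; lra.
Qed.

Lemma oint_split_y f x1 x2 y1 m y2 : (y1 <= m)%R -> (m <= y2)%R -> (x1 <= x2)%R ->
  contR f x1 x2 y1 y2 -> oint f x1 x2 y1 y2 = oint f x1 x2 y1 m + oint f x1 x2 m y2.
Proof.
  intros H1 H2 Hy C. unfold oint.
  rewrite (cint_Chasles (fun t => f (x1, t)) y1 m y2), (cint_Chasles (fun t => f (x2, t)) y1 m y2); auto.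
  - ring.
  - apply (contR_V f x1 x2 y1 y2); auto; lra.
  - apply (contR_V f x1 x2 y1 y2); auto; lra.
Qed.

Lemma oint_bound f x1 x2 y1 y2 M : (x1 <= x2)%R -> (y1 <= y2)%R -> bcont f x1 x2 y1 y2 ->
  (forall x y, bdry x1 x2 y1 y2 x y -> (Cmod (f (x, y)) <= M)%R) ->
  (Cmod (oint f x1 x2 y1 y2) <= 4 * M * ((x2 - x1) + (y2 - y1)))%R.
Proof.
  intros Hx Hy C B. unfold oint. destruct (bcont_edges _ _ _ _ _ Hx Hy C) as (C1 & C2 & C3 & C4).
  assert (A1 : (Cmod (cint (fun t => f (t, y1)) x1 x2) <= 2 * M * (x2 - x1))%R).
  { apply cint_bound; auto. intros; apply B; repeat split; try lra; tauto. }
  assert (A2 : (Cmod (cint (fun t => f (t, y2)) x1 x2) <= 2 * M * (x2 - x1))%R).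
  { apply cint_bound; auto. intros; apply B; repeat split; try lra; tauto. }
  assert (A3 : (Cmod (cint (fun t => f (x1, t)) y1 y2) <= 2 * M * (y2 - y1))%R).
  { apply cint_bound; auto. intros; apply B; repeat split; try lra; tauto. }
  assert (A4 : (Cmod (cint (fun t => f (x2, t)) y1 y2) <= 2 * M * (y2 - y1))%R).
  { apply cint_bound; auto. intros; apply B; repeat split; try lra; tauto. }
  set (a := cint (fun t => f (t, y1)) x1 x2) in *. set (b := cint (fun t => f (x2, t)) y1 y2) in *.
  set (c := cint (fun t => f (t, y2)) x1 x2) in *. set (d := cint (fun t => f (x1, t)) y1 y2) in *.
  pose proof (Cmod_triangle (a + Ci * b - c) (- (Ci * d))).
  pose proof (Cmod_triangle (a + Ci * b) (- c)).
  pose proof (Cmod_triangle a (Ci * b)).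
  rewrite Cmod_opp, Cmod_mult, Cmod_Ci in H. rewrite Cmod_opp in H0.
  rewrite Cmod_mult, Cmod_Ci in H1. unfold Cminus in *. lra.
Qed.

Lemma oint_plus f g x1 x2 y1 y2 : (x1 <= x2)%R -> (y1 <= y2)%R -> bcont f x1 x2 y1 y2 -> bcont g x1 x2 y1 y2 ->
  oint (fun z => f z + g z) x1 x2 y1 y2 = oint f x1 x2 y1 y2 + oint g x1 x2 y1 y2.
Proof.
  intros Hx Hy F G. unfold oint.
  destruct (bcont_edges _ _ _ _ _ Hx Hy F) as (C1 & C2 & C3 & C4).
  destruct (bcont_edges _ _ _ _ _ Hx Hy G) as (D1 & D2 & D3 & D4).
  rewrite (cint_plus (fun t => f (t, y1))), (cint_plus (fun t => f (t, y2))),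
    (cint_plus (fun t => f (x1, t))), (cint_plus (fun t => f (x2, t))); auto.
  ring.
Qed.

Lemma oint_scale c f x1 x2 y1 y2 : (x1 <= x2)%R -> (y1 <= y2)%R -> bcont f x1 x2 y1 y2 ->
  oint (fun z => c * f z) x1 x2 y1 y2 = c * oint f x1 x2 y1 y2.
Proof.
  intros Hx Hy F. unfold oint.
  destruct (bcont_edges _ _ _ _ _ Hx Hy F) as (C1 & C2 & C3 & C4).
  rewrite (cint_scale c (fun t => f (t, y1))), (cint_scale c (fun t => f (t, y2))),
    (cint_scale c (fun t => f (x1, t))), (cint_scale c (fun t => f (x2, t))); auto.
  ring.
Qed.

Lemma oint_ext f g x1 x2 y1 y2 : (x1 <= x2)%R -> (y1 <= y2)%R ->
  (forall x y, bdry x1 x2 y1 y2 x y -> f (x, y) = g (x, y)) -> oint f x1 x2 y1 y2 = oint g x1 x2 y1 y2.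
Proof.
  intros Hx Hy E. unfold oint.
  rewrite (cint_ext (fun t => f (t, y1)) (fun t => g (t, y1))), (cint_ext (fun t => f (t, y2)) (fun t => g (t, y2))),
    (cint_ext (fun t => f (x1, t)) (fun t => g (x1, t))), (cint_ext (fun t => f (x2, t)) (fun t => g (x2, t)));
    auto; intros t Ht; apply E; repeat split; try lra; tauto.
Qed.

Lemma oint_affine (u v : C) x1 x2 y1 y2 : oint (fun z => u + v * z) x1 x2 y1 y2 = 0.
Proof.
  assert (E : forall x y : R, (x, y) = RtoC x + Ci * RtoC y)
    by (intros; C_ring).
  assert (EH : forall y a b, cint (fun t => u + v * (t, y)) a b = cint (fun t => (u + v * (Ci * RtoC y)) + v * RtoC t) a b).
  { intros. unfold cint. f_equal; apply RInt_ext; intros; rewrite (E x y); f_equal; ring. }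
  assert (EV : forall x a b, cint (fun t => u + v * (x, t)) a b = cint (fun t => (u + v * RtoC x) + v * Ci * RtoC t) a b).
  { intros. unfold cint. f_equal; apply RInt_ext; intros t _; rewrite (E x t); f_equal; ring. }
  unfold oint. rewrite !EH, !EV, !cint_affine.
  destruct u, v; C_field.
Qed.

(** A rectangle (corner x, y, side lengths s, t) that violates P has a quarter that violates P.
    Iteration gives nested rectangles that shrink to a point (p, q), where the local hypothesis is
    contradicted. *)
Lemma bisection (P : R -> R -> R -> R -> Prop) (x0 y0 s0 t0 : R) :
  (0 < s0)%R -> (0 < t0)%R ->
  (forall x y s t, (0 < s)%R -> (0 < t)%R ->
     (x0 <= x)%R -> (x + s <= x0 + s0)%R -> (y0 <= y)%R -> (y + t <= y0 + t0)%R ->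
     P x y (s / 2)%R (t / 2)%R -> P (x + s / 2)%R y (s / 2)%R (t / 2)%R ->
     P x (y + t / 2)%R (s / 2)%R (t / 2)%R -> P (x + s / 2)%R (y + t / 2)%R (s / 2)%R (t / 2)%R ->
     P x y s t) ->
  (forall p q, (x0 <= p <= x0 + s0)%R -> (y0 <= q <= y0 + t0)%R -> exists d, (0 < d)%R /\
     forall x y s t, (0 < s < d)%R -> (0 < t < d)%R ->
       (x0 <= x)%R -> (x + s <= x0 + s0)%R -> (y0 <= y)%R -> (y + t <= y0 + t0)%R ->
       (x <= p <= x + s)%R -> (y <= q <= y + t)%R -> P x y s t) ->
  P x0 y0 s0 t0.
Proof.
  intros Hs Ht Hsplit Hloc. apply NNPP. intros Hn.
  set (w := fun n : nat => (/ 2 ^ n)%R).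
  assert (W : forall n, (0 < w n)%R) by (intros; apply Rinv_0_lt_compat, pow_lt; lra).
  assert (WS : forall n, w (S n) = (w n / 2)%R).
  { intros n. unfold w. simpl. rewrite Rinv_mult. unfold Rdiv. ring. }
  (* [good n a b]: b is the corner of a violating quarter of the rectangle of stage n with corner
     a. *)
  set (good := fun n (a b : R * R) =>
    (fst b = fst a \/ fst b = fst a + s0 * w n / 2)%R /\ (snd b = snd a \/ snd b = snd a + t0 * w n / 2)%R /\
    ~ P (fst b) (snd b) (s0 * w n / 2)%R (t0 * w n / 2)%R).
  set (st := fix st n := match n with O => (x0, y0) | S m => epsilon (inhabits (0, 0)%R) (good m (st m)) end).
  set (inv := fun n => (x0 <= fst (st n) /\ fst (st n) + s0 * w n <= x0 + s0 /\ y0 <= snd (st n) /\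
    snd (st n) + t0 * w n <= y0 + t0)%R /\ ~ P (fst (st n)) (snd (st n)) (s0 * w n)%R (t0 * w n)%R).
  assert (Pos : forall n, (0 < s0 * w n)%R /\ (0 < t0 * w n)%R) by (intros; split; now apply Rmult_lt_0_compat).
  assert (Step : forall n, inv n -> good n (st n) (st (S n))).
  { intros n ((A1 & A2 & A3 & A4) & A5). destruct (Pos n). simpl st. apply epsilon_spec. apply NNPP. intros Hno. apply A5.
    apply Hsplit; auto; apply NNPP; intros K; apply Hno.
    - exists (st n). repeat split; auto.
    - exists ((fst (st n) + s0 * w n / 2)%R, snd (st n)). repeat split; auto.
    - exists (fst (st n), (snd (st n) + t0 * w n / 2)%R). repeat split; auto.
    - exists ((fst (st n) + s0 * w n / 2)%R, (snd (st n) + t0 * w n / 2)%R). repeat split; auto. }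
  assert (Inv : forall n, inv n).
  { induction n as [|n IH].
    - unfold inv, w. simpl. rewrite Rinv_1, !Rmult_1_r. split; [lra|auto].
    - destruct (Step n IH) as (G1 & G2 & G3). destruct IH as (A & _). destruct (Pos n). unfold inv.
      rewrite WS. replace (s0 * (w n / 2))%R with (s0 * w n / 2)%R by field.
      replace (t0 * (w n / 2))%R with (t0 * w n / 2)%R by field.
      split; auto. destruct G1 as [E1|E1]; destruct G2 as [E2|E2]; rewrite ?E1, ?E2; lra. }
  (* Nested intervals: every left end lies below every right end, so the supremum of the left ends
     belongs to all of them. It is applied once to each coordinate. *)
  assert (Lim : forall (a : nat -> R) (c c0 : R), (0 < c)%R ->
    (forall n, (a n <= a (S n))%R /\ (a (S n) + c * w (S n) <= a n + c * w n)%R) ->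
    a O = c0 -> exists l, forall n, (a n <= l <= a n + c * w n)%R).
  { intros a c c0 Hc Ha H0.
    assert (Mon : forall n m, (a n <= a (n + m)%nat)%R /\ (a (n + m)%nat + c * w (n + m)%nat <= a n + c * w n)%R).
    { intros n m; induction m as [|m IHm]. rewrite Nat.add_0_r; lra.
      rewrite Nat.add_succ_r. destruct (Ha (n + m)%nat). lra. }
    assert (Bd : forall n m, (a n <= a m + c * w m)%R).
    { intros n m. assert (Pm : forall k, (0 < c * w k)%R) by (intros; apply Rmult_lt_0_compat; auto).
      destruct (le_lt_dec n m) as [L|L].
      - destruct (Mon n (m - n)%nat) as [M1 _]. replace (n + (m - n))%nat with m in M1 by lia.
        specialize (Pm m). lra.
      - destruct (Mon m (n - m)%nat) as [_ M1]. replace (m + (n - m))%nat with n in M1 by lia.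
        specialize (Pm n). lra. }
    destruct (completeness (fun r => exists n, r = a n)) as [l [U L]].
    - exists (a O + c * w O)%R. intros r [n ->]. auto.
    - exists (a O); now exists O.
    - exists l. intros n; split.
      + apply U. now exists n.
      + apply L. intros r [m ->]. auto. }
  assert (Aw : forall c n, (c * w (S n) = c * w n / 2)%R) by (intros; rewrite WS; field).
  destruct (Lim (fun n => fst (st n)) s0 x0) as [p Hp]; auto.
  { intros n. destruct (Step n (Inv n)) as (G1 & _ & _).
    pose proof (Rmult_lt_0_compat _ _ Hs (W n)). rewrite Aw. destruct G1 as [->| ->]; lra. }
  destruct (Lim (fun n => snd (st n)) t0 y0) as [q Hq]; auto.
  { intros n. destruct (Step n (Inv n)) as (_ & G1 & _).
    pose proof (Rmult_lt_0_compat _ _ Ht (W n)). rewrite Aw. destruct G1 as [->| ->]; lra. }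
  assert (E0 : w 0%nat = 1%R) by (unfold w; simpl; field).
  destruct (Hloc p q) as [d [D Hd]].
  { specialize (Hp 0%nat). rewrite E0 in Hp. simpl in Hp. lra. }
  { specialize (Hq 0%nat). rewrite E0 in Hq. simpl in Hq. lra. }
  (* N is taken so large that the sum of both sides at stage N is below d. *)
  destruct (pow_lt_1_zero (/2) ltac:(rewrite Rabs_right; lra) (d / (s0 + t0))%R) as [N HN].
  { apply Rdiv_lt_0_compat; lra. }
  specialize (HN N (le_n _)). rewrite Rabs_right in HN by (left; apply pow_lt; lra).
  rewrite pow_inv in HN. fold (w N) in HN.
  destruct (Inv N) as ((A1 & A2 & A3 & A4) & A5). apply A5.
  assert (HW : ((s0 + t0) * w N < d)%R).
  { apply Rmult_lt_compat_l with (r := (s0 + t0)%R) in HN; [|lra].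
    replace ((s0 + t0) * (d / (s0 + t0)))%R with d in HN by (field; lra). exact HN. }
  pose proof (Rmult_lt_0_compat _ _ Hs (W N)). pose proof (Rmult_lt_0_compat _ _ Ht (W N)).
  rewrite Rmult_plus_distr_r in HW.
  apply Hd; auto; lra.
Qed.

Lemma Cmod_small_eq_0 (c : C) (K : R) : (forall e, (0 < e)%R -> (Cmod c <= K * e)%R) -> c = 0.
Proof.
  intros H. apply Cmod_eq_0. apply Rle_antisym; [|apply Cmod_ge_0].
  apply Rnot_lt_le. intros P.
  specialize (H (Cmod c / (2 * (Rabs K + 1)))%R).
  pose proof (Rabs_pos K). pose proof (Rle_abs K).
  assert (Q : (0 < Cmod c / (2 * (Rabs K + 1)))%R) by (apply Rdiv_lt_0_compat; lra).
  specialize (H Q).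
  assert (Cmod c / (2 * (Rabs K + 1)) * (2 * (Rabs K + 1)) = Cmod c)%R by (field; lra).
  set (e := (Cmod c / (2 * (Rabs K + 1)))%R) in *. nra.
Qed.

(** The bound 4 (s + t)^2 e is inherited under quartering, since each quarter contributes a quarter
    of it. On a small rectangle f is an affine function, whose integral vanishes, plus an error of
    at most e times the distance to the centre of expansion. *)
Lemma goursat f x1 x2 y1 y2 : (x1 < x2)%R -> (y1 < y2)%R ->
  (forall x y, (x1 <= x <= x2)%R -> (y1 <= y <= y2)%R -> exists l, cder f (x, y) l) ->
  oint f x1 x2 y1 y2 = 0.
Proof.
  intros Hx Hy Df.
  assert (Cf : contR f x1 x2 y1 y2).
  { intros x y A B. destruct (Df x y A B) as [l L]. now apply cder_ctend with l. }
  apply Cmod_small_eq_0 with (K := (4 * ((x2 - x1) + (y2 - y1)) * ((x2 - x1) + (y2 - y1)))%R).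
  intros e He.
  set (P := fun x y s t => (Cmod (oint f x (x + s) y (y + t)) <= 4 * (s + t) * (s + t) * e)%R).
  assert (HP : P x1 y1 (x2 - x1)%R (y2 - y1)%R).
  2: { unfold P in HP. replace (x1 + (x2 - x1))%R with x2 in HP by ring.
       replace (y1 + (y2 - y1))%R with y2 in HP by ring. exact HP. }
  apply bisection; try lra.
  - intros x y s t Hs Ht A1 A2 A3 A4 P1 P2 P3 P4. unfold P in *.
    replace (x + s / 2 + s / 2)%R with (x + s)%R in * by field.
    replace (y + t / 2 + t / 2)%R with (y + t)%R in * by field.
    rewrite (oint_split_x f x (x + s / 2)%R (x + s)%R), (oint_split_y f x (x + s / 2)%R y (y + t / 2)%R (y + t)%R),
      (oint_split_y f (x + s / 2)%R (x + s)%R y (y + t / 2)%R (y + t)%R); try lra;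
      try (apply (contR_sub f x1 x2 y1 y2); auto; lra).
    eapply Rle_trans; [apply Cmod_triangle|].
    eapply Rle_trans; [apply Rplus_le_compat; apply Cmod_triangle|].
    replace (4 * (s + t) * (s + t) * e)%R with (4 * (4 * (s / 2 + t / 2) * (s / 2 + t / 2) * e))%R by field.
    lra.
  - intros p q Hp Hq. destruct (Df p q) as [l L]; try lra.
    destruct (cder_estim _ _ _ L e He) as [d [D E]].
    (* With both sides below d/2, every point of the rectangle is at distance at most s + t < d from
       (p, q). *)
    exists (d / 2)%R. split; [lra|]. intros x y s t Hs Ht A1 A2 A3 A4 B1 B2. unfold P.
    set (u := f (p, q) - l * (p, q)).
    assert (Ca : contR (fun z => u + l * z) x (x + s) y (y + t)).
    { intros a b _ _. apply (cder_ctend (fun z => u + l * z) (a, b) (0 + l * 1)).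
      apply cder_plus. apply cder_const. apply cder_scale, cder_id. }
    assert (Cr : contR (fun z => f z + - (1) * (u + l * z)) x (x + s) y (y + t)).
    { intros a b Ha Hb. apply ctend_plus. apply Cf; lra.
      apply ctend_mult. apply ctend_const. now apply Ca. }
    replace (oint f x (x + s) y (y + t)) with (oint (fun z => f z + - (1) * (u + l * z)) x (x + s) y (y + t)).
    + replace (4 * (s + t) * (s + t) * e)%R with (4 * (e * (s + t)) * ((x + s - x) + (y + t - y)))%R by ring.
      apply oint_bound; try lra. { now apply contR_bcont. }
      intros a b (Ha & Hb & _). set (h := ((a - p)%R, (b - q)%R) : C).
      assert (Eh : (a, b) = (p, q) + h) by (C_ring).
      assert (Hh : (Cmod h <= s + t)%R).
      { eapply Rle_trans; [apply Cmod_le_abs|]. simpl.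
        apply Rplus_le_compat; apply Rabs_le; lra. }
      rewrite Eh.
      replace (f ((p, q) + h)%C + - (1) * (u + l * ((p, q) + h))) with (f ((p, q) + h)%C - f (p, q) - l * h)
        by (unfold u; ring).
      eapply Rle_trans; [apply E; lra|]. apply Rmult_le_compat_l; lra.
    + symmetry. transitivity (oint (fun z => (f z + - (1) * (u + l * z)) + (u + l * z)) x (x + s) y (y + t)).
      { f_equal. funext z. ring. }
      rewrite (oint_plus (fun z => f z + - (1) * (u + l * z)) (fun z => u + l * z)); try lra; try now apply contR_bcont.
      rewrite oint_affine. ring.
Qed.

(** A square of half side e around (u, v) is cut out. Goursat disposes of the four rectangles left,
    right, below and above it, and on the square f is bounded by continuity, so its contribution is
    of order e. *)
Lemma goursat_puncture f x1 x2 y1 y2 u v : (x1 < u < x2)%R -> (y1 < v < y2)%R ->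
  contR f x1 x2 y1 y2 ->
  (forall x y, (x1 <= x <= x2)%R -> (y1 <= y <= y2)%R -> (x, y) <> (u, v) -> exists l, cder f (x, y) l) ->
  oint f x1 x2 y1 y2 = 0.
Proof.
  intros Hu Hv Cf Df.
  destruct (Cf u v ltac:(lra) ltac:(lra) 1%R Rlt_0_1) as [d [D E]].
  set (M := (Cmod (f (u, v)) + 1)%R).
  assert (B : forall h, (Cmod h < d)%R -> (Cmod (f ((u, v) + h)%C) <= M)%R).
  { intros h Hh. specialize (E h Hh).
    pose proof (Cmod_triangle (f ((u, v) + h)%C - f (u, v)) (f (u, v))).
    replace (f ((u, v) + h)%C - f (u, v) + f (u, v)) with (f ((u, v) + h)%C) in H by ring.
    unfold M. lra. }
  set (m := Rmin d (Rmin (Rmin (u - x1) (x2 - u)) (Rmin (v - y1) (y2 - v)))).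
  assert (Hm : (0 < m)%R) by (unfold m; repeat apply Rmin_pos; lra).
  assert (m <= d /\ m <= u - x1 /\ m <= x2 - u /\ m <= v - y1 /\ m <= y2 - v)%R as (M1 & M2 & M3 & M4 & M5).
  { unfold m.
    pose proof (Rmin_l d (Rmin (Rmin (u - x1) (x2 - u)) (Rmin (v - y1) (y2 - v)))).
    pose proof (Rmin_r d (Rmin (Rmin (u - x1) (x2 - u)) (Rmin (v - y1) (y2 - v)))).
    pose proof (Rmin_l (Rmin (u - x1) (x2 - u)) (Rmin (v - y1) (y2 - v))).
    pose proof (Rmin_r (Rmin (u - x1) (x2 - u)) (Rmin (v - y1) (y2 - v))).
    pose proof (Rmin_l (u - x1) (x2 - u)). pose proof (Rmin_r (u - x1) (x2 - u)).
    pose proof (Rmin_l (v - y1) (y2 - v)). pose proof (Rmin_r (v - y1) (y2 - v)). lra. }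
  apply Cmod_small_eq_0 with (K := (16 * M)%R). intros e0 He0.
  (* e <= m/4 keeps the square inside the rectangle and inside the disc of radius d on which f is
     bounded by M. *)
  set (e := Rmin e0 (m / 4)).
  assert (He : (0 < e)%R) by (unfold e; apply Rmin_pos; lra).
  assert (He1 : (e <= e0)%R) by apply Rmin_l. assert (He2 : (e <= m / 4)%R) by apply Rmin_r.
  assert (HM : (0 <= M)%R) by (unfold M; pose proof (Cmod_ge_0 (f (u, v))); lra).
  rewrite (oint_split_x f x1 (u - e)%R x2), (oint_split_x f (u - e)%R (u + e)%R x2),
    (oint_split_y f (u - e)%R (u + e)%R y1 (v - e)%R y2), (oint_split_y f (u - e)%R (u + e)%R (v - e)%R (v + e)%R y2); try lra;
    try (apply (contR_sub f x1 x2 y1 y2); auto; lra).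
  rewrite (goursat f x1 (u - e)%R y1 y2), (goursat f (u + e)%R x2 y1 y2),
    (goursat f (u - e)%R (u + e)%R y1 (v - e)%R), (goursat f (u - e)%R (u + e)%R (v + e)%R y2); try lra.
  2,3,4,5: intros x y Hx Hy; apply Df; try lra; intros Q; injection Q; intros; lra.
  rewrite !Cplus_0_l, !Cplus_0_r.
  eapply Rle_trans.
  { apply (oint_bound f _ _ _ _ M); try lra.
    - apply contR_bcont. apply (contR_sub f x1 x2 y1 y2); auto; lra.
    - intros x y (Hx & Hy & _). replace (x, y) with ((u, v) + ((x - u)%R, (y - v)%R))
        by (C_ring).
      apply B. eapply Rle_lt_trans; [apply Cmod_le_abs|]. simpl.
      assert (Rabs (x - u) <= e)%R by (apply Rabs_le; lra).
      assert (Rabs (y - v) <= e)%R by (apply Rabs_le; lra). lra. }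
  replace (4 * M * (u + e - (u - e) + (v + e - (v - e))))%R with (16 * M * e)%R by ring.
  apply Rmult_le_compat_l; lra.
Qed.

(** * Cauchy's formula and the derivative of a holomorphic function *)

Lemma ccont_bounded p a b : ccont_on p a b ->
  exists M, forall t, (a <= t <= b)%R -> (Cmod (p t) <= M)%R.
Proof.
  intros C.
  destruct (bounded_continuity (V := R_NormedModule) (fun t => Re (p t)) a b) as [M1 H1].
  { intros x Hx. exact (proj1 (C x Hx)). }
  destruct (bounded_continuity (V := R_NormedModule) (fun t => Im (p t)) a b) as [M2 H2].
  { intros x Hx. exact (proj2 (C x Hx)). }
  exists (M1 + M2)%R. intros t Ht.
  eapply Rle_trans; [apply Cmod_le_abs|].
  apply Rplus_le_compat; left; [apply H1 | apply H2]; auto.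
Qed.

Lemma bcont_bounded f x1 x2 y1 y2 : (x1 <= x2)%R -> (y1 <= y2)%R -> bcont f x1 x2 y1 y2 ->
  exists M, forall x y, bdry x1 x2 y1 y2 x y -> (Cmod (f (x, y)) <= M)%R.
Proof.
  intros Hx Hy B. destruct (bcont_edges _ _ _ _ _ Hx Hy B) as (C1 & C2 & C3 & C4).
  destruct (ccont_bounded _ _ _ C1) as [M1 H1]. destruct (ccont_bounded _ _ _ C2) as [M2 H2].
  destruct (ccont_bounded _ _ _ C3) as [M3 H3]. destruct (ccont_bounded _ _ _ C4) as [M4 H4].
  exists (Rmax (Rmax M1 M2) (Rmax M3 M4)).
  pose proof (Rmax_l M1 M2). pose proof (Rmax_r M1 M2). pose proof (Rmax_l M3 M4). pose proof (Rmax_r M3 M4).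
  pose proof (Rmax_l (Rmax M1 M2) (Rmax M3 M4)). pose proof (Rmax_r (Rmax M1 M2) (Rmax M3 M4)).
  intros x y (A & A' & [->|[->|[->| ->]]]).
  - specialize (H3 y A'). cbv beta in H3. lra.
  - specialize (H4 y A'). cbv beta in H4. lra.
  - specialize (H1 x A). cbv beta in H1. lra.
  - specialize (H2 x A). cbv beta in H2. lra.
Qed.

(** Differentiation under the integral sign: a quadratic remainder that is uniform on the boundary
    integrates to a quadratic remainder. *)
Lemma oint_param (G G' : C -> C -> C) w d K x1 x2 y1 y2 : (x1 <= x2)%R -> (y1 <= y2)%R ->
  (0 < d)%R -> (0 <= K)%R ->
  (forall h : C, (Cmod h < d)%R -> bcont (G (w + h)) x1 x2 y1 y2) -> bcont (G' w) x1 x2 y1 y2 ->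
  (forall h : C, (Cmod h < d)%R -> forall x y, bdry x1 x2 y1 y2 x y ->
     (Cmod (G (w + h)%C (x, y) - G w (x, y) - G' w (x, y) * h) <= K * (Cmod h * Cmod h))%R) ->
  cder (fun w => oint (G w) x1 x2 y1 y2) w (oint (G' w) x1 x2 y1 y2).
Proof.
  intros Hx Hy Hd HK B B' E.
  assert (B0 : bcont (G w) x1 x2 y1 y2).
  { specialize (B (RtoC 0)). rewrite Cplus_0_r in B. apply B. now rewrite Cmod_0. }
  apply cder_quadratic with (d := d) (K := (4 * K * ((x2 - x1) + (y2 - y1)))%R); auto.
  { repeat apply Rmult_le_pos; lra. }
  intros h Hh. specialize (B h Hh). specialize (E h Hh).
  assert (B1 : bcont (fun z => - (1) * G w z) x1 x2 y1 y2).
  { intros x y Hb. apply ctend_mult. apply ctend_const. now apply B0. }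
  assert (B2 : bcont (fun z => - h * G' w z) x1 x2 y1 y2).
  { intros x y Hb. apply ctend_mult. apply ctend_const. now apply B'. }
  assert (B3 : bcont (fun z => G (w + h)%C z + - (1) * G w z) x1 x2 y1 y2).
  { intros x y Hb. apply (ctend_plus (fun k => G (w + h)%C ((x, y) + k)%C) (fun k => - (1) * G w ((x, y) + k)%C)). now apply B. now apply B1. }
  replace (oint (G (w + h)%C) x1 x2 y1 y2 - oint (G w) x1 x2 y1 y2 - oint (G' w) x1 x2 y1 y2 * h)
    with (oint (fun z => (G (w + h)%C z + - (1) * G w z) + - h * G' w z) x1 x2 y1 y2).
  - replace (4 * K * (x2 - x1 + (y2 - y1)) * (Cmod h * Cmod h))%R
      with (4 * (K * (Cmod h * Cmod h)) * (x2 - x1 + (y2 - y1)))%R by ring.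
    apply oint_bound; auto.
    { intros x y Hb. apply (ctend_plus (fun k => G (w + h)%C ((x, y) + k)%C + - (1) * G w ((x, y) + k)%C) (fun k => - h * G' w ((x, y) + k)%C)). now apply B3. now apply B2. }
    intros x y Hb. specialize (E x y Hb).
    replace (G (w + h)%C (x, y) + - (1) * G w (x, y) + - h * G' w (x, y))
      with (G (w + h)%C (x, y) - G w (x, y) - G' w (x, y) * h) by ring. exact E.
  - rewrite (oint_plus (fun z => G (w + h)%C z + - (1) * G w z) (fun z => - h * G' w z)); auto.
    rewrite (oint_plus (G (w + h)%C) (fun z => - (1) * G w z)); auto.
    rewrite !oint_scale; auto. ring.
Qed.

Definition inside (x1 x2 y1 y2 : R) (w : C) : Prop :=
  (x1 < Re w < x2)%R /\ (y1 < Im w < y2)%R.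

Lemma inside_dist x1 x2 y1 y2 w : inside x1 x2 y1 y2 w ->
  exists r, (0 < r)%R /\ (forall x y, bdry x1 x2 y1 y2 x y -> (r <= Cmod ((x, y) - w))%R)
    /\ (forall h : C, (Cmod h < r)%R -> inside x1 x2 y1 y2 (w + h)).
Proof.
  destruct w as [u v]. intros [Hu Hv]. simpl in Hu, Hv.
  exists (Rmin (Rmin (u - x1) (x2 - u)) (Rmin (v - y1) (y2 - v))).
  pose proof (Rmin_l (Rmin (u - x1) (x2 - u)) (Rmin (v - y1) (y2 - v))).
  pose proof (Rmin_r (Rmin (u - x1) (x2 - u)) (Rmin (v - y1) (y2 - v))).
  pose proof (Rmin_l (u - x1) (x2 - u)). pose proof (Rmin_r (u - x1) (x2 - u)).
  pose proof (Rmin_l (v - y1) (y2 - v)). pose proof (Rmin_r (v - y1) (y2 - v)).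
  split; [repeat apply Rmin_pos; lra|].
  set (r := Rmin (Rmin (u - x1) (x2 - u)) (Rmin (v - y1) (y2 - v))) in *. split.
  - intros x y (A & B & D).
    pose proof (re_le_Cmod ((x, y) - (u, v))) as N1. pose proof (im_le_Cmod ((x, y) - (u, v))) as N2.
    simpl in N1, N2.
    unfold Rabs in N1, N2. destruct (Rcase_abs (x + - u)), (Rcase_abs (y + - v)), D as [->|[->|[->| ->]]]; lra.
  - intros [a b] Hh.
    pose proof (re_le_Cmod (a, b)) as N1. pose proof (im_le_Cmod (a, b)) as N2. simpl in N1, N2.
    unfold Rabs in N1, N2. unfold inside; simpl.
    destruct (Rcase_abs a), (Rcase_abs b); lra.
Qed.

Lemma bcont_cder f x1 x2 y1 y2 : (forall x y, bdry x1 x2 y1 y2 x y -> exists l, cder f (x, y) l) ->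
  bcont f x1 x2 y1 y2.
Proof. intros H x y B. destruct (H x y B) as [l L]. now apply cder_ctend with l. Qed.

Lemma cder_ker w z : z <> w -> exists l, cder (fun z => / (z - w)) z l.
Proof.
  intros N. eexists. apply cder_inv.
  - intros E. apply N. replace z with (z - w + w) by ring. rewrite E. ring.
  - apply cder_plus. apply cder_id. apply cder_const.
Qed.

Lemma ne_of_dist (z w : C) r : (0 < r)%R -> (r <= Cmod (z - w))%R -> z <> w.
Proof.
  intros Hr H ->. replace (w - w) with (RtoC 0) in H by ring. rewrite Cmod_0 in H. lra.
Qed.

Lemma inside_ker_bcont x1 x2 y1 y2 w : inside x1 x2 y1 y2 w -> bcont (fun z => / (z - w)) x1 x2 y1 y2.
Proof.
  intros Hw. destruct (inside_dist _ _ _ _ _ Hw) as (r & Hr & D & _).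
  apply bcont_cder. intros x y B. apply cder_ker. apply (ne_of_dist _ _ r); auto.
Qed.

Lemma bcont_mult f g x1 x2 y1 y2 : bcont f x1 x2 y1 y2 -> bcont g x1 x2 y1 y2 -> bcont (fun z => f z * g z) x1 x2 y1 y2.
Proof. intros F G x y B. apply ctend_mult; [now apply F|now apply G]. Qed.

(** The quotient (f z - f w)/(z - w), completed by the derivative of f at w, is continuous
    everywhere and differentiable off w, so [goursat_puncture] makes its integral vanish. *)
Lemma cauchy_formula f x1 x2 y1 y2 w : inside x1 x2 y1 y2 w ->
  (forall x y, (x1 <= x <= x2)%R -> (y1 <= y <= y2)%R -> exists l, cder f (x, y) l) ->
  oint (fun z => f z * / (z - w)) x1 x2 y1 y2 = f w * oint (fun z => / (z - w)) x1 x2 y1 y2.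
Proof.
  intros Hw Df. pose proof Hw as [Hu Hv].
  destruct (inside_dist _ _ _ _ _ Hw) as (r & Hr & D & _).
  pose proof (inside_ker_bcont _ _ _ _ _ Hw) as Bk.
  destruct (Df (Re w) (Im w)) as [l L]; try lra.
  replace (Re w, Im w) with w in L by (now destruct w).
  set (g := fun z => if prop_dec (z = w) then l else (f z - f w) * / (z - w)).
  assert (Dg : forall z, z <> w -> (exists l, cder f z l) -> exists l, cder g z l).
  { intros z N [m Hm]. destruct (cder_ker w z N) as [k Hk].
    assert (N0 : (0 < Cmod (z - w))%R).
    { apply Cmod_gt_0. intros E. apply N. replace z with (z - w + w) by ring. rewrite E. ring. }
    eexists. apply (cder_near (fun z => (f z - f w) * / (z - w)) g z _ (Cmod (z - w))); auto.
    - intros h Hh. unfold g. destruct (prop_dec (z + h = w)) as [E|_]; auto.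
      exfalso. replace h with (- (z - w)) in Hh by (rewrite <- E; ring). rewrite Cmod_opp in Hh. lra.
    - apply cder_mult; [|exact Hk]. apply cder_plus; [exact Hm|apply cder_const]. }
  assert (Cg : contR g x1 x2 y1 y2).
  { intros x y Hx Hy. destruct (prop_dec ((x, y) = w)) as [E|N].
    - rewrite E. intros e He. destruct (cder_estim _ _ _ L (e / 2)%R) as [d [Hd H]]; [lra|].
      exists d. split; auto. intros h Hh. specialize (H h Hh). unfold g.
      destruct (prop_dec (w = w)) as [_|K]; [|easy].
      destruct (prop_dec (w + h = w)) as [E1|N1].
      + replace (l - l) with (RtoC 0) by ring. now rewrite Cmod_0.
      + assert (Nh : h <> 0). { intros ->. apply N1. ring. }
        replace (w + h - w) with h by ring.
        replace ((f (w + h)%C - f w) * / h - l) with ((f (w + h)%C - f w - l * h) * / h) by (field; auto).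
        rewrite Cmod_mult, Cmod_inv by auto. apply Cmod_gt_0 in Nh.
        apply Rmult_lt_reg_r with (Cmod h); auto. rewrite Rmult_assoc, Rinv_l by lra. nra.
    - destruct (Dg (x, y) N (Df x y Hx Hy)) as [m Hm]. now apply cder_ctend with m. }
  assert (J0 : oint g x1 x2 y1 y2 = 0).
  { apply (goursat_puncture g x1 x2 y1 y2 (Re w) (Im w)); auto.
    intros x y Hx Hy N. apply Dg; auto. intros E. apply N. rewrite E. now destruct w. }
  rewrite (oint_ext _ (fun z => g z + f w * / (z - w))); try lra.
  - rewrite (oint_plus g (fun z => f w * / (z - w))), J0, oint_scale; auto; try lra.
    + ring.
    + now apply contR_bcont.
    + apply bcont_mult; auto. intros x y _. apply ctend_const.
  - intros x y B. unfold g.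
    destruct (prop_dec (@eq C (x, y) w)) as [E|N].
    + exfalso. apply (ne_of_dist (x, y) w r); auto.
    + set (k := / ((x, y) - w)). set (a := f (x, y)). ring.
Qed.

Lemma RInt_pos (f : R -> R) a b : (a < b)%R -> ccont_on (fun t => RtoC (f t)) a b ->
  (forall t, (a <= t <= b)%R -> (0 < f t)%R) -> (0 < RInt f a b)%R.
Proof.
  intros H C P. apply RInt_gt_0; auto.
  - intros; apply P; lra.
  - intros x Hx. exact (proj1 (C x Hx)).
Qed.

Lemma Cinv_sign (a b : R) :
  ((b < 0 -> 0 < Im (/ (a, b))) /\ (0 < b -> 0 < - Im (/ (a, b))) /\
   (a < 0 -> 0 < - Re (/ (a, b))) /\ (0 < a -> 0 < Re (/ (a, b))))%R.
Proof.
  simpl. unfold Rdiv.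
  assert (H : (b < 0 \/ 0 < b \/ a < 0 \/ 0 < a -> 0 < / (a * (a * 1) + b * (b * 1)))%R).
  { intros H. apply Rinv_0_lt_compat. nra. }
  repeat split; intros K; specialize (H ltac:(tauto)); nra.
Qed.

(* Seen from an interior point, every edge turns counterclockwise, so all four contributions to
   the imaginary part are positive. *)
Lemma winding_nonzero x1 x2 y1 y2 w : inside x1 x2 y1 y2 w -> oint (fun z => / (z - w)) x1 x2 y1 y2 <> 0.
Proof.
  intros Hw E. pose proof Hw as [Hu Hv]. pose proof (inside_ker_bcont _ _ _ _ _ Hw) as Bk.
  destruct (bcont_edges _ x1 x2 y1 y2 ltac:(lra) ltac:(lra) Bk) as (C1 & C2 & C3 & C4).
  destruct w as [u v]. simpl in Hu, Hv.
  apply (f_equal Im) in E. unfold oint, cint in E. simpl in E.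
  assert (P1 : (0 < RInt (fun t => Im (/ ((t, y1) - (u, v)))) x1 x2)%R).
  { apply RInt_pos; try lra.
    - intros t Ht. split; [exact (proj2 (C1 t Ht))|apply continuous_const].
    - intros t Ht. apply (Cinv_sign (t - u) (y1 - v)). lra. }
  assert (P2 : (0 < - RInt (fun t => Im (/ ((t, y2) - (u, v)))) x1 x2)%R).
  { rewrite <- (RInt_opp (V := R_CompleteNormedModule)).
    2: { apply (ccont_on_ex (fun t => / ((t, y2) - (u, v)))); auto. lra. }
    apply RInt_pos; try lra.
    - intros t Ht. split; [|apply continuous_const]. apply (continuous_opp (V := R_NormedModule)). exact (proj2 (C2 t Ht)).
    - intros t Ht. apply (Cinv_sign (t - u) (y2 - v)). lra. }
  assert (P3 : (0 < - RInt (fun t => Re (/ ((x1, t) - (u, v)))) y1 y2)%R).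
  { rewrite <- (RInt_opp (V := R_CompleteNormedModule)).
    2: { apply (ccont_on_ex (fun t => / ((x1, t) - (u, v)))); auto. lra. }
    apply RInt_pos; try lra.
    - intros t Ht. split; [|apply continuous_const]. apply (continuous_opp (V := R_NormedModule)). exact (proj1 (C3 t Ht)).
    - intros t Ht. apply (Cinv_sign (x1 - u) (t - v)). lra. }
  assert (P4 : (0 < RInt (fun t => Re (/ ((x2, t) - (u, v)))) y1 y2)%R).
  { apply RInt_pos; try lra.
    - intros t Ht. split; [exact (proj1 (C4 t Ht))|apply continuous_const].
    - intros t Ht. apply (Cinv_sign (x2 - u) (t - v)). lra. }
  simpl in P1, P2, P3, P4. lra.
Qed.

(** Taylor remainders in h of 1/(a - h) and of its square, as exact identities. Naming the inverses
    u and v makes the estimates polynomial in them; |a - h| >= r/2 gives |v| <= 2/r. *)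
Lemma ker_shift r (a h : C) : (0 < r)%R -> (r <= Cmod a)%R -> (Cmod h < r / 2)%R ->
  exists u v, u = / a /\ v = / (a - h) /\ (Cmod u <= / r)%R /\ (Cmod v <= 2 * / r)%R /\
    v - u - h * (u * u) = h * h * (u * u * v) /\
    v * v - u * u - h * (2 * (u * u * u)) = h * h * (3 * (u * u * (v * v)) - 2 * h * (u * u * u * (v * v))).
Proof.
  intros Hr Ha Hh.
  assert (Q : (r / 2 <= Cmod (a - h))%R).
  { pose proof (Cmod_triangle (a - h) h) as T. replace (a - h + h) with a in T by ring. lra. }
  assert (Na : a <> 0) by (apply Cmod_gt_0; lra).
  assert (Nh : a - h <> 0) by (apply Cmod_gt_0; lra).
  exists (/ a), (/ (a - h)). split; [reflexivity|]. split; [reflexivity|].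
  split; [|split; [|split]].
  - rewrite Cmod_inv by auto. apply Rinv_le_contravar; auto.
  - rewrite Cmod_inv by auto. replace (2 * / r)%R with (/ (r / 2))%R by (field; lra).
    apply Rinv_le_contravar; lra.
  - field. auto.
  - field. auto.
Qed.

(** The factor f is bounded on the boundary, so a quadratic remainder for the kernel alone
    suffices. *)
Lemma oint_kernel f (k k' : C -> C -> C) w d K x1 x2 y1 y2 : (x1 <= x2)%R -> (y1 <= y2)%R -> (0 < d)%R -> (0 <= K)%R ->
  bcont f x1 x2 y1 y2 -> (forall h : C, (Cmod h < d)%R -> bcont (k (w + h)) x1 x2 y1 y2) -> bcont (k' w) x1 x2 y1 y2 ->
  (forall h : C, (Cmod h < d)%R -> forall x y, bdry x1 x2 y1 y2 x y ->
     (Cmod (k (w + h)%C (x, y) - k w (x, y) - h * k' w (x, y)) <= K * (Cmod h * Cmod h))%R) ->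
  cder (fun w => oint (fun z => f z * k w z) x1 x2 y1 y2) w (oint (fun z => f z * k' w z) x1 x2 y1 y2).
Proof.
  intros Hx Hy Hd HK Bf Bk Bk' H. destruct (bcont_bounded f x1 x2 y1 y2) as [M HM]; auto.
  apply (oint_param (fun w z => f z * k w z) (fun w z => f z * k' w z) w d (Rabs M * K)%R); auto using bcont_mult.
  - apply Rmult_le_pos; auto using Rabs_pos.
  - intros h Hh x y B. specialize (H h Hh x y B). cbv beta.
    replace (f (x, y) * k (w + h)%C (x, y) - f (x, y) * k w (x, y) - f (x, y) * k' w (x, y) * h)
      with (f (x, y) * (k (w + h)%C (x, y) - k w (x, y) - h * k' w (x, y))) by ring.
    rewrite Cmod_mult, Rmult_assoc. apply Rmult_le_compat; auto using Cmod_ge_0.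
    eapply Rle_trans; [now apply HM|apply Rle_abs].
Qed.

Lemma cauchy_transform f x1 x2 y1 y2 w : inside x1 x2 y1 y2 w -> bcont f x1 x2 y1 y2 ->
  cder (fun w => oint (fun z => f z * / (z - w)) x1 x2 y1 y2) w
    (oint (fun z => f z * (/ (z - w) * / (z - w))) x1 x2 y1 y2) /\
  cder (fun w => oint (fun z => f z * (/ (z - w) * / (z - w))) x1 x2 y1 y2) w
    (oint (fun z => f z * (2 * (/ (z - w) * / (z - w) * / (z - w)))) x1 x2 y1 y2).
Proof.
  intros Hw Bf. pose proof Hw as [Hu Hv].
  assert (x1 <= x2)%R by lra. assert (y1 <= y2)%R by lra.
  destruct (inside_dist _ _ _ _ _ Hw) as (r & Hr & D & In).
  assert (R0 : (0 < / r)%R) by now apply Rinv_0_lt_compat.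
  assert (Bk : forall h : C, (Cmod h < r / 2)%R -> bcont (fun z => / (z - (w + h))) x1 x2 y1 y2).
  { intros h Hh. apply inside_ker_bcont, In. lra. }
  pose proof (inside_ker_bcont _ _ _ _ _ Hw) as Bk0.
  assert (IR : (/ r * r = 1)%R) by (field; lra).
  split.
  - apply (oint_kernel f (fun w z => / (z - w)) (fun w z => / (z - w) * / (z - w)) w (r / 2) (2 * (/ r * / r * / r))%R);
      auto using bcont_mult; try lra.
    + repeat apply Rmult_le_pos; lra.
    + intros h Hh x y B.
      destruct (ker_shift r ((x, y) - w) h Hr (D x y B) Hh) as (u & v & Eu & Ev & Bu & Bv & E1 & _).
      replace ((x, y) - (w + h)) with ((x, y) - w - h) by ring.
      rewrite <- Eu, <- Ev, E1, !Cmod_mult.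
      pose proof (Cmod_ge_0 u). pose proof (Cmod_ge_0 v). pose proof (Cmod_ge_0 h).
      replace (2 * (/ r * / r * / r) * (Cmod h * Cmod h))%R with (Cmod h * Cmod h * (/ r * / r * (2 * / r)))%R by ring.
      repeat (apply Rmult_le_compat; try (repeat apply Rmult_le_pos; auto; lra); auto; try lra).
  (* With |u| <= 1/r, |v| <= 2/r and |h| < r/2, the terms 3 u^2 v^2 and 2 h u^3 v^2 are at most
     12/r^4 and 4/r^4, whence 16. *)
  - apply (oint_kernel f (fun w z => / (z - w) * / (z - w)) (fun w z => 2 * (/ (z - w) * / (z - w) * / (z - w))) w (r / 2)
      (16 * (/ r * / r * / r * / r))%R); auto using bcont_mult; try lra.
    + repeat apply Rmult_le_pos; lra.
    + apply bcont_mult; [intros ? ? _; apply ctend_const|auto using bcont_mult].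
    + intros h Hh x y B.
      destruct (ker_shift r ((x, y) - w) h Hr (D x y B) Hh) as (u & v & Eu & Ev & Bu & Bv & _ & E2).
      replace ((x, y) - (w + h)) with ((x, y) - w - h) by ring.
      rewrite <- Eu, <- Ev, E2, !Cmod_mult, (Rmult_comm (16 * _)).
      pose proof (Cmod_ge_0 u). pose proof (Cmod_ge_0 v). pose proof (Cmod_ge_0 h).
      apply Rmult_le_compat_l; [now apply Rmult_le_pos|].
      eapply Rle_trans; [apply Cmod_triangle|].
      rewrite Cmod_opp, !Cmod_mult, !Cmod_R, !Rabs_right by lra.
      set (q := (/ r)%R) in *. set (U := Cmod u) in *. set (V := Cmod v) in *. set (h' := Cmod h) in *.
      assert (A1 : (U * U * (V * V) <= q * q * (2 * q * (2 * q)))%R).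
      { repeat (apply Rmult_le_compat; try (repeat apply Rmult_le_pos; auto; lra); auto; try lra). }
      assert (A2 : (h' * (U * U * U * (V * V)) <= r / 2 * (q * q * q * (2 * q * (2 * q))))%R).
      { repeat (apply Rmult_le_compat; try (repeat apply Rmult_le_pos; auto; lra); auto; try lra). }
      replace (r / 2 * (q * q * q * (2 * q * (2 * q))))%R with (2 * (q * r) * (q * q * q * q))%R in A2 by field.
      rewrite IR in A2. lra.
Qed.

(* By Cauchy's formula f = N / W near z, where N and W are the Cauchy transforms of f and 1; both can
   be differentiated twice under the integral sign, and the exact value of W does not matter. *)
Theorem hol_derivative f : isHol f -> isHol (cderiv f).
Proof.
  intros Hf [u v] Hz. unfold UHP in Hz. simpl in Hz. apply cdiff_cder.
  set (x1 := (u - v / 2)%R). set (x2 := (u + v / 2)%R). set (y1 := (v / 2)%R). set (y2 := (3 * v / 2)%R).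
  assert (Df : forall x y, (x1 <= x <= x2)%R -> (y1 <= y <= y2)%R -> exists l, cder f (x, y) l).
  { intros x y _ Hy. apply cdiff_cder. apply Hf. unfold UHP, y1 in *. simpl. lra. }
  assert (Hin : inside x1 x2 y1 y2 (u, v)).
  { unfold inside, x1, x2, y1, y2. simpl. lra. }
  assert (Bf : bcont f x1 x2 y1 y2).
  { apply bcont_cder. intros x y (A & B & _). auto. }
  assert (B1 : bcont (fun _ => RtoC 1) x1 x2 y1 y2) by (intros ? ? _; apply ctend_const).
  set (N := fun w => oint (fun z => f z * / (z - w)) x1 x2 y1 y2).
  set (W := fun w => oint (fun z => RtoC 1 * / (z - w)) x1 x2 y1 y2).
  set (N' := fun w => oint (fun z => f z * (/ (z - w) * / (z - w))) x1 x2 y1 y2).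
  set (W' := fun w => oint (fun z => RtoC 1 * (/ (z - w) * / (z - w))) x1 x2 y1 y2).
  assert (W0 : forall w, inside x1 x2 y1 y2 w -> W w <> 0).
  { intros w Hw. unfold W. replace (fun z => RtoC 1 * / (z - w)) with (fun z => / (z - w)).
    now apply winding_nonzero. apply functional_extensionality. intros. ring. }
  assert (Ef : forall w, inside x1 x2 y1 y2 w -> N w * / W w = f w).
  { intros w Hw. unfold N. rewrite (cauchy_formula f); auto.
    replace (oint (fun z => / (z - w)) x1 x2 y1 y2) with (W w). field. now apply W0.
    unfold W. f_equal. apply functional_extensionality. intros. ring. }
  set (F := fun w => N' w * / W w + N w * (- W' w * / (W w * W w))).
  assert (Hd : forall w, inside x1 x2 y1 y2 w -> cderiv f w = F w).
  { intros w Hw. destruct (inside_dist _ _ _ _ _ Hw) as (r & Hr & _ & In).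
    apply cder_cderiv. apply (cder_near (fun w => N w * / W w) f w _ r); auto.
    apply (cder_mult N (fun w => / W w)). { exact (proj1 (cauchy_transform f x1 x2 y1 y2 w Hw Bf)). }
    apply (cder_inv W). { now apply W0. } exact (proj1 (cauchy_transform (fun _ => RtoC 1) x1 x2 y1 y2 w Hw B1)). }
  destruct (inside_dist _ _ _ _ _ Hin) as (r & Hr & _ & In).
  pose proof (W0 _ Hin) as W0z.
  destruct (cauchy_transform f _ _ _ _ _ Hin Bf) as [N1 N2].
  destruct (cauchy_transform (fun _ => RtoC 1) _ _ _ _ _ Hin B1) as [W1 W2].
  eexists. apply (cder_near F (cderiv f) (u, v) _ r); auto.
  { intros h Hh. symmetry. apply Hd. auto. }
  unfold F. apply (cder_plus (fun w => N' w * / W w) (fun w => N w * (- W' w * / (W w * W w)))).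
  - apply (cder_mult N' (fun w => / W w)). exact N2. apply (cder_inv W); auto. exact W1.
  - apply (cder_mult N (fun w => - W' w * / (W w * W w))). exact N1.
    apply (cder_mult (fun w => - W' w) (fun w => / (W w * W w))).
    + replace (fun w => - W' w) with (fun w => - (1) * W' w)
        by (apply functional_extensionality; intros; ring).
      apply cder_scale. exact W2.
    + apply (cder_inv (fun w => W w * W w)). now apply Cmult_neq_0. apply (cder_mult W W); exact W1.
Qed.

(** * Power series in q *)

(** Polynomial growth is stable under passing from a_n to n a_n and gives absolute convergence of
    the q-series on the whole upper half plane. *)
Definition pbound (a : nat -> R) : Prop :=
  exists K m, (0 <= K)%R /\ forall n, (Rabs (a n) <= K * INR (S n) ^ m)%R.

Lemma linear_geom_bounded r : (0 < r < 1)%R -> exists C, forall n, (INR (S n) * r ^ n <= C)%R.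
Proof.
  intros Hr. set (e := (/ r - 1)%R).
  assert (He : (0 < e)%R).
  { unfold e. assert (/ 1 < / r)%R by (apply Rinv_lt_contravar; lra). rewrite Rinv_1 in H. lra. }
  exists (/ e + 1)%R. intros n.
  pose proof (poly n e He) as P. replace (1 + e)%R with (/ r)%R in P by (unfold e; ring).
  rewrite pow_inv in P.
  assert (Pr : (0 < r ^ n)%R) by (apply pow_lt; lra).
  assert (P1 : (r ^ n <= 1)%R).
  { rewrite <- (pow1 n). apply pow_incr. lra. }
  assert (P2 : ((1 + INR n * e) * r ^ n <= 1)%R).
  { apply Rmult_le_compat_r with (r := (r ^ n)%R) in P; [|lra]. rewrite Rinv_l in P; lra. }
  rewrite S_INR.
  assert (INR n * r ^ n <= / e)%R.
  { apply Rmult_le_reg_r with e; auto. rewrite Rinv_l by lra. nra. }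
  nra.
Qed.

(** Write r as the square of sqrt r: one factor (sqrt r)^n absorbs one factor n + 1, the other
    serves the induction hypothesis. *)
Lemma poly_geom_bounded m : forall r, (0 < r < 1)%R -> exists C, (0 <= C)%R /\ forall n, (INR (S n) ^ m * r ^ n <= C)%R.
Proof.
  induction m as [|m IH]; intros r Hr.
  - exists 1%R. split; [lra|]. intros n. simpl. rewrite Rmult_1_l, <- (pow1 n). apply pow_incr. lra.
  - assert (Hs : (0 < sqrt r < 1)%R).
    { split. apply sqrt_lt_R0; lra. rewrite <- sqrt_1. apply sqrt_lt_1; lra. }
    destruct (IH _ Hs) as (C & HC & B). destruct (linear_geom_bounded _ Hs) as (C1 & B1).
    exists (C1 * C)%R.
    assert (X : forall n, (0 <= INR (S n) * sqrt r ^ n)%R).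
    { intros n. apply Rmult_le_pos. apply pos_INR. apply pow_le; lra. }
    split. { apply Rmult_le_pos; auto. eapply Rle_trans; [apply (X O)|apply B1]. }
    intros n. rewrite <- (sqrt_sqrt r) at 1 by lra. rewrite Rpow_mult_distr.
    rewrite <- (tech_pow_Rmult (INR (S n)) m).
    replace (INR (S n) * INR (S n) ^ m * (sqrt r ^ n * sqrt r ^ n))%R
      with ((INR (S n) * sqrt r ^ n) * (INR (S n) ^ m * sqrt r ^ n))%R by ring.
    apply Rmult_le_compat; auto. apply Rmult_le_pos. apply pow_le, pos_INR. apply pow_le; lra.
Qed.

Lemma ex_series_poly_geom m r : (0 < r < 1)%R -> ex_series (fun n => INR (S n) ^ m * r ^ n)%R.
Proof.
  intros Hr.
  assert (Hs : (0 < sqrt r < 1)%R).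
  { split. apply sqrt_lt_R0; lra. rewrite <- sqrt_1. apply sqrt_lt_1; lra. }
  destruct (poly_geom_bounded m _ Hs) as (C & HC & B).
  apply (ex_series_le (V := R_CompleteNormedModule) _ (fun n => C * sqrt r ^ n)%R).
  - intros n. change (Rabs (INR (S n) ^ m * r ^ n) <= C * sqrt r ^ n)%R.
    rewrite Rabs_right.
    + rewrite <- (sqrt_sqrt r) at 1 by lra. rewrite Rpow_mult_distr.
      rewrite <- Rmult_assoc. apply Rmult_le_compat_r; auto. apply pow_le; lra.
    + apply Rle_ge, Rmult_le_pos. apply pow_le, pos_INR. apply pow_le; lra.
  - apply (ex_series_scal_l (K := R_AbsRing) (V := R_NormedModule)). apply ex_series_geom. rewrite Rabs_right; lra.
Qed.

Lemma pbound_series a r : pbound a -> (0 < r < 1)%R -> ex_series (fun n => Rabs (a n) * r ^ n)%R.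
Proof.
  intros (K & m & HK & B) Hr.
  apply (ex_series_le (V := R_CompleteNormedModule) _ (fun n => K * (INR (S n) ^ m * r ^ n))%R).
  - intros n. change (Rabs (Rabs (a n) * r ^ n) <= K * (INR (S n) ^ m * r ^ n))%R.
    rewrite Rabs_mult, Rabs_Rabsolu, (Rabs_right (r ^ n)) by (apply Rle_ge, pow_le; lra).
    rewrite <- Rmult_assoc. apply Rmult_le_compat_r; auto. apply pow_le; lra.
  - apply (ex_series_scal_l (K := R_AbsRing) (V := R_NormedModule)). now apply ex_series_poly_geom.
Qed.

Lemma qpow_0 z : qpow 0 z = 1.
Proof.
  unfold qpow. simpl INR. rewrite !Rmult_0_r, !Rmult_0_l, exp_0, cos_0, sin_0, Rmult_1_r, Rmult_0_r. reflexivity.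
Qed.

Lemma qpow_add n m z : qpow (n + m) z = qpow n z * qpow m z.
Proof.
  unfold qpow. rewrite plus_INR.
  replace (- 2 * PI * (INR n + INR m) * Im z)%R with (- 2 * PI * INR n * Im z + - 2 * PI * INR m * Im z)%R by ring.
  replace (2 * PI * (INR n + INR m) * Re z)%R with (2 * PI * INR n * Re z + 2 * PI * INR m * Re z)%R by ring.
  rewrite exp_plus, cos_plus, sin_plus. apply injective_projections; unfold Cmult; cbn [fst snd]; ring.
Qed.

Lemma qpow_plus n z w : qpow n (z + w) = qpow n z * qpow n w.
Proof.
  unfold qpow. destruct z as [a b], w as [c d]. unfold Cplus, Re, Im. cbn [fst snd].
  rewrite !(Rmult_plus_distr_l (_ * _)).
  rewrite exp_plus, cos_plus, sin_plus. apply injective_projections; unfold Cmult; cbn [fst snd]; ring.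
Qed.

Definition qabs (z : C) : R := exp (- 2 * PI * Im z).

Lemma Cmod_polar r t : (0 <= r)%R -> Cmod ((r * cos t)%R, (r * sin t)%R) = r.
Proof.
  intros Hr. unfold Cmod. cbn [fst snd].
  replace ((r * cos t) ^ 2 + (r * sin t) ^ 2)%R
    with (r * r * (Rsqr (sin t) + Rsqr (cos t)))%R by (unfold Rsqr; ring).
  rewrite sin2_cos2, Rmult_1_r. now apply sqrt_square.
Qed.

Lemma Cmod_qpow n z : Cmod (qpow n z) = (qabs z ^ n)%R.
Proof.
  unfold qpow. rewrite Cmod_polar by (left; apply exp_pos).
  unfold qabs. induction n as [|n IH].
  - simpl. rewrite Rmult_0_r, Rmult_0_l. apply exp_0.
  - rewrite S_INR, <- tech_pow_Rmult, <- IH, <- exp_plus. f_equal. ring.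
Qed.

Lemma qabs_lt1 z : UHP z -> (0 < qabs z < 1)%R.
Proof.
  intros H. unfold UHP in H. split. apply exp_pos. unfold qabs. rewrite <- exp_0.
  apply exp_increasing. pose proof PI_RGT_0. nra.
Qed.

(** [QS] has a value even for a divergent series; [isQS] also asserts convergence, and so can be
    added, scaled and multiplied. *)
Definition isQS (a : nat -> R) (z l : C) : Prop :=
  is_series (fun n => a n * Re (qpow n z))%R (Re l) /\ is_series (fun n => a n * Im (qpow n z))%R (Im l).

Definition QS (a : nat -> R) (z : C) : C := csum (fun n => RtoC (a n) * qpow n z).

Lemma QS_comp a z : QS a z = (Series (fun n => a n * Re (qpow n z))%R, Series (fun n => a n * Im (qpow n z))%R).
Proof. unfold QS, csum. f_equal; apply Series_ext; intros n; unfold Cmult, Re, Im; cbn [fst snd RtoC]; ring. Qed.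

Lemma pbound_abs a z : pbound a -> UHP z ->
  ex_series (fun n => Rabs (a n * Re (qpow n z)))%R /\ ex_series (fun n => Rabs (a n * Im (qpow n z)))%R.
Proof.
  intros Pa Hz. pose proof (pbound_series a _ Pa (qabs_lt1 z Hz)) as S.
  split; apply (ex_series_le (V := R_CompleteNormedModule) _ (fun n => Rabs (a n) * qabs z ^ n)%R); auto; intros n;
    rewrite <- Cmod_qpow, Rabs_mult.
  - change (Rabs (Rabs (a n) * Rabs (Re (qpow n z))) <= Rabs (a n) * Cmod (qpow n z))%R.
    rewrite Rabs_mult, !Rabs_Rabsolu. apply Rmult_le_compat_l. apply Rabs_pos. apply re_le_Cmod.
  - change (Rabs (Rabs (a n) * Rabs (Im (qpow n z))) <= Rabs (a n) * Cmod (qpow n z))%R.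
    rewrite Rabs_mult, !Rabs_Rabsolu. apply Rmult_le_compat_l. apply Rabs_pos. apply im_le_Cmod.
Qed.

Lemma QS_correct a z : pbound a -> UHP z -> isQS a z (QS a z).
Proof.
  intros Pa Hz. destruct (pbound_abs a z Pa Hz) as [A B].
  rewrite QS_comp. split; apply Series_correct; now apply ex_series_Rabs.
Qed.

Lemma isQS_unique a z l l' : isQS a z l -> isQS a z l' -> l = l'.
Proof.
  intros [A B] [A' B'].
  apply injective_projections.
  - apply is_series_unique in A, A'. unfold Re in A, A'. congruence.
  - apply is_series_unique in B, B'. unfold Im in B, B'. congruence.
Qed.

Lemma isQS_ext a b z l : (forall n, a n = b n) -> isQS a z l -> isQS b z l.
Proof.
  intros E [A B]; split; [eapply is_series_ext; [|exact A]|eapply is_series_ext; [|exact B]];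
    intros n; cbv beta; now rewrite E.
Qed.

Lemma isQS_plus a b z l m : isQS a z l -> isQS b z m -> isQS (fun n => a n + b n)%R z (l + m).
Proof.
  intros [A B] [A' B']; split.
  - eapply is_series_ext; [|exact (is_series_plus _ _ _ _ A A')]. intros n. symmetry. apply Rmult_plus_distr_r.
  - eapply is_series_ext; [|exact (is_series_plus _ _ _ _ B B')]. intros n. symmetry. apply Rmult_plus_distr_r.
Qed.

Lemma isQS_scale c a z l : isQS a z l -> isQS (fun n => c * a n)%R z (RtoC c * l).
Proof.
  intros [A B]; split.
  - replace (Re (RtoC c * l)) with (c * Re l)%R by (destruct l; simpl; ring).
    eapply is_series_ext; [|exact (is_series_scal_l c _ _ A)]. intros n. symmetry. apply Rmult_assoc.
  - replace (Im (RtoC c * l)) with (c * Im l)%R by (destruct l; simpl; ring).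
    eapply is_series_ext; [|exact (is_series_scal_l c _ _ B)]. intros n. symmetry. apply Rmult_assoc.
Qed.

Definition conv (a b : nat -> R) (n : nat) : R := sum_f_R0 (fun k => a k * b (n - k)%nat)%R n.

(** Cauchy products of the four pairs of real and imaginary parts, recombined through q^n = q^k q^(n
    - k). *)
Lemma QS_mult a b z : pbound a -> pbound b -> UHP z -> isQS (conv a b) z (QS a z * QS b z).
Proof.
  intros Pa Pb Hz.
  destruct (pbound_abs a z Pa Hz) as [A1 A2]. destruct (pbound_abs b z Pb Hz) as [B1 B2].
  destruct (QS_correct a z Pa Hz) as [C1 C2]. destruct (QS_correct b z Pb Hz) as [D1 D2].
  pose proof (is_series_mult _ _ _ _ C1 D1 A1 B1) as M11.
  pose proof (is_series_mult _ _ _ _ C2 D2 A2 B2) as M22.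
  pose proof (is_series_mult _ _ _ _ C1 D2 A1 B2) as M12.
  pose proof (is_series_mult _ _ _ _ C2 D1 A2 B1) as M21.
  assert (Q : forall n k, (k <= n)%nat -> qpow n z = qpow k z * qpow (n - k) z).
  { intros n k Hk. rewrite <- qpow_add. f_equal. lia. }
  split.
  - eapply is_series_ext; [|exact (is_series_minus _ _ _ _ M11 M22)].
    intros n. unfold conv. rewrite (Rmult_comm _ (Re _)), scal_sum.
    etransitivity; [symmetry; apply minus_sum|]. apply sum_eq. intros k Hk.
    rewrite (Q n k Hk). unfold Cmult, Re, Im; cbn [fst snd]. ring.
  - eapply is_series_ext; [|exact (is_series_plus _ _ _ _ M12 M21)].
    intros n. unfold conv. rewrite (Rmult_comm _ (Im _)), scal_sum.
    etransitivity; [symmetry; apply sum_plus|]. apply sum_eq. intros k Hk.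
    rewrite (Q n k Hk). unfold Cmult, Re, Im; cbn [fst snd]. ring.
Qed.

(** * Termwise differentiation of q-series *)

Lemma second_order_remainder (f f1 f2 : R -> R) M : (0 <= M)%R ->
  (forall t, is_derive f t (f1 t)) -> (forall t, is_derive f1 t (f2 t)) ->
  (forall t, (0 <= t <= 1)%R -> (Rabs (f2 t) <= M)%R) -> (Rabs (f 1 - f 0 - f1 0) <= M)%R.
Proof.
  intros HM D1 D2 B.
  destruct (MVT_cor2 f f1 0 1) as [c [E Hc]]; [lra| |].
  { intros x _. now apply is_derive_Reals. }
  destruct (MVT_cor2 f1 f2 0 c) as [c' [E' Hc']]; [lra| |].
  { intros x _. now apply is_derive_Reals. }
  replace (f 1 - f 0 - f1 0)%R with (f2 c' * c)%R by lra.
  rewrite Rabs_mult, (Rabs_right c) by lra.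
  assert (Rabs (f2 c') <= M)%R by (apply B; lra). pose proof (Rabs_pos (f2 c')). nra.
Qed.

(** Taylor remainder of e^w - 1 - w for w = a + ib. Along t -> e^(tw) on [0,1] the second derivative
    w^2 e^(tw) is controlled by |w|^2 e^|a|; each component is bounded by twice that, whence the
    factor 4. *)
Lemma cexp_remainder a b :
  (Cmod ((exp a * cos b - 1 - a)%R, (exp a * sin b - b)%R) <= 4 * (a * a + b * b) * exp (Rabs a))%R.
Proof.
  set (M := (2 * (a * a + b * b) * exp (Rabs a))%R).
  pose proof (Rle_0_sqr a) as Qa. pose proof (Rle_0_sqr b) as Qb. unfold Rsqr in Qa, Qb.
  assert (H0 : (0 <= a * a + b * b)%R) by lra.
  assert (HM : (0 <= M)%R).
  { unfold M. apply Rmult_le_pos; [lra|left; apply exp_pos]. }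
  assert (He : forall t, (0 <= t <= 1)%R -> (0 < exp (a * t) <= exp (Rabs a))%R).
  { intros t Ht. split. apply exp_pos. pose proof (Rle_abs a). pose proof (Rabs_pos a).
    assert (H3 : (a * t <= Rabs a)%R) by nra. destruct H3 as [H3|H3].
    left; now apply exp_increasing. rewrite H3; lra. }
  assert (Comb : forall x y t, (0 <= t <= 1)%R -> (-1 <= x <= 1)%R -> (-1 <= y <= 1)%R ->
    (Rabs (exp (a * t) * ((a * a - b * b) * x + 2 * a * b * y)) <= M)%R).
  { intros x y t Ht Hx Hy. rewrite Rabs_mult. destruct (He t Ht).
    rewrite (Rabs_right (exp _)) by lra. replace M with (exp (Rabs a) * (2 * (a * a + b * b)))%R by (unfold M; ring).
    apply Rmult_le_compat; try lra. apply Rabs_pos.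
    assert (A1 : (Rabs ((a * a - b * b) * x) <= a * a + b * b)%R).
    { rewrite Rabs_mult. assert (Rabs x <= 1)%R by (apply Rabs_le; lra).
      assert (Rabs (a * a - b * b) <= a * a + b * b)%R by (apply Rabs_le; nra).
      pose proof (Rabs_pos x). pose proof (Rabs_pos (a * a - b * b)). nra. }
    assert (A2 : (Rabs (2 * a * b * y) <= a * a + b * b)%R).
    { rewrite Rabs_mult. assert (Rabs y <= 1)%R by (apply Rabs_le; lra).
      assert (Rabs (2 * a * b) <= a * a + b * b)%R.
      { pose proof (Rle_0_sqr (a + b)) as Q1. pose proof (Rle_0_sqr (a - b)) as Q2. unfold Rsqr in Q1, Q2. apply Rabs_le; lra. }
      pose proof (Rabs_pos y). pose proof (Rabs_pos (2 * a * b)). nra. }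
    eapply Rle_trans; [apply Rabs_triang|]. lra. }
  assert (P1 : (Rabs (exp a * cos b - 1 - a) <= M)%R).
  { pose proof (second_order_remainder (fun t => exp (a * t) * cos (b * t))%R
      (fun t => exp (a * t) * (a * cos (b * t) - b * sin (b * t)))%R
      (fun t => exp (a * t) * ((a * a - b * b) * cos (b * t) + 2 * a * b * (- sin (b * t))))%R M HM) as S.
    cbv beta in S. rewrite (Rmult_1_r a), (Rmult_1_r b), (Rmult_0_r a), (Rmult_0_r b), exp_0, cos_0, sin_0 in S.
    replace (exp a * cos b - 1 - a)%R with (exp a * cos b - 1 * 1 - 1 * (a * 1 - b * 0))%R by ring. apply S.
    - intros t. auto_derive; auto. ring.
    - intros t. auto_derive; auto. ring.
    - intros t Ht. apply Comb; auto. apply COS_bound. pose proof (SIN_bound (b * t)). lra. }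
  assert (P2 : (Rabs (exp a * sin b - b) <= M)%R).
  { pose proof (second_order_remainder (fun t => exp (a * t) * sin (b * t))%R
      (fun t => exp (a * t) * (a * sin (b * t) + b * cos (b * t)))%R
      (fun t => exp (a * t) * ((a * a - b * b) * sin (b * t) + 2 * a * b * cos (b * t)))%R M HM) as S.
    cbv beta in S. rewrite (Rmult_1_r a), (Rmult_1_r b), (Rmult_0_r a), (Rmult_0_r b), exp_0, cos_0, sin_0 in S.
    replace (exp a * sin b - b)%R with (exp a * sin b - 1 * 0 - 1 * (a * 0 + b * 1))%R by ring. apply S.
    - intros t. auto_derive; auto. ring.
    - intros t. auto_derive; auto. ring.
    - intros t Ht. apply Comb; auto. apply SIN_bound. apply COS_bound. }
  eapply Rle_trans; [apply Cmod_le_abs|]. cbn [Re Im fst snd]. unfold Re, Im. cbn [fst snd]. unfold M in *. lra.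
Qed.

(** General complex terms: the remainder of a difference quotient has complex coefficients in front
    of q^n, which [isQS] does not cover. *)
Definition isC (t : nat -> C) (l : C) : Prop :=
  is_series (fun n => Re (t n)) (Re l) /\ is_series (fun n => Im (t n)) (Im l).

Lemma isQS_isC a z l : isQS a z l <-> isC (fun n => RtoC (a n) * qpow n z) l.
Proof.
  assert (ER : forall n, (a n * Re (qpow n z))%R = Re (RtoC (a n) * qpow n z))
    by (intros n; unfold Cmult, Re, Im; cbn [fst snd RtoC]; ring).
  assert (EI : forall n, (a n * Im (qpow n z))%R = Im (RtoC (a n) * qpow n z))
    by (intros n; unfold Cmult, Re, Im; cbn [fst snd RtoC]; ring).
  unfold isQS, isC. split; intros [A B]; split.
  - exact (is_series_ext _ _ _ ER A).
  - exact (is_series_ext _ _ _ EI B).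
  - exact (is_series_ext _ _ _ (fun n => eq_sym (ER n)) A).
  - exact (is_series_ext _ _ _ (fun n => eq_sym (EI n)) B).
Qed.

Lemma isC_plus t u l m : isC t l -> isC u m -> isC (fun n => t n + u n) (l + m).
Proof.
  intros [A B] [A' B']; split.
  - exact (is_series_plus _ _ _ _ A A').
  - exact (is_series_plus _ _ _ _ B B').
Qed.

Lemma isC_scale c t l : isC t l -> isC (fun n => c * t n) (c * l).
Proof.
  intros [A B]; destruct c as [x y]; split.
  - exact (is_series_minus _ _ _ _ (is_series_scal_l x _ _ A) (is_series_scal_l y _ _ B)).
  - exact (is_series_plus _ _ _ _ (is_series_scal_l x _ _ B) (is_series_scal_l y _ _ A)).
Qed.

Lemma isC_bound t l (B : nat -> R) : isC t l -> (forall n, (Cmod (t n) <= B n)%R) -> ex_series B ->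
  (Cmod l <= 2 * Series B)%R.
Proof.
  intros [A A'] H EB.
  assert (X : forall u : nat -> R, (forall n, (Rabs (u n) <= B n)%R) -> forall s, is_series u s -> (Rabs s <= Series B)%R).
  { intros u Hu s Hs. rewrite <- (is_series_unique _ _ Hs).
    assert (Ea : ex_series (fun n => Rabs (u n))).
    { apply (ex_series_le (V := R_CompleteNormedModule) _ B); auto.
      intros n. change (Rabs (Rabs (u n)) <= B n)%R. rewrite Rabs_Rabsolu. auto. }
    eapply Rle_trans; [apply Series_Rabs; auto|]. apply Series_le; auto.
    intros n; split; auto. apply Rabs_pos. }
  pose proof (X _ (fun n => Rle_trans _ _ _ (re_le_Cmod (t n)) (H n)) _ A).
  pose proof (X _ (fun n => Rle_trans _ _ _ (im_le_Cmod (t n)) (H n)) _ A').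
  pose proof (Cmod_le_abs l). lra.
Qed.

Lemma pbound_n a : pbound a -> pbound (fun n => INR n * a n)%R.
Proof.
  intros (K & m & HK & B). exists K, (S m). split; auto. intros n.
  rewrite Rabs_mult, (Rabs_right (INR n)) by apply Rle_ge, pos_INR.
  rewrite <- tech_pow_Rmult.
  assert (0 <= INR n <= INR (S n))%R. { split. apply pos_INR. rewrite S_INR. lra. }
  specialize (B n). pose proof (Rabs_pos (a n)).
  assert (0 <= INR (S n) ^ m)%R by (apply pow_le; lra).
  replace (K * (INR (S n) * INR (S n) ^ m))%R with (INR (S n) * (K * INR (S n) ^ m))%R by ring.
  apply Rmult_le_compat; lra.
Qed.

Lemma exp_pow_INR x n : (exp x ^ n = exp (INR n * x))%R.
Proof.
  induction n as [|n IH].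
  - simpl. now rewrite Rmult_0_l, exp_0.
  - rewrite <- tech_pow_Rmult, S_INR, IH, <- exp_plus. f_equal. ring.
Qed.

(** Moving z by |h| < Im z / 2 costs at most the factor e^(pi n Im z), which is half of the decay
    e^(-2 pi n Im z) of q^n; the other half remains for summation. *)
Lemma qpow_term_bound n z h : (Cmod h < Im z / 2)%R ->
  (Cmod (qpow n (z + h) - qpow n z - (Ci * RtoC (2 * PI * INR n) * h) * qpow n z)
   <= 16 * PI * PI * (INR n * INR n) * exp (- PI * Im z) ^ n * (Cmod h * Cmod h))%R.
Proof.
  intros Hh. rewrite qpow_plus.
  replace (qpow n z * qpow n h - qpow n z - (Ci * RtoC (2 * PI * INR n) * h) * qpow n z)
    with (qpow n z * (qpow n h - 1 - Ci * RtoC (2 * PI * INR n) * h)) by ring.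
  rewrite Cmod_mult, Cmod_qpow.
  set (a := (- 2 * PI * INR n * Im h)%R). set (b := (2 * PI * INR n * Re h)%R).
  replace (qpow n h - 1 - Ci * RtoC (2 * PI * INR n) * h) with ((exp a * cos b - 1 - a)%R, (exp a * sin b - b)%R).
  2: { unfold qpow. fold a b. unfold a, b. destruct h as [x y]. C_ring. }
  pose proof (pos_INR n) as Pn. pose proof PI_RGT_0 as Pp.
  assert (Eab : (a * a + b * b = 4 * PI * PI * (INR n * INR n) * (Cmod h * Cmod h))%R).
  { unfold Cmod. rewrite sqrt_sqrt by nra. unfold a, b, Re, Im. ring. }
  assert (Ea : (exp (Rabs a) <= exp (PI * Im z) ^ n)%R).
  { rewrite exp_pow_INR.
    assert (L : (Rabs a <= INR n * (PI * Im z))%R).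
    { unfold a. rewrite !Rabs_mult. rewrite (Rabs_right PI), (Rabs_right (INR n)) by lra.
      replace (Rabs (-2)) with 2%R by (rewrite Rabs_left; lra).
      pose proof (im_le_Cmod h).
      replace (2 * PI * INR n * Rabs (Im h))%R with (INR n * (PI * (2 * Rabs (Im h))))%R by ring.
      apply Rmult_le_compat_l; auto. apply Rmult_le_compat_l; lra. }
    destruct L as [L|L]; [left; now apply exp_increasing|rewrite L; lra]. }
  eapply Rle_trans.
  { apply Rmult_le_compat_l; [apply pow_le; left; apply exp_pos|]. apply cexp_remainder. }
  rewrite Eab.
  assert (Er : (exp (- PI * Im z) = qabs z * exp (PI * Im z))%R).
  { unfold qabs. rewrite <- exp_plus. f_equal. ring. }
  rewrite Er, Rpow_mult_distr.
  assert (Q0 : (0 <= qabs z ^ n)%R) by (apply pow_le; left; apply exp_pos).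
  assert (X0 : (0 <= 16 * PI * PI * (INR n * INR n) * (Cmod h * Cmod h) * qabs z ^ n)%R).
  { pose proof (Cmod_ge_0 h). repeat (first [lra | apply Rmult_le_pos]). }
  apply Rmult_le_compat_l with (r := (16 * PI * PI * (INR n * INR n) * (Cmod h * Cmod h) * qabs z ^ n)%R) in Ea; auto.
  lra.
Qed.

(** The second order remainders of the terms are dominated by n^2 |a_n| e^(-pi n Im z), which is
    summable because n^2 a_n still has polynomial growth. *)
Lemma QS_cder a z : pbound a -> UHP z ->
  cder (QS a) z (Ci * RtoC (2 * PI) * QS (fun n => INR n * a n)%R z).
Proof.
  intros Pa Hz. pose proof Hz as Hy. unfold UHP in Hy.
  assert (Pnn : pbound (fun n => INR n * (INR n * a n))%R) by (apply (pbound_n (fun n => INR n * a n)%R); now apply pbound_n).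
  pose proof PI_RGT_0 as Pp.
  assert (Hr : (0 < exp (- PI * Im z) < 1)%R).
  { split. apply exp_pos. rewrite <- exp_0. apply exp_increasing. pose proof (Rmult_lt_0_compat _ _ Pp Hy). lra. }
  pose proof (pbound_series _ _ Pnn Hr) as SB.
  set (B := (fun n => Rabs (INR n * (INR n * a n)) * exp (- PI * Im z) ^ n)%R) in *.
  assert (SB0 : (0 <= Series B)%R).
  { replace 0%R with (Series (fun n => 0 * B n)%R) by (rewrite Series_scal_l; ring).
    apply Series_le; auto. intros n; split; [lra|]. rewrite Rmult_0_l.
    apply Rmult_le_pos. apply Rabs_pos. apply pow_le; lra. }
  apply cder_quadratic with (d := (Im z / 2)%R) (K := (2 * (16 * PI * PI * Series B))%R); [lra| |].
  { repeat (first [lra | apply Rmult_le_pos]). }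
  intros h Hh.
  assert (Hzh : UHP (z + h)).
  { unfold UHP. pose proof (im_le_Cmod h). destruct z, h. simpl in *. unfold Rabs in H. destruct (Rcase_abs r2); lra. }
  pose proof (proj1 (isQS_isC _ _ _) (QS_correct a (z + h) Pa Hzh)) as S1.
  pose proof (proj1 (isQS_isC _ _ _) (QS_correct a z Pa Hz)) as S2.
  pose proof (proj1 (isQS_isC _ _ _) (QS_correct _ z (pbound_n a Pa) Hz)) as S3.
  pose proof (isC_plus _ _ _ _ (isC_plus _ _ _ _ S1 (isC_scale (- (1)) _ _ S2)) (isC_scale (- (Ci * RtoC (2 * PI) * h)) _ _ S3)) as S4.
  replace (QS a (z + h)%C - QS a z - Ci * RtoC (2 * PI) * QS (fun n => INR n * a n)%R z * h)
    with (QS a (z + h)%C + - (1) * QS a z + - (Ci * RtoC (2 * PI) * h) * QS (fun n => INR n * a n)%R z) by ring.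
  replace (2 * (16 * PI * PI * Series B) * (Cmod h * Cmod h))%R
    with (2 * Series (fun n => 16 * PI * PI * (Cmod h * Cmod h) * B n))%R by (rewrite Series_scal_l; ring).
  apply (isC_bound _ _ _ S4).
  - intros n.
    replace (RtoC (a n) * qpow n (z + h) + - (1) * (RtoC (a n) * qpow n z) + - (Ci * RtoC (2 * PI) * h) * (RtoC (INR n * a n) * qpow n z))
      with (RtoC (a n) * (qpow n (z + h) - qpow n z - (Ci * RtoC (2 * PI * INR n) * h) * qpow n z))
      by (rewrite !RtoC_mult; ring).
    rewrite Cmod_mult, Cmod_R. pose proof (Rabs_pos (a n)).
    eapply Rle_trans. { apply Rmult_le_compat_l; auto. now apply qpow_term_bound. }
    unfold B. rewrite !Rabs_mult, (Rabs_right (INR n)) by apply Rle_ge, pos_INR.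
    right. ring.
  - apply (ex_series_scal_l (K := R_AbsRing) (V := R_NormedModule)). exact SB.
Qed.

Lemma QS_dq a z : pbound a -> UHP z -> dq (QS a) z = QS (fun n => INR n * a n)%R z.
Proof.
  intros Pa Hz. unfold dq. rewrite (cder_cderiv _ _ _ (QS_cder a z Pa Hz)).
  pose proof PI_RGT_0. destruct (QS (fun n => INR n * a n)%R z) as [u v].
  C_field; lra.
Qed.

(** * Convolution sums of divisor functions *)

Open Scope R_scope.

Definition lsum {A} (f : A -> R) (l : list A) : R := fold_right Rplus 0 (map f l).

Lemma lsum_ext {A} (f g : A -> R) l : (forall x, In x l -> f x = g x) -> lsum f l = lsum g l.
Proof. intros H. unfold lsum. f_equal. now apply map_ext_in. Qed.

Lemma lsum_plus {A} (f g : A -> R) l : lsum (fun x => f x + g x) l = lsum f l + lsum g l.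
Proof. unfold lsum. induction l as [|x l IH]; simpl; [ring|rewrite IH; ring]. Qed.

Lemma lsum_scale {A} c (f : A -> R) l : lsum (fun x => c * f x) l = c * lsum f l.
Proof. unfold lsum. induction l as [|x l IH]; simpl; [ring|rewrite IH; ring]. Qed.

Lemma lsum_zero {A} (f : A -> R) l : (forall x, In x l -> f x = 0) -> lsum f l = 0.
Proof.
  intros H. rewrite (lsum_ext f (fun x => 0 * 0)), lsum_scale; [ring|]. intros x Hx. rewrite H; auto; ring.
Qed.

Lemma lsum_app {A} (f : A -> R) l l' : lsum f (l ++ l') = lsum f l + lsum f l'.
Proof. unfold lsum. induction l as [|x l IH]; simpl; [ring|rewrite IH; ring]. Qed.

Lemma lsum_map {A B} (f : B -> R) (g : A -> B) l : lsum f (map g l) = lsum (fun x => f (g x)) l.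
Proof. unfold lsum. now rewrite map_map. Qed.

Lemma lsum_prod {A B} (f : A * B -> R) l l' :
  lsum f (list_prod l l') = lsum (fun a => lsum (fun b => f (a, b)) l') l.
Proof.
  induction l as [|x l IH]; [reflexivity|]. simpl list_prod. rewrite lsum_app, lsum_map, IH. reflexivity.
Qed.

Lemma lsum_filter {A} (f : A -> R) p l : lsum f (filter p l) = lsum (fun x => if p x then f x else 0) l.
Proof.
  unfold lsum. induction l as [|x l IH]; [reflexivity|]. simpl. destruct (p x); simpl; rewrite IH; ring.
Qed.

Lemma lsum_perm {A} (f : A -> R) l l' : Permutation l l' -> lsum f l = lsum f l'.
Proof. unfold lsum. induction 1; simpl; try lra. Qed.

Lemma lsum_bij {A B} (h : B -> R) (f : A -> B) (g : B -> A) l l' : NoDup l -> NoDup l' ->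
  (forall x, In x l -> In (f x) l' /\ g (f x) = x) -> (forall y, In y l' -> In (g y) l /\ f (g y) = y) ->
  lsum (fun x => h (f x)) l = lsum h l'.
Proof.
  intros N N' F G. rewrite <- lsum_map. apply lsum_perm. apply NoDup_Permutation; auto.
  - apply FinFun.Injective_map_NoDup_in; auto. intros x y Hx Hy E.
    rewrite <- (proj2 (F x Hx)), <- (proj2 (F y Hy)). now rewrite E.
  - intros y. rewrite in_map_iff. split.
    + intros (x & <- & Hx). now apply F.
    + intros Hy. exists (g y). split; now apply G.
Qed.

Lemma NoDup_list_prod {A B} (l : list A) (l' : list B) : NoDup l -> NoDup l' -> NoDup (list_prod l l').
Proof.
  intros N N'. induction N as [|x l Hx N IH]; simpl; [constructor|].
  apply NoDup_app; auto.
  - apply FinFun.Injective_map_NoDup; auto. intros a b E. congruence.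
  - intros [a b] H1 H2. apply in_map_iff in H1. destruct H1 as (c & E & _). injection E as -> ->.
    apply in_prod_iff in H2. tauto.
Qed.

Definition quads (n : nat) : list ((nat * nat) * (nat * nat)) :=
  filter (fun q => (fst (fst q) * fst (snd q) + snd (fst q) * snd (snd q) =? n)%nat)
    (list_prod (list_prod (seq 1 n) (seq 1 n)) (list_prod (seq 1 n) (seq 1 n))).

Lemma quads_NoDup n : NoDup (quads n).
Proof. apply NoDup_filter. repeat apply NoDup_list_prod; apply seq_NoDup. Qed.

Lemma in_quads n a b x y : In ((a, b), (x, y)) (quads n) <->
  (1 <= a /\ 1 <= b /\ 1 <= x /\ 1 <= y /\ a * x + b * y = n)%nat.
Proof.
  unfold quads. rewrite filter_In, !in_prod_iff, !in_seq, Nat.eqb_eq. simpl fst. simpl snd. split.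
  - lia.
  - intros (A & B & X & Y & E). split; [|exact E]. nia.
Qed.

Definition psum (p : nat -> nat -> nat -> nat -> bool) (F : R -> R -> R) (n : nat) : R :=
  lsum (fun q => let '((a, b), (x, y)) := q in if p a b x y then F (INR a) (INR b) else 0) (quads n).

Lemma psum_filter p F n : psum p F n =
  lsum (fun q => F (INR (fst (fst q))) (INR (snd (fst q))))
    (filter (fun q => p (fst (fst q)) (snd (fst q)) (fst (snd q)) (snd (snd q))) (quads n)).
Proof.
  rewrite lsum_filter. apply lsum_ext. intros [[a b] [x y]] _. reflexivity.
Qed.

Lemma psum_bij p p' F F' n (f g : nat * nat * (nat * nat) -> nat * nat * (nat * nat)) :
  (forall a b x y, (1 <= a /\ 1 <= b /\ 1 <= x /\ 1 <= y /\ a * x + b * y = n)%nat -> p a b x y = true ->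
     let '((a', b'), (x', y')) := f ((a, b), (x, y)) in
     (1 <= a' /\ 1 <= b' /\ 1 <= x' /\ 1 <= y' /\ a' * x' + b' * y' = n)%nat /\ p' a' b' x' y' = true /\
     g ((a', b'), (x', y')) = ((a, b), (x, y)) /\ F (INR a) (INR b) = F' (INR a') (INR b')) ->
  (forall a b x y, (1 <= a /\ 1 <= b /\ 1 <= x /\ 1 <= y /\ a * x + b * y = n)%nat -> p' a b x y = true ->
     let '((a', b'), (x', y')) := g ((a, b), (x, y)) in
     (1 <= a' /\ 1 <= b' /\ 1 <= x' /\ 1 <= y' /\ a' * x' + b' * y' = n)%nat /\ p a' b' x' y' = true /\
     f ((a', b'), (x', y')) = ((a, b), (x, y))) ->
  psum p F n = psum p' F' n.
Proof.
  intros H G. rewrite !psum_filter.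
  rewrite <- (lsum_bij (fun q => F' (INR (fst (fst q))) (INR (snd (fst q)))) f g
     (filter (fun q => p (fst (fst q)) (snd (fst q)) (fst (snd q)) (snd (snd q))) (quads n))).
  - apply lsum_ext. intros [[a b] [x y]] Hq. apply filter_In in Hq. destruct Hq as [Hq Hp].
    apply in_quads in Hq. specialize (H a b x y Hq Hp).
    destruct (f (a, b, (x, y))) as [[a' b'] [x' y']]. simpl. apply H.
  - apply NoDup_filter, quads_NoDup.
  - apply NoDup_filter, quads_NoDup.
  - intros [[a b] [x y]] Hq. apply filter_In in Hq. destruct Hq as [Hq Hp].
    apply in_quads in Hq. specialize (H a b x y Hq Hp).
    destruct (f (a, b, (x, y))) as [[a' b'] [x' y']]. rewrite filter_In, in_quads. tauto.
  - intros [[a b] [x y]] Hq. apply filter_In in Hq. destruct Hq as [Hq Hp].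
    apply in_quads in Hq. specialize (G a b x y Hq Hp).
    destruct (g (a, b, (x, y))) as [[a' b'] [x' y']]. rewrite filter_In, in_quads. tauto.
Qed.

Notation total := (psum (fun _ _ _ _ => true)).

Definition swapq (q : nat * nat * (nat * nat)) := let '((a, b), (x, y)) := q in ((b, a), (y, x)).

Lemma psum_split c (F : R -> R -> R) n :
  total F n =
  psum (fun a b x y => match c a b x y with Lt => true | _ => false end) F n +
  psum (fun a b x y => match c a b x y with Gt => true | _ => false end) F n +
  psum (fun a b x y => match c a b x y with Eq => true | _ => false end) F n.
Proof.
  unfold psum. rewrite <- !lsum_plus. apply lsum_ext. intros [[a b] [x y]] _. destruct (c a b x y); ring.
Qed.

(* Skoruppa's argument: (a,b,x,y) |-> (a-b,b,x,x+y) maps the solutions with a > b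
   bijectively to those with x < y. *)
Theorem quadratic_symmetric_sum (F : R -> R -> R) n :
  (forall u v, F u v = F v u) -> (forall u v, F u v = F u (u - v)) ->
  total F n - total (fun a b => F a (- b)) n =
  psum (fun a b x y => (a =? b)%nat) F n - psum (fun a b x y => (x =? y)%nat) (fun a b => F a (- b)) n.
Proof.
  intros S T. set (G := fun a b => F a (- b)).
  (* F(u,-v) = F(u,u+v) = F(u+v,u) = F(u+v,v), and then back with u and v exchanged. *)
  assert (GS : forall u v, G u v = G v u).
  { intros u v. unfold G. rewrite (T u), (S u (u - - v)), (T (u - - v)), (S (u - - v)).
    rewrite (T v). replace (u - - v - u) with v by ring. replace (v - - u) with (u - - v) by ring. reflexivity. }
  assert (GF : forall u v, F (u + v) v = G u v).
  { intros u v. unfold G. rewrite (T (u + v) v), (S (u + v)), (T u). f_equal; ring. }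
  rewrite (psum_split (fun a b x y => Nat.compare a b) F).
  rewrite (psum_split (fun a b x y => Nat.compare x y) G).
  assert (E1 : psum (fun a b x y => match Nat.compare a b with Lt => true | _ => false end) F n =
     psum (fun a b x y => match Nat.compare a b with Gt => true | _ => false end) F n).
  { apply psum_bij with (f := swapq) (g := swapq); intros a b x y H E; simpl.
    - destruct (Nat.compare_spec a b); try discriminate. repeat split; try lia; auto.
      destruct (Nat.compare_spec b a); auto; lia.
    - destruct (Nat.compare_spec a b); try discriminate. repeat split; try lia; auto.
      destruct (Nat.compare_spec b a); auto; lia. }
  assert (E2 : psum (fun a b x y => match Nat.compare a b with Gt => true | _ => false end) F n =
     psum (fun a b x y => match Nat.compare x y with Lt => true | _ => false end) G n).
  { apply psum_bij with (f := fun q => let '((a, b), (x, y)) := q in ((a - b, b), (x, x + y))%nat)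
      (g := fun q => let '((a, b), (x, y)) := q in ((a + b, b), (x, y - x))%nat); intros a b x y H E; simpl.
    - destruct (Nat.compare_spec a b); try discriminate. repeat split; try lia.
      + destruct (Nat.compare_spec x (x + y)); auto; lia.
      + f_equal; f_equal; lia.
      + rewrite <- GF, <- plus_INR. f_equal. f_equal. lia.
    - destruct (Nat.compare_spec x y); try discriminate. repeat split; try lia.
      + destruct (Nat.compare_spec (a + b) b); auto; lia.
      + f_equal; f_equal; lia. }
  assert (E3 : psum (fun a b x y => match Nat.compare x y with Lt => true | _ => false end) G n =
     psum (fun a b x y => match Nat.compare x y with Gt => true | _ => false end) G n).
  { apply psum_bij with (f := swapq) (g := swapq); intros a b x y H E; simpl.
    - destruct (Nat.compare_spec x y); try discriminate. repeat split; try lia; auto.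
      destruct (Nat.compare_spec y x); auto; lia.
    - destruct (Nat.compare_spec x y); try discriminate. repeat split; try lia; auto.
      destruct (Nat.compare_spec y x); auto; lia. }
  assert (E4 : psum (fun a b x y => match Nat.compare a b with Eq => true | _ => false end) F n =
     psum (fun a b x y => (a =? b)%nat) F n).
  { unfold psum. apply lsum_ext. intros [[a b] [x y]] _.
    destruct (Nat.compare_spec a b), (Nat.eqb_spec a b); auto; lia. }
  assert (E5 : psum (fun a b x y => match Nat.compare x y with Eq => true | _ => false end) G n =
     psum (fun a b x y => (x =? y)%nat) G n).
  { unfold psum. apply lsum_ext. intros [[a b] [x y]] _.
    destruct (Nat.compare_spec x y), (Nat.eqb_spec x y); auto; lia. }
  rewrite E1, E2, E4, E5, E3. ring.
Qed.

(** * Divisor sums and the diagonals a = b and x = y *)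

Definition dsum (f : nat -> R) (n : nat) : R :=
  lsum (fun d => if (n mod d =? 0)%nat then f d else 0) (seq 1 n).

Lemma mod_eqb_divide n d : (1 <= d)%nat -> (n mod d =? 0)%nat = true <-> exists k, n = (k * d)%nat.
Proof.
  intros Hd. rewrite Nat.eqb_eq. apply Nat.Lcm0.mod_divide.
Qed.

Lemma lsum_seq_lt (f : nat -> R) m N : (m <= N)%nat ->
  lsum (fun x => if (x <=? m)%nat then f x else 0) (seq 1 N) = lsum f (seq 1 m).
Proof.
  intros H. replace N with (m + (N - m))%nat by lia. rewrite seq_app, lsum_app.
  rewrite (lsum_zero _ (seq (1 + m) (N - m))).
  - rewrite Rplus_0_r. apply lsum_ext. intros x Hx. apply in_seq in Hx. destruct (Nat.leb_spec x m); auto; lia.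
  - intros x Hx. apply in_seq in Hx. destruct (Nat.leb_spec x m); auto; lia.
Qed.

(** a = b = d turns the equation into d (x + y) = n: d divides n, and x takes n/d - 1 values. The
    list L enumerates the pairs (d, x). *)
Lemma diag_ab F n : psum (fun a b x y => (a =? b)%nat) F n =
  dsum (fun d => (INR n / INR d - 1) * F (INR d) (INR d)) n.
Proof.
  rewrite psum_filter.
  set (L := filter (fun q => (andb (n mod fst q =? 0) (snd q <? n / fst q))%nat) (list_prod (seq 1 n) (seq 1 n))).
  rewrite (lsum_ext _ (fun q => F (INR (fst (fst q))) (INR (fst (fst q))))).
  2: { intros [[a b] [x y]] H. apply filter_In in H. destruct H as [_ H]. simpl in *. apply Nat.eqb_eq in H. now subst. }
  rewrite <- (lsum_bij (fun q => F (INR (fst (fst q))) (INR (fst (fst q))))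
     (fun q => ((fst q, fst q), (snd q, n / fst q - snd q)%nat)) (fun q => (fst (fst q), fst (snd q))) L).
  - unfold L. rewrite lsum_filter, lsum_prod. unfold dsum. apply lsum_ext. intros d Hd. apply in_seq in Hd. simpl.
    destruct (n mod d =? 0)%nat eqn:E.
    + apply mod_eqb_divide in E; [|lia]. destruct E as [k E].
      assert (Ek : (n / d = k)%nat) by (rewrite E; apply Nat.div_mul; lia). rewrite Ek. simpl.
      transitivity (lsum (fun b => F (INR d) (INR d) * 1) (seq 1 (k - 1))).
      * rewrite <- (lsum_seq_lt _ (k - 1) n) by nia. apply lsum_ext. intros x Hx. apply in_seq in Hx.
        destruct (Nat.ltb_spec x k), (Nat.leb_spec x (k - 1)); try lia; ring.
      * rewrite lsum_scale.
        assert (LC : forall m s, lsum (fun _ : nat => 1) (seq s m) = INR m).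
        { induction m; intros s. reflexivity. simpl seq. rewrite S_INR. unfold lsum in *. simpl. rewrite IHm. ring. }
        rewrite LC, minus_INR by nia. rewrite E, mult_INR. simpl. field. apply not_0_INR. lia.
    + simpl. apply lsum_zero. auto.
  - apply NoDup_filter, NoDup_list_prod; apply seq_NoDup.
  - apply NoDup_filter, quads_NoDup.
  - intros [d x] H. unfold L in H. apply filter_In in H. destruct H as [H1 H2].
    apply in_prod_iff in H1. rewrite !in_seq in H1. simpl in *. apply andb_prop in H2. destruct H2 as [H2 H3].
    apply mod_eqb_divide in H2; [|lia]. destruct H2 as [k E]. apply Nat.ltb_lt in H3.
    assert (Ek : (n / d = k)%nat) by (rewrite E; apply Nat.div_mul; lia). rewrite Ek in *.
    split; [|reflexivity]. apply filter_In. rewrite in_quads. simpl. rewrite Nat.eqb_refl. split; auto.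
    repeat split; lia.
  - intros [[a b] [x y]] H. apply filter_In in H. destruct H as [H1 H2]. simpl in *. apply Nat.eqb_eq in H2. subst b.
    apply in_quads in H1. assert (E : (n = (x + y) * a)%nat) by lia.
    assert (Ek : (n / a = x + y)%nat) by (rewrite E; apply Nat.div_mul; lia).
    split.
    + unfold L. apply filter_In. rewrite in_prod_iff, !in_seq. simpl. rewrite Ek. split; [nia|].
      apply andb_true_intro. split. apply mod_eqb_divide; [lia|eauto]. apply Nat.ltb_lt. lia.
    + rewrite Ek. f_equal. f_equal. lia.
Qed.

(** x = y turns the equation into x (a + b) = n: e = a + b divides n, and a runs from 1 to e - 1.
    The list L enumerates the pairs (e, a). *)
Lemma diag_xy (G : R -> R -> R) n : psum (fun a b x y => (x =? y)%nat) G n =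
  dsum (fun e => lsum (fun a => G (INR a) (INR e - INR a)) (seq 1 (e - 1))) n.
Proof.
  rewrite psum_filter.
  set (L := filter (fun q => (andb (n mod fst q =? 0) (snd q <=? fst q - 1))%nat) (list_prod (seq 1 n) (seq 1 n))).
  rewrite <- (lsum_bij (fun q => G (INR (fst (fst q))) (INR (snd (fst q))))
     (fun q => ((snd q, fst q - snd q), (n / fst q, n / fst q))%nat) (fun q => ((fst (fst q) + snd (fst q))%nat, fst (fst q))) L).
  - unfold L. rewrite lsum_filter, lsum_prod. unfold dsum. apply lsum_ext. intros d Hd. apply in_seq in Hd. simpl.
    destruct (n mod d =? 0)%nat eqn:E; simpl.
    + rewrite <- (lsum_seq_lt _ (d - 1) n) by lia. apply lsum_ext. intros x Hx. apply in_seq in Hx.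
      destruct (Nat.leb_spec x (d - 1)); auto. rewrite minus_INR by lia. reflexivity.
    + apply lsum_zero. auto.
  - apply NoDup_filter, NoDup_list_prod; apply seq_NoDup.
  - apply NoDup_filter, quads_NoDup.
  - intros [d x] H. unfold L in H. apply filter_In in H. destruct H as [H1 H2].
    apply in_prod_iff in H1. rewrite !in_seq in H1. simpl in *. apply andb_prop in H2. destruct H2 as [H2 H3].
    apply mod_eqb_divide in H2; [|lia]. destruct H2 as [k E]. apply Nat.leb_le in H3.
    assert (Ek : (n / d = k)%nat) by (rewrite E; apply Nat.div_mul; lia). rewrite Ek in *.
    split.
    + apply filter_In. rewrite in_quads. simpl. rewrite Nat.eqb_refl. split; auto.
      repeat split; nia.
    + f_equal. lia.
  - intros [[a b] [x y]] H. apply filter_In in H. destruct H as [H1 H2]. simpl in *. apply Nat.eqb_eq in H2. subst y.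
    apply in_quads in H1. assert (E : (n = x * (a + b))%nat) by lia.
    assert (Ek : (n / (a + b) = x)%nat) by (rewrite E; apply Nat.div_mul; lia).
    split.
    + unfold L. apply filter_In. rewrite in_prod_iff, !in_seq. simpl. split; [nia|].
      apply andb_true_intro. split. apply mod_eqb_divide; [lia|eauto]. apply Nat.leb_le. lia.
    + rewrite Ek. f_equal. f_equal. lia.
Qed.

Lemma sigma_dsum k n : (1 <= n)%nat -> Defs.sigma k n = dsum (fun d => INR d ^ k) n.
Proof.
  intros Hn. unfold Defs.sigma, dsum.
  assert (E : forall (f : nat -> R) m, sum_f_R0 f m = lsum (fun d => f (d - 1)%nat) (seq 1 (S m))).
  { intros f m. induction m as [|m IH]. { unfold lsum. simpl. ring. }
    rewrite seq_S, lsum_app. simpl sum_f_R0. rewrite IH. f_equal. unfold lsum. cbn [map fold_right].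
    replace (1 + S m - 1)%nat with (S m) by lia. ring. }
  rewrite E. replace (S (n - 1)) with n by lia. apply lsum_ext. intros d Hd. apply in_seq in Hd.
  replace (S (d - 1)) with d by lia. reflexivity.
Qed.

(** Solutions are grouped by m = a x; then a runs over the divisors of m and b over those of n -
    m. *)
Lemma sigma_convolution i j n : total (fun a b => a ^ i * b ^ j) n =
  lsum (fun m => Defs.sigma i m * Defs.sigma j (n - m)) (seq 1 (n - 1)).
Proof.
  unfold psum.
  rewrite (lsum_ext _ (fun q => INR (fst (fst q)) ^ i * INR (snd (fst q)) ^ j))
    by (intros [[a b] [x y]] _; reflexivity).
  set (L := filter (fun q => (andb (fst q mod fst (snd q) =? 0) ((n - fst q) mod snd (snd q) =? 0))%nat)
     (list_prod (seq 1 (n - 1)) (list_prod (seq 1 n) (seq 1 n)))).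
  rewrite <- (lsum_bij (fun q => INR (fst (fst q)) ^ i * INR (snd (fst q)) ^ j)
     (fun q => ((fst (snd q), snd (snd q)), (fst q / fst (snd q), (n - fst q) / snd (snd q)))%nat)
     (fun q => ((fst (fst q) * fst (snd q))%nat, (fst (fst q), snd (fst q)))) L).
  - unfold L. rewrite lsum_filter, lsum_prod. apply lsum_ext. intros m Hm. apply in_seq in Hm.
    rewrite lsum_prod. simpl.
    assert (X : forall k m, (1 <= m <= n)%nat -> Defs.sigma k m = lsum (fun d => if (m mod d =? 0)%nat then INR d ^ k else 0) (seq 1 n)).
    { intros k m' Hm'. rewrite sigma_dsum by lia. unfold dsum. rewrite <- (lsum_seq_lt _ m' n) by lia. apply lsum_ext.
      intros d Hd. apply in_seq in Hd. destruct (Nat.leb_spec d m'); auto.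
      rewrite Nat.mod_small by lia. destruct (Nat.eqb_spec m' 0); auto; lia. }
    rewrite (X i m), (X j (n - m)%nat) by lia. rewrite Rmult_comm, <- lsum_scale. apply lsum_ext.
    intros a _. rewrite Rmult_comm, <- lsum_scale. apply lsum_ext. intros b _.
    destruct (m mod a =? 0)%nat, ((n - m) mod b =? 0)%nat; simpl; ring.
  - apply NoDup_filter. repeat apply NoDup_list_prod; apply seq_NoDup.
  - apply quads_NoDup.
  - intros [m [a b]] H. unfold L in H. apply filter_In in H. destruct H as [H1 H2].
    rewrite !in_prod_iff, !in_seq in H1. simpl in *. apply andb_prop in H2. destruct H2 as [H2 H3].
    apply mod_eqb_divide in H2; [|lia]. destruct H2 as [k E]. apply mod_eqb_divide in H3; [|lia]. destruct H3 as [l E'].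
    assert (Ek : (m / a = k)%nat) by (rewrite E; apply Nat.div_mul; lia).
    assert (El : ((n - m) / b = l)%nat) by (rewrite E'; apply Nat.div_mul; lia). rewrite Ek, El.
    split.
    + apply in_quads. repeat split; try nia.
    + f_equal. lia.
  - intros [[a b] [x y]] H. apply in_quads in H. simpl.
    assert (E : (n - a * x = y * b)%nat) by lia.
    assert (Ex : (a * x / a = x)%nat) by (rewrite Nat.mul_comm; apply Nat.div_mul; lia).
    assert (Ey : ((n - a * x) / b = y)%nat) by (rewrite E; apply Nat.div_mul; lia).
    rewrite Ex, Ey. split; [|reflexivity]. unfold L. apply filter_In. rewrite !in_prod_iff, !in_seq. simpl. split; [nia|].
    apply andb_true_intro. split; apply mod_eqb_divide; try lia.
    + exists x. lia.
    + exists y. lia.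
Qed.

(** Faulhaber's formulas, up to the degree 6 of the largest polynomial F below. *)
Lemma power_sums e : (1 <= e)%nat ->
  let s k := lsum (fun a => INR a ^ k) (seq 1 (e - 1)) in let x := INR e in
  s 0%nat = x - 1 /\ s 1%nat = x ^ 2 / 2 - x / 2 /\ s 2%nat = x ^ 3 / 3 - x ^ 2 / 2 + x / 6 /\
  s 3%nat = x ^ 4 / 4 - x ^ 3 / 2 + x ^ 2 / 4 /\ s 4%nat = x ^ 5 / 5 - x ^ 4 / 2 + x ^ 3 / 3 - x / 30 /\
  s 5%nat = x ^ 6 / 6 - x ^ 5 / 2 + 5 * x ^ 4 / 12 - x ^ 2 / 12 /\
  s 6%nat = x ^ 7 / 7 - x ^ 6 / 2 + x ^ 5 / 2 - x ^ 3 / 6 + x / 42.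
Proof.
  intros He. destruct e as [|e]; [lia|]. clear He. replace (S e - 1)%nat with e by lia.
  induction e as [|e IH].
  - cbv zeta. unfold lsum. simpl seq. cbn [map fold_right INR]. repeat split; field.
  - cbv zeta in *. rewrite seq_S, !lsum_app.
    destruct IH as (H0 & H1 & H2 & H3 & H4 & H5 & H6).
    rewrite H0, H1, H2, H3, H4, H5, H6. unfold lsum. cbn [map fold_right].
    replace (1 + e)%nat with (S e) by lia. rewrite (S_INR (S e)). set (x := INR (S e)).
    repeat split; field.
Qed.

Lemma poly6_sum e c0 c1 c2 c3 c4 c5 c6 (f : R -> R) : (1 <= e)%nat ->
  (forall a, f a = c0 * a ^ 0 + c1 * a ^ 1 + c2 * a ^ 2 + c3 * a ^ 3 + c4 * a ^ 4 + c5 * a ^ 5 + c6 * a ^ 6) ->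
  lsum (fun a => f (INR a)) (seq 1 (e - 1)) =
  let x := INR e in
  c0 * (x - 1) + c1 * (x ^ 2 / 2 - x / 2) + c2 * (x ^ 3 / 3 - x ^ 2 / 2 + x / 6) +
  c3 * (x ^ 4 / 4 - x ^ 3 / 2 + x ^ 2 / 4) + c4 * (x ^ 5 / 5 - x ^ 4 / 2 + x ^ 3 / 3 - x / 30) +
  c5 * (x ^ 6 / 6 - x ^ 5 / 2 + 5 * x ^ 4 / 12 - x ^ 2 / 12) +
  c6 * (x ^ 7 / 7 - x ^ 6 / 2 + x ^ 5 / 2 - x ^ 3 / 6 + x / 42).
Proof.
  intros He H. destruct (power_sums e He) as (H0 & H1 & H2 & H3 & H4 & H5 & H6).
  cbv zeta. rewrite <- H0, <- H1, <- H2, <- H3, <- H4, <- H5, <- H6.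
  rewrite <- !lsum_scale, <- !lsum_plus. apply lsum_ext. intros a _. apply H.
Qed.

Lemma dsum_ext f g n : (forall d, (1 <= d)%nat -> f d = g d) -> dsum f n = dsum g n.
Proof.
  intros H. apply lsum_ext. intros d Hd. apply in_seq in Hd. rewrite H by lia. reflexivity.
Qed.

Lemma dsum_plus f g n : dsum (fun d => f d + g d) n = dsum f n + dsum g n.
Proof.
  unfold dsum. rewrite <- lsum_plus. apply lsum_ext. intros d _. destruct (n mod d =? 0)%nat; ring.
Qed.

Lemma dsum_scale c f n : dsum (fun d => c * f d) n = c * dsum f n.
Proof.
  unfold dsum. rewrite <- lsum_scale. apply lsum_ext. intros d _. destruct (n mod d =? 0)%nat; ring.
Qed.

Lemma psum_plus p F G n : psum p (fun a b => F a b + G a b) n = psum p F n + psum p G n.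
Proof.
  unfold psum. rewrite <- lsum_plus. apply lsum_ext. intros [[a b] [x y]] _. destruct (p a b x y); ring.
Qed.

Lemma psum_scale p c F n : psum p (fun a b => c * F a b) n = c * psum p F n.
Proof.
  unfold psum. rewrite <- lsum_scale. apply lsum_ext. intros [[a b] [x y]] _. destruct (p a b x y); ring.
Qed.

Lemma psum_ext p F G n : (forall a b, F a b = G a b) -> psum p F n = psum p G n.
Proof.
  intros H. unfold psum. apply lsum_ext. intros [[a b] [x y]] _. now rewrite H.
Qed.

(** * Closed forms of three convolution sums *)

Notation csig i j n := (total (fun a b => a ^ i * b ^ j) n).

Lemma csig_sym i j n : csig i j n = csig j i n.
Proof.
  apply psum_bij with (f := swapq) (g := swapq); intros a b x y H _; simpl; repeat split; try lia; ring.
Qed.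

(** For this invariant F the difference F(a,b) - F(a,-b) is -4(a^3 b + a b^3), which isolates the
    wanted sum by symmetry. *)
Lemma convolution_1_3 n : (1 <= n)%nat ->
  csig 1 3 n = (21 * Defs.sigma 5 n + (10 - 30 * INR n) * Defs.sigma 3 n - Defs.sigma 1 n) / 240.
Proof.
  intros Hn. set (F := fun u v : R => (u ^ 2 - u * v + v ^ 2) ^ 2).
  pose proof (quadratic_symmetric_sum F n ltac:(intros; unfold F; ring) ltac:(intros; unfold F; ring)) as Q.
  rewrite diag_ab, diag_xy in Q.
  assert (L : total F n - total (fun a b => F a (- b)) n = -8 * csig 1 3 n).
  { transitivity (total F n + -1 * total (fun a b => F a (- b)) n); [ring|].
    rewrite <- psum_scale, <- psum_plus.
    replace (-8 * csig 1 3 n) with (-4 * csig 1 3 n + -4 * csig 3 1 n) by (rewrite (csig_sym 3 1); ring).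
    rewrite <- !psum_scale, <- psum_plus. apply psum_ext. intros; unfold F; ring. }
  rewrite L in Q.
  rewrite (dsum_ext _ (fun d => INR n * INR d ^ 3 + -1 * INR d ^ 4)) in Q.
  2: { intros d Hd. unfold F. field. apply not_0_INR. lia. }
  (* By invariance F(a, a - x) = F(a, x), which gives the coefficients passed to [poly6_sum]. The
     term in e^4 cancels against the one from the diagonal a = b. *)
  rewrite (dsum_ext (fun e => lsum _ _) (fun e => 7 / 10 * INR e ^ 5 + (-1) * INR e ^ 4 + 1 / 3 * INR e ^ 3 + (-1 / 30) * INR e ^ 1)) in Q.
  2: { intros e He. set (x := INR e).
       rewrite (poly6_sum e (x ^ 4) (-2 * x ^ 3) (3 * x ^ 2) (-2 * x) 1 0 0 (fun a => F a (- (x - a)))); auto.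
       cbv zeta. fold x. field. intros a. unfold F. ring. }
  rewrite !dsum_plus, !dsum_scale, <- !sigma_dsum in Q by auto. lra.
Qed.

(** The part of F odd in v is the single monomial -2 u^3 v^3, and F(u,u) = 0 removes the diagonal a
    = b. *)
Lemma convolution_3_3 n : (1 <= n)%nat -> csig 3 3 n = (Defs.sigma 7 n - Defs.sigma 3 n) / 120.
Proof.
  intros Hn. set (F := fun u v : R => (u * v * (u - v)) ^ 2).
  pose proof (quadratic_symmetric_sum F n ltac:(intros; unfold F; ring) ltac:(intros; unfold F; ring)) as Q.
  rewrite diag_ab, diag_xy in Q.
  assert (L : total F n - total (fun a b => F a (- b)) n = -4 * csig 3 3 n).
  { transitivity (total F n + -1 * total (fun a b => F a (- b)) n); [ring|].
    rewrite <- !psum_scale, <- psum_plus. apply psum_ext. intros; unfold F; ring. }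
  rewrite L in Q.
  rewrite (dsum_ext (fun d => (INR n / INR d - 1) * _) (fun d => 0 * 0)) in Q.
  2: { intros d Hd. unfold F. ring. }
  rewrite (dsum_ext (fun e => lsum _ _) (fun e => 1 / 30 * INR e ^ 7 + (-1 / 30) * INR e ^ 3)) in Q.
  2: { intros e He. set (x := INR e).
       rewrite (poly6_sum e 0 0 (x ^ 4) (-2 * x ^ 3) (x ^ 2) 0 0 (fun a => F a (- (x - a)))); auto.
       cbv zeta. fold x. field. intros a. unfold F. ring. }
  rewrite dsum_plus, !dsum_scale, <- !sigma_dsum in Q by auto. lra.
Qed.

(** Here F(a,b) - F(a,-b) = -6(a^5 b + a b^5) - 14 a^3 b^3, so the previous convolution has to be
    known first. *)
Lemma convolution_1_5 n : (1 <= n)%nat ->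
  csig 1 5 n = (20 * Defs.sigma 7 n + (21 - 42 * INR n) * Defs.sigma 5 n + Defs.sigma 1 n) / 504.
Proof.
  intros Hn. set (F := fun u v : R => (u ^ 2 - u * v + v ^ 2) ^ 3).
  pose proof (quadratic_symmetric_sum F n ltac:(intros; unfold F; ring) ltac:(intros; unfold F; ring)) as Q.
  rewrite diag_ab, diag_xy in Q.
  assert (L : total F n - total (fun a b => F a (- b)) n
     = -12 * csig 1 5 n + -14 * csig 3 3 n).
  { transitivity (total F n + -1 * total (fun a b => F a (- b)) n); [ring|].
    replace (-12 * csig 1 5 n) with (-6 * csig 1 5 n + -6 * csig 5 1 n) by (rewrite (csig_sym 5 1); ring).
    rewrite <- !psum_scale, <- !psum_plus. apply psum_ext. intros; unfold F; ring. }
  rewrite L, convolution_3_3 in Q by auto.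
  rewrite (dsum_ext _ (fun d => INR n * INR d ^ 5 + -1 * INR d ^ 6)) in Q.
  2: { intros d Hd. unfold F. field. apply not_0_INR. lia. }
  rewrite (dsum_ext (fun e => lsum _ _) (fun e =>
     (1 - 3 / 2 + 2 - 7 / 4 + 6 / 5 - 1 / 2 + 1 / 7) * INR e ^ 7 + (-1) * INR e ^ 6 + 1 / 2 * INR e ^ 5 + (-7 / 60) * INR e ^ 3 + 1 / 42 * INR e ^ 1)) in Q.
  2: { intros e He. set (x := INR e).
       rewrite (poly6_sum e (x ^ 6) (-3 * x ^ 5) (6 * x ^ 4) (-7 * x ^ 3) (6 * x ^ 2) (-3 * x) 1 (fun a => F a (- (x - a)))); auto.
       cbv zeta. fold x. field. intros a. unfold F. ring. }
  rewrite !dsum_plus, !dsum_scale, <- !sigma_dsum in Q by auto. lra.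
Qed.

Definition eis (c : R) (k n : nat) : R := match n with O => 1 | S _ => c * Defs.sigma k n end.

Lemma sum_f_R0_lsum f n : sum_f_R0 f n = lsum f (seq 0 (S n)).
Proof.
  induction n as [|n IH]. { unfold lsum. simpl. ring. }
  rewrite seq_S, lsum_app, <- IH. unfold lsum. simpl. ring.
Qed.

(** The indices 0 and n of the convolution meet the constant terms 1 and give the two single divisor
    sums; the indices between them give the convolution sum. *)
Lemma conv_eis c k c' k' n : (1 <= n)%nat ->
  conv (eis c k) (eis c' k') n = c' * Defs.sigma k' n + c * Defs.sigma k n + c * c' * csig k k' n.
Proof.
  intros Hn. unfold conv. rewrite sum_f_R0_lsum, sigma_convolution.
  replace (S n) with (1 + ((n - 1) + 1))%nat by lia. rewrite !seq_app, !lsum_app, <- lsum_scale.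
  replace (lsum (fun i => eis c k i * eis c' k' (n - i)) (seq (0 + 1) (n - 1)))
    with (lsum (fun m => c * c' * (Defs.sigma k m * Defs.sigma k' (n - m))) (seq 1 (n - 1))).
  - unfold lsum at 1 3. cbn [seq map fold_right]. replace (0 + 1 + (n - 1))%nat with n by lia.
    rewrite Nat.sub_diag, Nat.sub_0_r. destruct n as [|n]; [lia|]. simpl eis. ring.
  - apply lsum_ext. intros m Hm. apply in_seq in Hm.
    assert (H : forall c k j, (1 <= j)%nat -> eis c k j = c * Defs.sigma k j) by (intros ? ? [|j] ?; [lia|reflexivity]).
    rewrite !H by lia. ring.
Qed.

Lemma ramanujan_coeff_E4 n :
  INR n * eis 240 3 n = 1 / 3 * (conv (eis (-24) 1) (eis 240 3) n + -1 * eis (-504) 5 n).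
Proof.
  destruct (Nat.eq_dec n 0) as [->|N].
  - unfold conv. simpl. field.
  - rewrite conv_eis, convolution_1_3 by lia. destruct n as [|n]; [lia|]. unfold eis. set (x := INR (S n)). field.
Qed.

Lemma ramanujan_coeff_E6 n :
  INR n * eis (-504) 5 n = 1 / 2 * (conv (eis (-24) 1) (eis (-504) 5) n + -1 * conv (eis 240 3) (eis 240 3) n).
Proof.
  destruct (Nat.eq_dec n 0) as [->|N].
  - unfold conv. simpl. field.
  - rewrite !conv_eis, convolution_1_5, convolution_3_3 by lia.
    destruct n as [|n]; [lia|]. unfold eis. set (x := INR (S n)). field.
Qed.

Open Scope C_scope.

(** * Ramanujan's identities *)

Lemma sigma_bound k n : (0 <= Defs.sigma k n <= INR (S n) ^ S k)%R.
Proof.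
  unfold Defs.sigma.
  assert (T : forall d, (d <= n)%nat -> (0 <= (if (n mod S d =? 0)%nat then INR (S d) ^ k else 0) <= INR (S n) ^ k)%R).
  { intros d Hd. assert (0 <= INR (S d) <= INR (S n))%R by (split; [apply pos_INR|apply le_INR; lia]).
    destruct (n mod S d =? 0)%nat.
    - split. apply pow_le; lra. apply pow_incr; lra.
    - split; [lra|]. apply pow_le; lra. }
  assert (X : forall m, (m <= n)%nat ->
     (0 <= sum_f_R0 (fun d => if (n mod S d =? 0)%nat then INR (S d) ^ k else 0) m <= INR (S m) * INR (S n) ^ k)%R).
  { induction m as [|m IH]; intros Hm.
    - change (INR 1) with 1%R. rewrite Rmult_1_l. exact (T 0%nat Hm).
    - rewrite tech5. cbv beta. specialize (T (S m) Hm). specialize (IH ltac:(lia)).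
      replace (INR (S (S m)) * INR (S n) ^ k)%R with (INR (S m) * INR (S n) ^ k + INR (S n) ^ k)%R
        by (rewrite (S_INR (S m)); ring). lra. }
  specialize (X (n - 1)%nat ltac:(lia)). rewrite <- tech_pow_Rmult. split; [apply X|].
  eapply Rle_trans; [apply X|]. apply Rmult_le_compat_r. apply pow_le, pos_INR. apply le_INR. lia.
Qed.

Lemma pbound_eis c k : pbound (eis c k).
Proof.
  exists (1 + Rabs c)%R, (S k). pose proof (Rabs_pos c). split; [lra|]. intros [|n].
  - unfold eis. rewrite Rabs_R1. simpl (INR 1). rewrite pow1. lra.
  - unfold eis. rewrite Rabs_mult. pose proof (sigma_bound k (S n)).
    rewrite (Rabs_right (Defs.sigma _ _)) by lra.
    assert (0 <= INR (S (S n)) ^ S k)%R by (apply pow_le, pos_INR).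
    assert (Rabs c * Defs.sigma k (S n) <= Rabs c * INR (S (S n)) ^ S k)%R by (apply Rmult_le_compat_l; lra). lra.
Qed.

Lemma eisenstein_QS c k z : UHP z ->
  RtoC 1 + RtoC c * csum (fun n => RtoC (Defs.sigma k (S n)) * qpow (S n) z) = QS (eis c k) z.
Proof.
  intros Hz. destruct (pbound_abs _ z (pbound_eis c k) Hz) as [A B].
  apply ex_series_Rabs in A, B. rewrite QS_comp, (Series_incr_1 _ A), (Series_incr_1 _ B).
  rewrite qpow_0. unfold csum.
  rewrite (Series_ext (fun n => eis c k (S n) * Re (qpow (S n) z))%R (fun n => c * Re (RtoC (Defs.sigma k (S n)) * qpow (S n) z))%R).
  rewrite (Series_ext (fun n => eis c k (S n) * Im (qpow (S n) z))%R (fun n => c * Im (RtoC (Defs.sigma k (S n)) * qpow (S n) z))%R).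
  rewrite !Series_scal_l. apply injective_projections; unfold eis, Cplus, Cmult, Re, Im, RtoC; cbn [fst snd]; ring.
  - intros n. unfold eis, Cplus, Cmult, Re, Im, RtoC; cbn [fst snd]; ring.
  - intros n. unfold eis, Cplus, Cmult, Re, Im, RtoC; cbn [fst snd]; ring.
Qed.

(** The half plane is open: the disc of radius Im z around z stays inside. *)
Lemma cder_UHP_ext f g z l : UHP z -> (forall w, UHP w -> f w = g w) -> cder f z l -> cder g z l.
Proof.
  intros Hz E. apply cder_near with (d := Im z); auto. intros h Hh. apply E.
  unfold UHP in *. pose proof (im_le_Cmod h). destruct z, h. simpl in *. unfold Rabs in H. destruct (Rcase_abs r2); lra.
Qed.

Lemma E2_QS z : UHP z -> E2 z = QS (eis (-24) 1) z.
Proof. apply eisenstein_QS. Qed.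
Lemma E4_QS z : UHP z -> E4 z = QS (eis 240 3) z.
Proof. apply eisenstein_QS. Qed.
Lemma E6_QS z : UHP z -> E6 z = QS (eis (-504) 5) z.
Proof. apply eisenstein_QS. Qed.

Lemma isHol_QS a f : pbound a -> (forall z, UHP z -> f z = QS a z) -> isHol f.
Proof.
  intros Pa E z Hz. apply cdiff_cder. eexists. apply (cder_UHP_ext (QS a)); auto.
  - intros; symmetry; auto.
  - now apply QS_cder.
Qed.

Lemma isHol_E2 : isHol E2.
Proof. exact (isHol_QS _ _ (pbound_eis _ _) E2_QS). Qed.
Lemma isHol_E4 : isHol E4.
Proof. exact (isHol_QS _ _ (pbound_eis _ _) E4_QS). Qed.
Lemma isHol_E6 : isHol E6.
Proof. exact (isHol_QS _ _ (pbound_eis _ _) E6_QS). Qed.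

Lemma cderiv_UHP_ext f g z : UHP z -> isHol f -> (forall w, UHP w -> f w = g w) -> cderiv f z = cderiv g z.
Proof.
  intros Hz Hf E. destruct (proj1 (cdiff_cder f z) (Hf z Hz)) as [l L].
  rewrite (cder_cderiv _ _ _ L). symmetry. apply cder_cderiv. now apply (cder_UHP_ext f).
Qed.

Lemma dq_QS f a z : pbound a -> (forall w, UHP w -> f w = QS a w) -> UHP z -> dq f z = QS (fun n => INR n * a n)%R z.
Proof.
  intros Pa E Hz. rewrite <- (QS_dq a z Pa Hz). unfold dq. f_equal.
  apply cderiv_UHP_ext; auto. now apply (isHol_QS a).
Qed.

Theorem ramanujan_E4 z : UHP z -> dq E4 z = RtoC (1 / 3) * (E2 z * E4 z - E6 z).
Proof.
  intros Hz. rewrite (dq_QS E4 _ z (pbound_eis 240 3) E4_QS Hz).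
  apply (isQS_unique (fun n => INR n * eis 240 3 n)%R z). { apply QS_correct; auto. apply pbound_n, pbound_eis. }
  eapply isQS_ext. { intros n. symmetry. apply ramanujan_coeff_E4. }
  apply isQS_scale. replace (E2 z * E4 z - E6 z) with (E2 z * E4 z + RtoC (-1) * E6 z) by ring.
  rewrite E2_QS, E4_QS, E6_QS by auto.
  apply isQS_plus. { apply QS_mult; auto; apply pbound_eis. }
  apply isQS_scale. apply QS_correct; auto. apply pbound_eis.
Qed.

Theorem ramanujan_E6 z : UHP z -> dq E6 z = RtoC (1 / 2) * (E2 z * E6 z - E4 z * E4 z).
Proof.
  intros Hz. rewrite (dq_QS E6 _ z (pbound_eis (-504) 5) E6_QS Hz).
  apply (isQS_unique (fun n => INR n * eis (-504) 5 n)%R z). { apply QS_correct; auto. apply pbound_n, pbound_eis. }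
  eapply isQS_ext. { intros n. symmetry. apply ramanujan_coeff_E6. }
  apply isQS_scale. replace (E2 z * E6 z - E4 z * E4 z) with (E2 z * E6 z + RtoC (-1) * (E4 z * E4 z)) by ring.
  rewrite E2_QS, E4_QS, E6_QS by auto.
  apply isQS_plus. { apply QS_mult; auto; apply pbound_eis. }
  apply isQS_scale. apply QS_mult; auto; apply pbound_eis.
Qed.

(** * E4 and E6 high up on the imaginary axis *)

Definition tail_sum (k : nat) (y : R) : R :=
  Series (fun n => Defs.sigma k (S n) * exp (- 2 * PI * y) ^ S n)%R.

Lemma qpow_imag n y : qpow n (0%R, y) = RtoC (exp (- 2 * PI * y) ^ n)%R.
Proof.
  unfold qpow, Re, Im. cbn [fst snd]. rewrite Rmult_0_r, cos_0, sin_0, Rmult_1_r, Rmult_0_r, exp_pow_INR.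
  unfold RtoC. f_equal. f_equal. ring.
Qed.

Lemma eisenstein_imag c k y :
  RtoC 1 + RtoC c * csum (fun n => RtoC (Defs.sigma k (S n)) * qpow (S n) (0%R, y)) = RtoC (1 + c * tail_sum k y)%R.
Proof.
  unfold csum.
  rewrite (Series_ext (fun n => Re (RtoC (Defs.sigma k (S n)) * qpow (S n) (0%R, y))) (fun n => Defs.sigma k (S n) * exp (- 2 * PI * y) ^ S n)%R).
  rewrite (Series_ext (fun n => Im (RtoC (Defs.sigma k (S n)) * qpow (S n) (0%R, y))) (fun n => 0 * 0)%R).
  rewrite Series_scal_l. fold (tail_sum k y). apply injective_projections; unfold Cplus, Cmult, Re, Im, RtoC; cbn [fst snd]; ring.
  - intros n. rewrite qpow_imag. unfold Cmult, Im, RtoC; cbn [fst snd]; ring.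
  - intros n. rewrite qpow_imag. unfold Cmult, Re, RtoC; cbn [fst snd]; ring.
Qed.

(** One factor q is pulled out, and the remaining series is compared with its value at y = 1. Strict
    positivity comes from the first term sigma_k(1) q = q; it later yields E4 > 1 > E6. *)
Lemma tail_sum_small k : exists K, (0 < K)%R /\ forall y, (1 <= y)%R -> (0 < tail_sum k y <= K * exp (- 2 * PI * y))%R.
Proof.
  pose proof PI_RGT_0 as Pp.
  set (q1 := exp (- 2 * PI)).
  assert (Hq1 : (0 < q1 < 1)%R). { split. apply exp_pos. unfold q1. rewrite <- exp_0. apply exp_increasing. lra. }
  assert (PB : pbound (fun n => Defs.sigma k (S n))).
  { exists (2 ^ S k)%R, (S k). split. apply pow_le; lra. intros n. pose proof (sigma_bound k (S n)).
    rewrite Rabs_right by lra. eapply Rle_trans; [apply H|]. rewrite <- Rpow_mult_distr. apply pow_incr.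
    rewrite !S_INR. pose proof (pos_INR n). lra. }
  pose proof (pbound_series _ q1 PB Hq1) as Ex.
  set (B := (fun n => Rabs (Defs.sigma k (S n)) * q1 ^ n)%R) in *.
  assert (B0 : forall n, (0 <= B n)%R) by (intros n; apply Rmult_le_pos; [apply Rabs_pos|apply pow_le; lra]).
  exists (Series B + 1)%R.
  assert (SB : (0 <= Series B)%R).
  { replace 0%R with (Series (fun n => 0 * B n)%R) by (rewrite Series_scal_l; ring). apply Series_le; auto.
    intros n. specialize (B0 n). lra. }
  split; [lra|].
  intros y Hy. set (q := exp (- 2 * PI * y)).
  assert (Hq : (0 < q <= q1)%R).
  { split. apply exp_pos. unfold q, q1. assert (H : (- 2 * PI * y <= - 2 * PI)%R) by nra.
    destruct H as [H|H]; [left; now apply exp_increasing|rewrite H; lra]. }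
  assert (Bd : forall n, (0 <= Defs.sigma k (S n) * q ^ S n <= q * B n)%R).
  { intros n. pose proof (sigma_bound k (S n)). unfold B. rewrite Rabs_right by lra.
    assert (0 <= q ^ n <= q1 ^ n)%R by (split; [apply pow_le|apply pow_incr]; lra).
    rewrite <- tech_pow_Rmult. split. repeat apply Rmult_le_pos; lra.
    replace (Defs.sigma k (S n) * (q * q ^ n))%R with (q * (Defs.sigma k (S n) * q ^ n))%R by ring.
    apply Rmult_le_compat_l; [lra|]. apply Rmult_le_compat_l; lra. }
  assert (Exq : ex_series (fun n => q * B n)%R) by (apply (ex_series_scal_l (K := R_AbsRing) (V := R_NormedModule)); auto).
  assert (Exs : ex_series (fun n => Defs.sigma k (S n) * q ^ S n)%R).
  { apply (ex_series_le (V := R_CompleteNormedModule) _ (fun n => q * B n)%R); auto.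
    intros n. change (Rabs (Defs.sigma k (S n) * q ^ S n) <= q * B n)%R. rewrite Rabs_right. apply Bd. apply Rle_ge, Bd. }
  unfold tail_sum. fold q. split.
  - rewrite Series_incr_1 by auto.
    assert (0 <= Series (fun n => Defs.sigma k (S (S n)) * q ^ S (S n)))%R.
    { replace 0%R with (Series (fun n => 0 * (Defs.sigma k (S (S n)) * q ^ S (S n)))%R) by (rewrite Series_scal_l; ring).
      apply Series_le; [|now apply ex_series_incr_1 in Exs]. intros n. specialize (Bd (S n)). lra. }
    assert (Defs.sigma k 1 = 1)%R by (unfold Defs.sigma; simpl; apply pow1).
    rewrite H0, pow_1. lra.
  - eapply Rle_trans; [apply (Series_le _ (fun n => q * B n)%R); auto|]. rewrite Series_scal_l. nra.
Qed.

Lemma tail_sum_lim k eps : (0 < eps)%R -> exists Y, (1 <= Y)%R /\ forall y, (Y <= y)%R -> (0 < tail_sum k y < eps)%R.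
Proof.
  intros He. destruct (tail_sum_small k) as (K & HK & B). pose proof PI_RGT_0 as Pp. pose proof PI2_1 as P1.
  exists (Rmax 1 (K / eps)). split. apply Rmax_l. intros y Hy.
  assert (1 <= y)%R by (eapply Rle_trans; [apply Rmax_l|exact Hy]).
  assert (H2 : (K / eps <= y)%R) by (eapply Rle_trans; [apply Rmax_r|exact Hy]).
  specialize (B y H). split; [apply B|]. eapply Rle_lt_trans; [apply B|].
  replace (- 2 * PI * y)%R with (- (2 * PI * y))%R by ring. rewrite exp_Ropp.
  assert (E : (y < exp (2 * PI * y))%R).
  { assert (1 + 2 * PI * y < exp (2 * PI * y))%R by (apply exp_ineq1; nra). nra. }
  apply Rmult_lt_reg_r with (exp (2 * PI * y)); [apply exp_pos|].
  rewrite Rmult_assoc, Rinv_l by (apply Rgt_not_eq, exp_pos).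
  assert (K / eps * eps = K)%R by (field; lra). nra.
Qed.

Definition A4 (y : R) : R := (1 + 240 * tail_sum 3 y)%R.
Definition B6 (y : R) : R := (1 + -504 * tail_sum 5 y)%R.

Lemma E4_imag y : E4 (0%R, y) = RtoC (A4 y).
Proof. apply eisenstein_imag. Qed.
Lemma E6_imag y : E6 (0%R, y) = RtoC (B6 y).
Proof. apply eisenstein_imag. Qed.

Lemma A4_B6_lim eps : (0 < eps)%R -> exists Y, (1 <= Y)%R /\ forall y, (Y <= y)%R ->
  (1 < A4 y < 1 + eps /\ 1 - eps < B6 y < 1)%R.
Proof.
  intros He. destruct (tail_sum_lim 3 (eps / 240)) as (Y1 & H1 & K1); [lra|].
  destruct (tail_sum_lim 5 (eps / 504)) as (Y2 & H2 & K2); [lra|].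
  exists (Rmax Y1 Y2). split. { eapply Rle_trans; [exact H1|apply Rmax_l]. }
  intros y Hy. specialize (K1 y (Rle_trans _ _ _ (Rmax_l _ _) Hy)). specialize (K2 y (Rle_trans _ _ _ (Rmax_r _ _) Hy)).
  unfold A4, B6. lra.
Qed.

(** * The free algebra and its ideal I *)

Definition clsum {A} (f : A -> C) (l : list A) : C := fold_right Cplus 0 (map f l).

Lemma clsum_ext {A} (f g : A -> C) l : (forall x, In x l -> f x = g x) -> clsum f l = clsum g l.
Proof. intros H. unfold clsum. f_equal. now apply map_ext_in. Qed.

Lemma clsum_plus {A} (f g : A -> C) l : clsum (fun x => f x + g x) l = clsum f l + clsum g l.
Proof. unfold clsum. induction l as [|x l IH]; simpl; [ring|rewrite IH; ring]. Qed.

Lemma clsum_scale {A} c (f : A -> C) l : clsum (fun x => c * f x) l = c * clsum f l.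
Proof. unfold clsum. induction l as [|x l IH]; simpl; [ring|rewrite IH; ring]. Qed.

Lemma clsum_perm {A} (f : A -> C) l l' : Permutation l l' -> clsum f l = clsum f l'.
Proof.
  unfold clsum. induction 1; simpl; auto; try congruence. ring.
Qed.

Lemma clsum_zero {A} (f : A -> C) l : (forall x, In x l -> f x = 0) -> clsum f l = 0.
Proof.
  intros H. rewrite (clsum_ext f (fun x => 0 * 0)), clsum_scale; [ring|]. intros x Hx. rewrite H; auto; ring.
Qed.

Lemma clsum_filter {A} (f : A -> C) p l : (forall x, In x l -> p x = false -> f x = 0) ->
  clsum f (filter p l) = clsum f l.
Proof.
  unfold clsum. induction l as [|x l IH]; intros H; [reflexivity|]. simpl.
  assert (IH' := IH (fun y Hy => H y (or_intror Hy))).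
  destruct (p x) eqn:E; simpl; rewrite IH'; auto. rewrite (H x (or_introl eq_refl) E). ring.
Qed.

(** * Linear extension of functions on words *)

Definition supports (s : list (list nat)) (p : NCP) : Prop := NoDup s /\ forall w, ~ In w s -> p w = 0.

Definition supp (p : NCP) : list (list nat) := epsilon (inhabits nil) (fun s => supports s p).

(** The linear extension of g from words to polynomials. Both the map to R and the map to the Weyl
    algebra are obtained from it. *)
Definition ev (p : NCP) (g : list nat -> C) : C := clsum (fun w => p w * g w) (supp p).

Lemma word_dec (u v : list nat) : {u = v} + {u <> v}.
Proof. apply list_eq_dec, Nat.eq_dec. Defined.

Lemma isNCP_supports p : isNCP p -> exists s, supports s p.
Proof.
  intros [[s H] _]. exists (nodup word_dec s). split; [apply NoDup_nodup|].
  intros w Hw. apply H. now rewrite <- (nodup_In word_dec).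
Qed.

Definition nonzerob (c : C) : bool := if prop_dec (c = 0) then false else true.

(** After discarding the words with coefficient 0, any two duplicate free supports are permutations
    of each other. *)
Lemma ev_any p g s : supports s p -> ev p g = clsum (fun w => p w * g w) s.
Proof.
  intros H. assert (K : supports (supp p) p) by (unfold supp; apply epsilon_spec; eauto). unfold ev.
  rewrite <- (clsum_filter _ (fun w => nonzerob (p w)) (supp p)), <- (clsum_filter _ (fun w => nonzerob (p w)) s).
  - apply clsum_perm. apply NoDup_Permutation.
    + apply NoDup_filter. exact (proj1 K).
    + apply NoDup_filter. exact (proj1 H).
    + intros w. rewrite !filter_In. unfold nonzerob.
      destruct (prop_dec (p w = 0)) as [E|E]; [intuition congruence|].
      split; intros [_ _]; split; auto.
      * apply NNPP. intros F. apply E. now apply H.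
      * apply NNPP. intros F. apply E. now apply K.
  - intros w _. unfold nonzerob. destruct (prop_dec (p w = 0)) as [E|E]; [|discriminate].
    intros _. rewrite E. ring.
  - intros w _. unfold nonzerob. destruct (prop_dec (p w = 0)) as [E|E]; [|discriminate].
    intros _. rewrite E. ring.
Qed.

Lemma common_support p q : isNCP p -> isNCP q -> exists s, supports s p /\ supports s q.
Proof.
  intros [[s H] _] [[t K] _]. exists (nodup word_dec (s ++ t)).
  split; (split; [apply NoDup_nodup|]); intros w Hw; [apply H|apply K]; intros L; apply Hw, nodup_In, in_or_app; auto.
Qed.

Lemma supports_add s p q : supports s p -> supports s q -> supports s (ncadd p q).
Proof.
  intros [N H] [_ K]. split; auto. intros w Hw. unfold ncadd. rewrite H, K; auto. ring.
Qed.

Lemma supports_scale s c p : supports s p -> supports s (ncscale c p).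
Proof. intros [N H]. split; auto. intros w Hw. unfold ncscale. rewrite H; auto. ring. Qed.

Lemma ncword_eq u w : ncword u w = if word_dec w u then 1 else 0.
Proof. unfold ncword. destruct (list_eq_dec Nat.eq_dec w u), (word_dec w u); congruence. Qed.

Lemma supports_word u : supports [u] (ncword u).
Proof.
  split. repeat constructor; auto. intros w Hw. rewrite ncword_eq. destruct (word_dec w u); auto.
  subst. exfalso. apply Hw. now left.
Qed.

Lemma ev_zero g : ev (fun _ => 0) g = 0.
Proof. apply clsum_zero. intros. ring. Qed.

Lemma ev_add p q g : isNCP p -> isNCP q -> ev (ncadd p q) g = ev p g + ev q g.
Proof.
  intros P Q. destruct (common_support p q P Q) as (s & H & K).
  rewrite (ev_any _ g s H), (ev_any _ g s K), (ev_any _ g s (supports_add _ _ _ H K)), <- clsum_plus.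
  apply clsum_ext. intros w _. unfold ncadd. ring.
Qed.

Lemma ev_scale c p g : isNCP p -> ev (ncscale c p) g = c * ev p g.
Proof.
  intros P. destruct (isNCP_supports p P) as [s H].
  rewrite (ev_any _ g s H), (ev_any _ g s (supports_scale _ _ _ H)), <- clsum_scale.
  apply clsum_ext. intros w _. unfold ncscale. ring.
Qed.

Lemma ev_word u g : ev (ncword u) g = g u.
Proof.
  rewrite (ev_any _ g _ (supports_word u)). unfold clsum. simpl. rewrite ncword_eq.
  destruct (word_dec u u); [cbv beta; ring|congruence].
Qed.

Lemma ev_ext (p : NCP) g g' : (forall w, p w <> 0 -> g w = g' w) -> ev p g = ev p g'.
Proof.
  intros H. apply clsum_ext. intros w _.
  destruct (prop_dec (p w = 0)) as [E|E]; [rewrite E; ring|now rewrite H].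
Qed.

Lemma ev_plus p g g' : ev p (fun w => g w + g' w) = ev p g + ev p g'.
Proof. unfold ev. rewrite <- clsum_plus. apply clsum_ext. intros. ring. Qed.

Lemma ev_cmul p c g : ev p (fun w => c * g w) = c * ev p g.
Proof. unfold ev. rewrite <- clsum_scale. apply clsum_ext. intros. ring. Qed.

Lemma ev_indicator p u : isNCP p -> ev p (fun w => if word_dec w u then 1 else 0) = p u.
Proof.
  intros P. destruct (isNCP_supports p P) as [s [N H]]. rewrite (ev_any _ _ s (conj N H)).
  destruct (in_dec word_dec u s) as [I|I].
  - clear H. unfold clsum. induction N as [|x l Hx N IH]; [easy|]. simpl. destruct (word_dec x u) as [->|E].
    + fold (clsum (fun w => p w * (if word_dec w u then 1 else 0)) l). rewrite clsum_zero; [ring|].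
      intros w Hw. destruct (word_dec w u); [congruence|cbv beta; ring].
    + destruct I as [I|I]; [congruence|]. rewrite IH by auto. ring.
  - rewrite H by auto. apply clsum_zero. intros w Hw. destruct (word_dec w u); [congruence|cbv beta; ring].
Qed.

Definition wf (w : list nat) : Prop := List.Forall (fun i : nat => (i < 3)%nat) w.

Lemma isNCP_zero : isNCP (fun _ => 0).
Proof. split; [now exists nil|congruence]. Qed.

Lemma isNCP_add p q : isNCP p -> isNCP q -> isNCP (ncadd p q).
Proof.
  intros P Q. destruct (common_support p q P Q) as (s & H & K). split.
  - exists s. now apply supports_add.
  - intros w Hw. destruct (prop_dec (p w = 0)) as [E|E]; [|now apply P].
    apply Q. intros F. apply Hw. unfold ncadd. rewrite E, F. ring.
Qed.

Lemma isNCP_scale c p : isNCP p -> isNCP (ncscale c p).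
Proof.
  intros [[s H] K]. unfold ncscale. split.
  - exists s. intros w Hw. rewrite H by auto. ring.
  - intros w Hw. apply K. intros F. apply Hw. rewrite F. ring.
Qed.

Lemma isNCP_word u : wf u -> isNCP (ncword u).
Proof.
  intros H. split; [exists [u]; apply supports_word|]. intros w. rewrite ncword_eq.
  destruct (word_dec w u); [now subst|congruence].
Qed.

(** Induction on a duplicate free support, one word at a time. [W] records a property of the words
    that occur, so that the same principle serves all polynomials and the normal ones. *)
Lemma span_ind (W : list nat -> Prop) (P : NCP -> Prop) : P (fun _ => 0) ->
  (forall c w p, W w -> wf w -> isNCP p -> (forall v, p v <> 0 -> W v) -> P p -> P (ncadd (ncscale c (ncword w)) p)) ->
  forall p, isNCP p -> (forall v, p v <> 0 -> W v) -> P p.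
Proof.
  intros P0 PS p Hp. destruct (isNCP_supports p Hp) as [s [N H]]. destruct Hp as [_ Hp].
  revert p H Hp. induction N as [|u l Hu N IH]; intros p H Hp HW.
  - replace p with (fun _ : list nat => RtoC 0); auto. funext w. symmetry. now apply H.
  - set (q := fun w => if word_dec w u then RtoC 0 else p w).
    assert (Hq : forall w, ~ In w l -> q w = 0).
    { intros w Hw. unfold q. destruct (word_dec w u); auto. apply H. simpl. intuition congruence. }
    assert (Sq : forall v, q v <> 0 -> p v <> 0).
    { intros v. unfold q. destruct (word_dec v u); congruence. }
    destruct (prop_dec (p u = 0)) as [E|E].
    + replace p with q; auto. funext w. unfold q. destruct (word_dec w u); congruence.
    + replace p with (ncadd (ncscale (p u) (ncword u)) q).
      * apply PS; auto; [exact (Hp u E)|]. split; [now exists l|]. intros w Hw. now apply Hp, Sq.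
      * funext w. unfold ncadd, ncscale, q. rewrite ncword_eq.
        destruct (word_dec w u); subst; ring.
Qed.

Lemma isNCP_ind (P : NCP -> Prop) : P (fun _ => 0) ->
  (forall c w p, wf w -> isNCP p -> P p -> P (ncadd (ncscale c (ncword w)) p)) -> forall p, isNCP p -> P p.
Proof.
  intros P0 PS p Hp. apply (span_ind (fun _ => True)); auto.
Qed.

Ltac nc_lin := apply functional_extensionality; intro; unfold ncsub, nccomm, ncsub, ncadd, ncscale; ring.

Lemma sumC_ext f g n : (forall k, (k < n)%nat -> f k = g k) -> sumC f n = sumC g n.
Proof. induction n; simpl; intros H; auto. rewrite IHn, H; auto. Qed.

Lemma sumC_plus f g n : sumC (fun k => f k + g k) n = sumC f n + sumC g n.
Proof. induction n; simpl; [ring|rewrite IHn; ring]. Qed.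

Lemma sumC_scale c f n : sumC (fun k => c * f k) n = c * sumC f n.
Proof. induction n; simpl; [ring|rewrite IHn; ring]. Qed.

Lemma sumC_S f n : sumC f (S n) = f O + sumC (fun k => f (S k)) n.
Proof. induction n; [simpl; ring|]. change (sumC f (S (S n))) with (sumC f (S n) + f (S n)). rewrite IHn. simpl. ring. Qed.

Lemma ncmul_nil p q : ncmul p q [] = p [] * q [].
Proof. unfold ncmul. simpl. ring. Qed.

(** A split of c :: w has an empty prefix or comes from a split of w, with p replaced by its left
    quotient by c. Identities for the product thus become structural inductions on the word. *)
Lemma ncmul_cons p q c w : ncmul p q (c :: w) = p [] * q (c :: w) + ncmul (fun v => p (c :: v)) q w.
Proof. unfold ncmul. cbn [length]. rewrite sumC_S. reflexivity. Qed.

Lemma ncmul_add_l p p' q : ncmul (ncadd p p') q = ncadd (ncmul p q) (ncmul p' q).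
Proof.
  funext w. unfold ncmul, ncadd. rewrite <- sumC_plus. apply sumC_ext. intros. cbv beta. ring.
Qed.
Lemma ncmul_add_r p q q' : ncmul p (ncadd q q') = ncadd (ncmul p q) (ncmul p q').
Proof.
  funext w. unfold ncmul, ncadd. rewrite <- sumC_plus. apply sumC_ext. intros. cbv beta. ring.
Qed.
Lemma ncmul_scale_l c p q : ncmul (ncscale c p) q = ncscale c (ncmul p q).
Proof.
  funext w. unfold ncmul, ncscale. rewrite <- sumC_scale. apply sumC_ext. intros. cbv beta. ring.
Qed.
Lemma ncmul_scale_r c p q : ncmul p (ncscale c q) = ncscale c (ncmul p q).
Proof.
  funext w. unfold ncmul, ncscale. rewrite <- sumC_scale. apply sumC_ext. intros. cbv beta. ring.
Qed.
Lemma ncmul_zero_l q : ncmul (fun _ => 0) q = fun _ => 0.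
Proof.
  funext w. unfold ncmul. rewrite (sumC_ext _ (fun k => 0 * 0)) by (intros; cbv beta; ring).
  rewrite sumC_scale. ring.
Qed.
Lemma ncmul_zero_r q : ncmul q (fun _ => 0) = fun _ => 0.
Proof.
  funext w. unfold ncmul. rewrite (sumC_ext _ (fun k => 0 * 0)) by (intros; cbv beta; ring).
  rewrite sumC_scale. ring.
Qed.

Lemma ncmul_assoc p q r : ncmul (ncmul p q) r = ncmul p (ncmul q r).
Proof.
  funext w. revert p q r. induction w as [|c w IH]; intros p q r.
  - rewrite !ncmul_nil. ring.
  - rewrite !ncmul_cons, ncmul_nil.
    replace (fun v => ncmul p q (c :: v)) with (ncadd (ncscale (p []) (fun v => q (c :: v))) (ncmul (fun v => p (c :: v)) q)).
    + rewrite ncmul_add_l, ncmul_scale_l. unfold ncadd, ncscale. rewrite IH. ring.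
    + funext v. now rewrite ncmul_cons.
Qed.

Lemma ncmul_word u v : ncmul (ncword u) (ncword v) = ncword (u ++ v).
Proof.
  funext w. revert w. induction u as [|c u IH]; intros w.
  - simpl. destruct w as [|d w].
    + rewrite ncmul_nil, !ncword_eq. destruct (word_dec [] []); [cbv beta; ring|congruence].
    + rewrite ncmul_cons. replace (fun v0 => ncword [] (d :: v0)) with (fun _ : list nat => RtoC 0).
      * rewrite ncmul_zero_l. rewrite (ncword_eq [] []). destruct (word_dec [] []); [cbv beta; ring|congruence].
      * funext x. rewrite ncword_eq. destruct (word_dec (d :: x) []); congruence.
  - destruct w as [|d w].
    + rewrite ncmul_nil, !ncword_eq. destruct (word_dec [] (c :: u)), (word_dec [] ((c :: u) ++ v)); try discriminate. ring.
    + rewrite ncmul_cons, (ncword_eq (c :: u) []). destruct (word_dec [] (c :: u)); [discriminate|].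
      destruct (Nat.eq_dec d c) as [->|E].
      * replace (fun v0 => ncword (c :: u) (c :: v0)) with (ncword u).
        -- rewrite IH, !ncword_eq. cbn [app]. destruct (word_dec w (u ++ v)), (word_dec (c :: w) (c :: u ++ v)); try congruence; ring.
        -- funext x. rewrite !ncword_eq.
           destruct (word_dec x u), (word_dec (c :: x) (c :: u)); congruence.
      * replace (fun v0 => ncword (c :: u) (d :: v0)) with (fun _ : list nat => RtoC 0).
        -- rewrite ncmul_zero_l, (ncword_eq ((c :: u) ++ v)). destruct (word_dec (d :: w) ((c :: u) ++ v)) as [F|F]; [injection F; congruence|cbv beta; ring].
        -- funext x. rewrite ncword_eq. destruct (word_dec (d :: x) (c :: u)); congruence.
Qed.

Lemma ncmul_one_l p : ncmul ncone p = p.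
Proof.
  apply functional_extensionality. intros [|c w].
  - rewrite ncmul_nil. unfold ncone. rewrite ncword_eq. destruct (word_dec [] []); [cbv beta; ring|congruence].
  - rewrite ncmul_cons. replace (fun v0 => ncone (c :: v0)) with (fun _ : list nat => RtoC 0).
    + rewrite ncmul_zero_l. unfold ncone. rewrite ncword_eq. destruct (word_dec [] []); [cbv beta; ring|congruence].
    + funext x. unfold ncone. rewrite ncword_eq. destruct (word_dec (c :: x) []); congruence.
Qed.

Lemma isNCP_mul p q : isNCP p -> isNCP q -> isNCP (ncmul p q).
Proof.
  intros P Q. revert p P. apply isNCP_ind.
  - rewrite ncmul_zero_l. apply isNCP_zero.
  - intros c w p Ww P IH. rewrite ncmul_add_l, ncmul_scale_l. apply isNCP_add; auto. apply isNCP_scale.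
    clear IH. revert q Q. apply isNCP_ind.
    + rewrite ncmul_zero_r. apply isNCP_zero.
    + intros c' v q Wv Q IH. rewrite ncmul_add_r, ncmul_scale_r, ncmul_word. apply isNCP_add; auto.
      apply isNCP_scale, isNCP_word. apply Forall_app. auto.
Qed.

Lemma isNCP_sub p q : isNCP p -> isNCP q -> isNCP (ncsub p q).
Proof. intros. apply isNCP_add; auto. now apply isNCP_scale. Qed.

Lemma isNCP_x : isNCP ncx. Proof. apply isNCP_word. repeat constructor. Qed.
Lemma isNCP_y : isNCP ncy. Proof. apply isNCP_word. repeat constructor. Qed.
Lemma isNCP_d : isNCP ncd. Proof. apply isNCP_word. repeat constructor. Qed.
Lemma isNCP_one : isNCP ncone. Proof. apply isNCP_word. repeat constructor. Qed.

#[global] Hint Resolve isNCP_zero isNCP_add isNCP_scale isNCP_mul isNCP_sub isNCP_x isNCP_y isNCP_d isNCP_one : ncp.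

Lemma wf_app u v : wf u -> wf v -> wf (u ++ v).
Proof. intros. now apply Forall_app. Qed.

#[global] Hint Resolve isNCP_word wf_app : ncp.
#[global] Hint Extern 2 (wf (_ :: _)) => repeat constructor : ncp.

Lemma ev_mul p q g : isNCP p -> isNCP q -> ev (ncmul p q) g = ev p (fun u => ev q (fun v => g (u ++ v))).
Proof.
  intros P Q. revert p P. apply isNCP_ind.
  - rewrite ncmul_zero_l, !ev_zero. reflexivity.
  - intros c w p Hw P IH. rewrite ncmul_add_l, ncmul_scale_l.
    rewrite !ev_add, !ev_scale; auto with ncp. rewrite IH, ev_word. f_equal. f_equal.
    clear IH. revert q Q. apply isNCP_ind.
    + rewrite ncmul_zero_r, !ev_zero. reflexivity.
    + intros c' v q Hv Q IH. rewrite ncmul_add_r, ncmul_scale_r, ncmul_word.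
      rewrite !ev_add, !ev_scale; auto with ncp. now rewrite IH, !ev_word.
Qed.

(** * Closure properties of the ideal I *)

Lemma isNCP_rel j : isNCP (rel j).
Proof. destruct j as [|[|j]]; simpl; unfold nccomm; auto 10 with ncp. Qed.
#[global] Hint Resolve isNCP_rel : ncp.

Lemma inI_NCP p : inI p -> isNCP p.
Proof. induction 1; auto with ncp. Qed.

Lemma inI_scale c p : inI p -> inI (ncscale c p).
Proof.
  induction 1.
  - replace (ncscale c (fun _ => RtoC 0)) with (fun _ : list nat => RtoC 0) by nc_lin. constructor.
  - rewrite <- !ncmul_scale_l. constructor; auto with ncp.
  - replace (ncscale c (ncadd p q)) with (ncadd (ncscale c p) (ncscale c q)) by nc_lin. now constructor.
Qed.

Lemma inI_mul_l a p : isNCP a -> inI p -> inI (ncmul a p).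
Proof.
  intros A. induction 1.
  - rewrite ncmul_zero_r. constructor.
  - rewrite <- !ncmul_assoc. constructor; auto with ncp.
  - rewrite ncmul_add_r. now constructor.
Qed.

Lemma inI_mul_r a p : isNCP a -> inI p -> inI (ncmul p a).
Proof.
  intros A. induction 1.
  - rewrite ncmul_zero_l. constructor.
  - rewrite (ncmul_assoc _ b a). constructor; auto with ncp.
  - rewrite ncmul_add_l. now constructor.
Qed.

Lemma ncmul_one_r p : ncmul p ncone = p.
Proof.
  funext w. revert p. induction w as [|c w IH]; intros p.
  - rewrite ncmul_nil. unfold ncone. rewrite ncword_eq. destruct (word_dec [] []); [cbv beta; ring|congruence].
  - rewrite ncmul_cons, IH. unfold ncone. rewrite ncword_eq. destruct (word_dec (c :: w) []); [congruence|cbv beta; ring].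
Qed.

Lemma inI_rel j : (j < 3)%nat -> inI (rel j).
Proof.
  intros H. rewrite <- (ncmul_one_l (rel j)), <- (ncmul_one_r (ncmul _ _)). constructor; auto with ncp.
Qed.

(** * Normal forms modulo I *)

Definition nword (a b k : nat) : list nat := repeat 0%nat a ++ repeat 1%nat b ++ repeat 2%nat k.

Lemma count_occ_repeat i n j : count_occ Nat.eq_dec (repeat i n) j = if Nat.eq_dec i j then n else 0%nat.
Proof.
  destruct (Nat.eq_dec i j) as [E|E].
  - now apply count_occ_repeat_eq.
  - now apply count_occ_repeat_neq.
Qed.

Lemma nword_inj a b k a' b' k' : nword a b k = nword a' b' k' -> a = a' /\ b = b' /\ k = k'.
Proof.
  intros E. assert (H : forall i, count_occ Nat.eq_dec (nword a b k) i = count_occ Nat.eq_dec (nword a' b' k') i) by congruence.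
  unfold nword in H.
  pose proof (H 0%nat) as H0. pose proof (H 1%nat) as H1. pose proof (H 2%nat) as H2.
  rewrite !count_occ_app in H0, H1, H2.
  rewrite !count_occ_repeat in H0, H1, H2. simpl in H0, H1, H2. lia.
Qed.

Lemma wf_repeat i n : (i < 3)%nat -> wf (repeat i n).
Proof. intros H. apply Forall_forall. intros x Hx. apply repeat_spec in Hx. now subst. Qed.

Lemma wf_nword a b k : wf (nword a b k).
Proof. unfold nword, wf. rewrite !Forall_app. repeat split; apply wf_repeat; lia. Qed.

(** The bound on the exponent of d is strict: [normal 1] describes the polynomials in x and y, and
    [normal 0] only the zero polynomial. *)
Definition normal (n : nat) (p : NCP) : Prop :=
  isNCP p /\ forall w, p w <> 0 -> exists a b k, (k < n)%nat /\ w = nword a b k.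

Definition eqI (p q : NCP) : Prop := inI (ncsub p q).

(** The filtration of T(V)/I by order in d, as for differential operators: x and y preserve it, and
    d raises it by one. *)
Definition Mod (n : nat) (p : NCP) : Prop := exists N, normal n N /\ eqI p N.

Lemma eqI_refl p : eqI p p.
Proof. unfold eqI. replace (ncsub p p) with (fun _ : list nat => RtoC 0) by nc_lin. constructor. Qed.

Lemma eqI_trans p q r : eqI p q -> eqI q r -> eqI p r.
Proof.
  unfold eqI. intros A B. replace (ncsub p r) with (ncadd (ncsub p q) (ncsub q r)) by nc_lin. now constructor.
Qed.

Lemma eqI_sym p q : eqI p q -> eqI q p.
Proof.
  unfold eqI. intros A. replace (ncsub q p) with (ncscale (-1) (ncsub p q)) by nc_lin. now apply inI_scale.
Qed.

Lemma eqI_add p q p' q' : eqI p p' -> eqI q q' -> eqI (ncadd p q) (ncadd p' q').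
Proof.
  unfold eqI. intros A B. replace (ncsub (ncadd p q) (ncadd p' q')) with (ncadd (ncsub p p') (ncsub q q')) by nc_lin.
  now constructor.
Qed.

Lemma eqI_scale c p q : eqI p q -> eqI (ncscale c p) (ncscale c q).
Proof.
  unfold eqI. intros A. replace (ncsub (ncscale c p) (ncscale c q)) with (ncscale c (ncsub p q)) by nc_lin.
  now apply inI_scale.
Qed.

Lemma ncmul_sub_r a p q : ncmul a (ncsub p q) = ncsub (ncmul a p) (ncmul a q).
Proof. unfold ncsub. now rewrite ncmul_add_r, ncmul_scale_r. Qed.
Lemma ncmul_sub_l a p q : ncmul (ncsub p q) a = ncsub (ncmul p a) (ncmul q a).
Proof. unfold ncsub. now rewrite ncmul_add_l, ncmul_scale_l. Qed.

Lemma eqI_mul_l a p q : isNCP a -> eqI p q -> eqI (ncmul a p) (ncmul a q).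
Proof. unfold eqI. intros A H. rewrite <- ncmul_sub_r. now apply inI_mul_l. Qed.
Lemma eqI_mul_r a p q : isNCP a -> eqI p q -> eqI (ncmul p a) (ncmul q a).
Proof. unfold eqI. intros A H. rewrite <- ncmul_sub_l. now apply inI_mul_r. Qed.

Lemma inI_eqI p : inI p <-> eqI p (fun _ => 0).
Proof. unfold eqI. replace (ncsub p (fun _ => RtoC 0)) with p by nc_lin. tauto. Qed.

Lemma normal_zero n : normal n (fun _ => 0).
Proof. split. apply isNCP_zero. congruence. Qed.

Lemma normal_add n p q : normal n p -> normal n q -> normal n (ncadd p q).
Proof.
  intros [P P'] [Q Q']. split; [auto with ncp|]. intros w H.
  destruct (prop_dec (p w = 0)) as [E|E]; auto. apply Q'. intros F. apply H. unfold ncadd. rewrite E, F. ring.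
Qed.

Lemma normal_scale n c p : normal n p -> normal n (ncscale c p).
Proof.
  intros [P P']. split; [auto with ncp|]. intros w H. apply P'. intros F. apply H. unfold ncscale. rewrite F. ring.
Qed.

Lemma normal_word n a b k : (k < n)%nat -> normal n (ncword (nword a b k)).
Proof.
  intros H. split. apply isNCP_word, wf_nword. intros w. rewrite ncword_eq. destruct (word_dec w (nword a b k)); [|congruence].
  intros _. now exists a, b, k.
Qed.

Lemma normal_mono n m p : (n <= m)%nat -> normal n p -> normal m p.
Proof.
  intros H [P P']. split; auto. intros w Hw. destruct (P' w Hw) as (a & b & k & L & E). exists a, b, k. split; auto. lia.
Qed.

Lemma normal_ind n (P : NCP -> Prop) : P (fun _ => 0) ->
  (forall c a b k p, (k < n)%nat -> normal n p -> P p -> P (ncadd (ncscale c (ncword (nword a b k))) p)) ->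
  forall p, normal n p -> P p.
Proof.
  intros P0 PS p [F H]. revert p F H. apply span_ind; auto.
  intros c w p (a & b & k & L & ->) _ Fp Hp. apply PS; auto. now split.
Qed.

Lemma Mod_normal n p : normal n p -> Mod n p.
Proof. intros H. exists p. split; auto. apply eqI_refl. Qed.

Lemma Mod_eqI n p q : eqI p q -> Mod n q -> Mod n p.
Proof. intros H (N & HN & E). exists N. split; auto. now apply eqI_trans with q. Qed.

Lemma Mod_add n p q : Mod n p -> Mod n q -> Mod n (ncadd p q).
Proof.
  intros (N & HN & E) (M & HM & F). exists (ncadd N M). split. now apply normal_add. now apply eqI_add.
Qed.

Lemma Mod_scale n c p : Mod n p -> Mod n (ncscale c p).
Proof. intros (N & HN & E). exists (ncscale c N). split. now apply normal_scale. now apply eqI_scale. Qed.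

Lemma Mod_sub n p q : Mod n p -> Mod n q -> Mod n (ncsub p q).
Proof. intros. apply Mod_add; auto. now apply Mod_scale. Qed.

Lemma Mod_inI n p : inI p -> Mod n p.
Proof. intros H. exists (fun _ => 0). split. apply normal_zero. exact (proj1 (inI_eqI p) H). Qed.

Lemma Mod_mono n m p : (n <= m)%nat -> Mod n p -> Mod m p.
Proof. intros H (N & HN & E). exists N. split; auto. now apply normal_mono with n. Qed.

Lemma Mod_word n a b k : (k < n)%nat -> Mod n (ncword (nword a b k)).
Proof. intros. apply Mod_normal. now apply normal_word. Qed.

Lemma Mod_mul_l a m n : isNCP a ->
  (forall a' b k, (k < m)%nat -> Mod n (ncmul a (ncword (nword a' b k)))) -> forall p, Mod m p -> Mod n (ncmul a p).
Proof.
  intros A H p (N & HN & E). apply Mod_eqI with (ncmul a N). now apply eqI_mul_l.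
  revert N HN E. intros N HN _. revert N HN. apply normal_ind.
  - rewrite ncmul_zero_r. apply Mod_normal, normal_zero.
  - intros c a' b k q L _ IH. rewrite ncmul_add_r, ncmul_scale_r. apply Mod_add; auto. apply Mod_scale; auto.
Qed.

Lemma Mod_mul_r a m n : isNCP a ->
  (forall a' b k, (k < m)%nat -> Mod n (ncmul (ncword (nword a' b k)) a)) -> forall p, Mod m p -> Mod n (ncmul p a).
Proof.
  intros A H p (N & HN & E). apply Mod_eqI with (ncmul N a). now apply eqI_mul_r.
  revert N HN E. intros N HN _. revert N HN. apply normal_ind.
  - rewrite ncmul_zero_l. apply Mod_normal, normal_zero.
  - intros c a' b k q L _ IH. rewrite ncmul_add_l, ncmul_scale_l. apply Mod_add; auto. apply Mod_scale; auto.
Qed.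

Lemma eqI_word_context s t u v : wf s -> wf t -> eqI (ncword u) (ncword v) ->
  eqI (ncword (s ++ u ++ t)) (ncword (s ++ v ++ t)).
Proof.
  intros S T H. rewrite <- !ncmul_word. apply eqI_mul_l. now apply isNCP_word. apply eqI_mul_r; auto. now apply isNCP_word.
Qed.

Lemma eqI_xy : eqI (ncword [1; 0]%nat) (ncword [0; 1]%nat).
Proof.
  apply eqI_sym. unfold eqI. pose proof (inI_rel 0 ltac:(lia)) as H. unfold rel, nccomm, ncx, ncy in H.
  now rewrite !ncmul_word in H.
Qed.

Lemma y_past_x a t : wf t -> eqI (ncword (1%nat :: repeat 0%nat a ++ t)) (ncword (repeat 0%nat a ++ 1%nat :: t)).
Proof.
  intros T. induction a as [|a IH]. apply eqI_refl.
  apply eqI_trans with (ncword (0 :: 1 :: repeat 0 a ++ t)%nat).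
  - apply (eqI_word_context [] (repeat 0%nat a ++ t) [1; 0]%nat [0; 1]%nat); [constructor| |apply eqI_xy].
    apply Forall_app. split; auto. apply wf_repeat. lia.
  - apply (eqI_mul_l ncx) in IH; [|apply isNCP_x]. unfold ncx in IH. rewrite !ncmul_word in IH. exact IH.
Qed.

Lemma x_past_y b t : wf t -> eqI (ncword (repeat 1%nat b ++ 0%nat :: t)) (ncword (0%nat :: repeat 1%nat b ++ t)).
Proof.
  intros T. induction b as [|b IH]. apply eqI_refl.
  apply eqI_trans with (ncword (1 :: 0 :: repeat 1 b ++ t)%nat).
  - apply (eqI_mul_l ncy) in IH; [|apply isNCP_y]. unfold ncy in IH. rewrite !ncmul_word in IH. exact IH.
  - apply (eqI_word_context [] (repeat 1%nat b ++ t) [1; 0]%nat [0; 1]%nat); [constructor| |apply eqI_xy].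
    apply Forall_app. split; auto. apply wf_repeat. lia.
Qed.

Lemma Mod_x n p : Mod n p -> Mod n (ncmul ncx p).
Proof.
  apply Mod_mul_l; [apply isNCP_x|]. intros a b k L. unfold ncx. rewrite ncmul_word. now apply (Mod_word n (S a)).
Qed.

Lemma Mod_y n p : Mod n p -> Mod n (ncmul ncy p).
Proof.
  apply Mod_mul_l; [apply isNCP_y|]. intros a b k L. unfold ncy. rewrite ncmul_word.
  apply Mod_eqI with (ncword (nword a (S b) k)); [|now apply Mod_word].
  unfold nword. apply (y_past_x a (repeat 1%nat b ++ repeat 2%nat k)).
  apply Forall_app. split; apply wf_repeat; lia.
Qed.

Lemma rel1_eq : rel 1 = ncadd (ncsub (ncmul ncd ncx) (ncmul ncx ncd)) (ncscale (RtoC (1 / 3)) ncy).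
Proof. reflexivity. Qed.
Lemma rel2_eq : rel 2 = ncadd (ncsub (ncmul ncd ncy) (ncmul ncy ncd)) (ncscale (RtoC (1 / 2)) (ncmul ncx ncx)).
Proof. reflexivity. Qed.

(** Modulo I the commutator with d is a derivation that sends x to -y/3 and y to -x^2/2, so it maps
    polynomials in x and y to such polynomials. The induction strips one letter at a time. *)
Lemma d_past_monomial a b : Mod 1 (ncsub (ncmul ncd (ncword (nword a b 0))) (ncmul (ncword (nword a b 0)) ncd)).
Proof.
  induction a as [|a IH].
  - induction b as [|b IH].
    + unfold nword. simpl. fold ncone. rewrite ncmul_one_l, ncmul_one_r. apply Mod_inI. apply eqI_refl.
    + assert (E : ncword (nword 0 (S b) 0) = ncmul ncy (ncword (nword 0 b 0))) by (unfold ncy; now rewrite ncmul_word).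
      rewrite E. set (m := ncword (nword 0 b 0)) in *.
      replace (ncsub (ncmul ncd (ncmul ncy m)) (ncmul (ncmul ncy m) ncd)) with
        (ncadd (ncadd (ncmul (rel 2) m) (ncscale (- RtoC (1 / 2)) (ncmul ncx (ncmul ncx m))))
           (ncmul ncy (ncsub (ncmul ncd m) (ncmul m ncd)))).
      * apply Mod_add; [apply Mod_add|].
        -- apply Mod_inI, inI_mul_r. apply isNCP_word, wf_nword. apply inI_rel. lia.
        -- apply Mod_scale, Mod_x, Mod_x, Mod_word. lia.
        -- now apply Mod_y.
      * rewrite rel2_eq, !ncmul_add_l, ncmul_sub_l, ncmul_scale_l, ncmul_sub_r, !ncmul_assoc. nc_lin.
  - assert (E : ncword (nword (S a) b 0) = ncmul ncx (ncword (nword a b 0))) by (unfold ncx; now rewrite ncmul_word).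
    rewrite E. set (m := ncword (nword a b 0)) in *.
    replace (ncsub (ncmul ncd (ncmul ncx m)) (ncmul (ncmul ncx m) ncd)) with
      (ncadd (ncadd (ncmul (rel 1) m) (ncscale (- RtoC (1 / 3)) (ncmul ncy m)))
         (ncmul ncx (ncsub (ncmul ncd m) (ncmul m ncd)))).
    + apply Mod_add; [apply Mod_add|].
      * apply Mod_inI, inI_mul_r. apply isNCP_word, wf_nword. apply inI_rel. lia.
      * apply Mod_scale, Mod_y, Mod_word. lia.
      * now apply Mod_x.
    + rewrite rel1_eq, !ncmul_add_l, ncmul_sub_l, ncmul_scale_l, ncmul_sub_r, !ncmul_assoc. nc_lin.
Qed.

Definition dpow (k : nat) : NCP := ncword (repeat 2%nat k).

Lemma isNCP_dpow k : isNCP (dpow k).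
Proof. apply isNCP_word, wf_repeat. lia. Qed.

Lemma nword_dpow a b k : ncword (nword a b k) = ncmul (ncword (nword a b 0)) (dpow k).
Proof. unfold dpow, nword. rewrite ncmul_word. simpl. now rewrite app_nil_r, <- app_assoc. Qed.

Lemma dpow_S k : dpow (S k) = ncmul ncd (dpow k).
Proof. unfold dpow, ncd. now rewrite ncmul_word. Qed.

(** For a monomial m in x and y, d m d^k = [d,m] d^k + m d^(k+1), and [d,m] has order 0. *)
Lemma Mod_d n p : Mod n p -> Mod (S n) (ncmul ncd p).
Proof.
  apply Mod_mul_l; [apply isNCP_d|]. intros a b k L.
  rewrite nword_dpow, <- ncmul_assoc. set (m := ncword (nword a b 0)).
  replace (ncmul (ncmul ncd m) (dpow k)) with
    (ncadd (ncmul (ncsub (ncmul ncd m) (ncmul m ncd)) (dpow k)) (ncmul m (dpow (S k)))).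
  - apply Mod_add.
    + apply (Mod_mul_r (dpow k) 1); [apply isNCP_dpow| |apply d_past_monomial].
      intros a' b' k' L'. replace k' with 0%nat by lia. rewrite <- nword_dpow. apply Mod_word. lia.
    + unfold m. rewrite <- nword_dpow. apply Mod_word. lia.
  - rewrite dpow_S, ncmul_sub_l, !ncmul_assoc. nc_lin.
Qed.

Theorem normal_form p : isNCP p -> exists n, Mod n p.
Proof.
  revert p. apply isNCP_ind.
  - exists 0%nat. apply Mod_normal, normal_zero.
  - intros c w p Ww _ [n IH].
    assert (Hw : exists m, Mod m (ncword w)).
    { clear - Ww. induction Ww as [|i w Hi Ww [m IH]].
      - exists 1%nat. apply (Mod_word 1 0 0 0). lia.
      - assert (E : ncword (i :: w) = ncmul (ncword [i]) (ncword w)) by now rewrite ncmul_word. rewrite E.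
        destruct i as [|[|[|i]]]; [| | |lia].
        + exists m. now apply Mod_x.
        + exists m. now apply Mod_y.
        + exists (S m). now apply Mod_d. }
    destruct Hw as [m Hm]. exists (max n m). apply Mod_add.
    + apply Mod_scale, (Mod_mono m); auto. lia.
    + apply (Mod_mono n); auto. lia.
Qed.

(** * Commutators with x *)

Definition adx (p : NCP) : NCP := ncsub (ncmul p ncx) (ncmul ncx p).

Lemma adx_mul p q : adx (ncmul p q) = ncadd (ncmul p (adx q)) (ncmul (adx p) q).
Proof. unfold adx. rewrite ncmul_sub_l, ncmul_sub_r, !ncmul_assoc. nc_lin. Qed.

(** The Leibniz rule repeats [d,x] = -y/3 once for each factor d, which gives the leading term
    -((k+1)/3) y d^k. Moving d past y in the induction step costs only x^2/2, a term of lower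
    order. *)
Lemma adx_dpow k : Mod k (ncadd (adx (dpow (S k))) (ncscale (RtoC (INR (S k) / 3)) (ncmul ncy (dpow k)))).
Proof.
  induction k as [|k IH].
  - apply Mod_inI.
    replace (ncadd _ _) with (rel 1). apply inI_rel; lia.
    rewrite rel1_eq. unfold adx, dpow, ncd. simpl repeat. fold ncone. rewrite ncmul_one_r. reflexivity.
  - rewrite (dpow_S (S k)), adx_mul.
    replace (RtoC (INR (S (S k)) / 3)) with (RtoC (INR (S k) / 3) + RtoC (1 / 3)).
    2: { rewrite (S_INR (S k)), <- RtoC_plus. f_equal. field. }
    set (c := RtoC (INR (S k) / 3)) in *.
    replace (ncadd _ _) with
      (ncadd (ncadd (ncmul ncd (ncadd (adx (dpow (S k))) (ncscale c (ncmul ncy (dpow k)))))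
                    (ncmul (rel 1) (dpow (S k))))
             (ncscale c (ncsub (ncscale (RtoC (1 / 2)) (ncmul ncx (ncmul ncx (dpow k)))) (ncmul (rel 2) (dpow k))))).
    + apply Mod_add; [apply Mod_add|].
      * now apply Mod_d.
      * apply Mod_inI, inI_mul_r; [apply isNCP_dpow|apply inI_rel; lia].
      * apply Mod_scale, Mod_sub.
        -- apply Mod_scale, Mod_x, Mod_x. apply (Mod_word (S k) 0 0 k). lia.
        -- apply Mod_inI, inI_mul_r; [apply isNCP_dpow|apply inI_rel; lia].
    + rewrite rel1_eq, rel2_eq, (dpow_S k). set (X := dpow k). unfold adx.
      repeat rewrite ?ncmul_add_l, ?ncmul_add_r, ?ncmul_sub_l, ?ncmul_sub_r, ?ncmul_scale_l, ?ncmul_scale_r, ?ncmul_assoc.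
      nc_lin.
Qed.

Lemma adx_monomial a b : inI (adx (ncword (nword a b 0))).
Proof.
  change (eqI (ncmul (ncword (nword a b 0)) ncx) (ncmul ncx (ncword (nword a b 0)))).
  unfold ncx. rewrite !ncmul_word. unfold nword. simpl repeat. rewrite app_nil_r, <- app_assoc.
  apply eqI_trans with (ncword (repeat 0%nat a ++ 0%nat :: repeat 1%nat b)).
  - pose proof (eqI_word_context (repeat 0%nat a) [] (repeat 1%nat b ++ [0%nat]) (0%nat :: repeat 1%nat b)) as H.
    rewrite !app_nil_r in H. apply H; [apply wf_repeat; lia|constructor|].
    pose proof (x_past_y b [] ltac:(constructor)) as K. now rewrite app_nil_r in K.
  - replace (repeat 0%nat a ++ 0%nat :: repeat 1%nat b) with ([0%nat] ++ repeat 0%nat a ++ repeat 1%nat b).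
    apply eqI_refl. clear. induction a; simpl in *; congruence.
Qed.

Lemma Mod_monomial n a b p : Mod n p -> Mod n (ncmul (ncword (nword a b 0)) p).
Proof.
  intros H. assert (E : ncword (nword a b 0) = ncmul (ncword (repeat 0%nat a)) (ncword (repeat 1%nat b))).
  { rewrite ncmul_word. unfold nword. simpl. now rewrite app_nil_r. }
  rewrite E, ncmul_assoc. assert (H' : Mod n (ncmul (ncword (repeat 1%nat b)) p)).
  { clear E. induction b as [|b IH]. simpl. fold ncone. now rewrite ncmul_one_l.
    replace (ncword (repeat 1%nat (S b))) with (ncmul ncy (ncword (repeat 1%nat b))) by (unfold ncy; now rewrite ncmul_word).
    rewrite ncmul_assoc. now apply Mod_y. }
  clear E. induction a as [|a IH]. simpl. fold ncone. now rewrite ncmul_one_l.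
  replace (ncword (repeat 0%nat (S a))) with (ncmul ncx (ncword (repeat 0%nat a))) by (unfold ncx; now rewrite ncmul_word).
  rewrite ncmul_assoc. now apply Mod_x.
Qed.

Lemma adx_nword a b k : Mod k (ncadd (adx (ncword (nword a b (S k))))
  (ncscale (RtoC (INR (S k) / 3)) (ncword (nword a (S b) k)))).
Proof.
  rewrite nword_dpow, adx_mul. set (m := ncword (nword a b 0)). set (c := RtoC (INR (S k) / 3)).
  replace (ncword (nword a (S b) k)) with (ncmul m (ncmul ncy (dpow k))).
  - replace (ncadd _ _) with (ncadd (ncmul m (ncadd (adx (dpow (S k))) (ncscale c (ncmul ncy (dpow k)))))
      (ncmul (adx m) (dpow (S k)))).
    + apply Mod_add. apply Mod_monomial, adx_dpow. apply Mod_inI, inI_mul_r. apply isNCP_dpow. apply adx_monomial.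
    + rewrite ncmul_add_r, ncmul_scale_r. nc_lin.
  - unfold m, ncy, dpow. rewrite !ncmul_word. f_equal. unfold nword. simpl. rewrite app_nil_r, <- app_assoc.
    f_equal. clear. induction b; simpl in *; congruence.
Qed.

Lemma normal_degree_zero n p a b k : normal n p -> (n <= k)%nat -> p (nword a b k) = 0.
Proof.
  intros [_ H] L. apply NNPP. intros N. destruct (H _ N) as (a' & b' & k' & L' & E).
  apply nword_inj in E. lia.
Qed.

Lemma nword_coeff a b k a' b' k' : ncword (nword a b k) (nword a' b' k') =
  if prop_dec (a = a' /\ b = b' /\ k = k') then 1 else 0.
Proof.
  rewrite ncword_eq. destruct (word_dec _ _) as [E|E], (prop_dec _) as [F|F]; auto.
  - apply nword_inj in E. exfalso. apply F. intuition.
  - destruct F as (-> & -> & ->). congruence.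
Qed.

(* Commuting with x lowers the degree in d by one and multiplies the leading coefficient by a
   nonzero multiple of y. *)
Lemma adx_leading m N : normal (S (S m)) N -> exists M, normal (S m) M /\ eqI (adx N) M /\
  forall a b, M (nword a (S b) m) = - RtoC (INR (S m) / 3) * N (nword a b (S m)).
Proof.
  revert N. apply normal_ind.
  - exists (fun _ => 0). split; [apply normal_zero|]. split; [|intros; ring].
    unfold adx. rewrite ncmul_zero_l, ncmul_zero_r. unfold eqI.
    replace (ncsub _ _) with (fun _ : list nat => RtoC 0) by nc_lin. constructor.
  - intros c a b k p L Hp (M & HM & EM & LM).
    assert (Hw : exists M', normal (S m) M' /\ eqI (adx (ncword (nword a b k))) M' /\
      forall a' b', M' (nword a' (S b') m) = - RtoC (INR (S m) / 3) * ncword (nword a b k) (nword a' b' (S m))).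
    { destruct (Nat.eq_dec k (S m)) as [->|Nk].
      - destruct (adx_nword a b m) as (R & HR & ER).
        exists (ncadd (ncscale (- RtoC (INR (S m) / 3)) (ncword (nword a (S b) m))) R). split; [|split].
        + apply normal_add. apply normal_scale, normal_word; lia. apply (normal_mono m); auto.
        + unfold eqI in *. match goal with |- inI ?G => match type of ER with inI ?H => replace G with H by nc_lin end end. exact ER.
        + intros a' b'. unfold ncadd, ncscale. rewrite (normal_degree_zero m R) by auto. rewrite !nword_coeff.
          destruct (prop_dec (a = a' /\ S b = S b' /\ m = m)) as [E|E],
            (prop_dec (a = a' /\ b = b' /\ S m = S m)) as [F|F]; try ring;
            exfalso; [apply F|apply E]; repeat split; lia.
      - assert (Hm : Mod m (adx (ncword (nword a b k)))).
        { destruct k as [|k]. apply Mod_inI, adx_monomial.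
          pose proof (adx_nword a b k) as H. apply (Mod_mono k m) in H; [|lia].
          match type of H with Mod _ (ncadd _ ?T) => pose proof (Mod_sub m _ T H) as H' end.
          match type of H' with _ -> Mod _ ?G => replace G with (adx (ncword (nword a b (S k)))) in H' by nc_lin end.
          apply H'. apply Mod_scale, Mod_word. lia. }
        destruct Hm as (R & HR & ER). exists R. split; [apply (normal_mono m); auto|]. split; auto.
        intros a' b'. rewrite (normal_degree_zero m R), nword_coeff by auto.
        destruct (prop_dec _) as [E|E]; [lia|ring]. }
    destruct Hw as (M' & HM' & EM' & LM').
    exists (ncadd (ncscale c M') M). split; [|split].
    + apply normal_add; auto. now apply normal_scale.
    + replace (adx _) with (ncadd (ncscale c (adx (ncword (nword a b k)))) (adx p)).
      * apply eqI_add; auto. now apply eqI_scale.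
      * unfold adx. rewrite ncmul_add_l, ncmul_add_r, ncmul_scale_l, ncmul_scale_r. nc_lin.
    + intros a' b'. unfold ncadd, ncscale. rewrite LM, LM'. ring.
Qed.

(** * Two-sided ideals that contain I and meet C[x,y] in 0 *)

Section Ideal.
Variable K : NCP -> Prop.
Hypothesis K_I : forall p, inI p -> K p.
Hypothesis K_sub : forall p q, K p -> K q -> K (ncsub p q).
Hypothesis K_mul_l : forall a p, isNCP a -> isNCP p -> K p -> K (ncmul a p).
Hypothesis K_mul_r : forall a p, isNCP a -> isNCP p -> K p -> K (ncmul p a).
Hypothesis K_pol : forall N, normal 1 N -> K N -> N = fun _ => 0.

(** The commutator of N with x stays in K and has smaller order, so it vanishes by induction. As its
    leading coefficients are nonzero multiples of those of N, the order of N drops as well. *)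
Lemma ideal_normal_zero n : forall N, normal n N -> K N -> N = fun _ => 0.
Proof.
  induction n as [|n IH]; intros N HN KN.
  - funext w. apply NNPP. intros H. destruct HN as [_ HN].
    destruct (HN w H) as (_ & _ & k & L & _). lia.
  - destruct n as [|m]; [auto|]. destruct (adx_leading m N HN) as (M & HM & EM & LM).
    pose proof (proj1 HN) as NN.
    assert (KM : K M).
    { replace M with (ncsub (adx N) (ncsub (adx N) M)) by nc_lin. apply K_sub; [|now apply K_I].
      apply K_sub; [apply K_mul_r|apply K_mul_l]; auto using isNCP_x. }
    rewrite (IH M HM KM) in LM.
    (* The induction hypothesis is used a second time, now for N itself: a word with d^(m+1) would
       have a nonzero coefficient, against [LM]. *)
    apply IH; auto. destruct HN as [F H]. split; auto. intros w Hw.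
    destruct (H w Hw) as (a & b & k & L & E). exists a, b, k. split; auto.
    destruct (Nat.eq_dec k (S m)) as [->|]; [|lia]. exfalso. apply Hw. rewrite E.
    specialize (LM a b). cbv beta in LM.
    assert (NZ : RtoC (INR (S m) / 3) <> 0).
    { intros Z. apply RtoC_inj in Z. pose proof (lt_0_INR (S m) ltac:(lia)). lra. }
    apply NNPP. intros Q. apply (Cmult_neq_0 _ _ NZ Q).
    replace (RtoC (INR (S m) / 3) * N (nword a b (S m))) with (- (- RtoC (INR (S m) / 3) * N (nword a b (S m)))) by ring.
    rewrite <- LM. ring.
Qed.

Theorem ideal_eq_I p : isNCP p -> K p -> inI p.
Proof.
  intros Hp Kp. destruct (normal_form p Hp) as (n & N & HN & E).
  assert (KN : K N). { replace N with (ncsub p (ncsub p N)) by nc_lin. apply K_sub; auto. }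
  rewrite (ideal_normal_zero n N HN KN) in E. now apply inI_eqI.
Qed.
End Ideal.

(** * Independence of E4 and E6 *)

Fixpoint horner (l : list C) (v : C) : C := match l with [] => 0 | c :: l => c + v * horner l v end.

(* The quotient of c + v * l by v - 1, which does not depend on c. *)
Fixpoint quotient1 (l : list C) : list C := match l with [] => [] | _ :: l' => horner l 1 :: quotient1 l' end.

Lemma horner_quotient1 c l v : horner (c :: l) v - horner (c :: l) 1 = (v - 1) * horner (quotient1 l) v.
Proof.
  revert c. induction l as [|c' l IH]; intros c.
  - simpl. ring.
  - specialize (IH c'). cbn [quotient1].
    change (horner (c :: c' :: l) v) with (c + v * horner (c' :: l) v).
    change (horner (c :: c' :: l) 1) with (c + 1 * horner (c' :: l) 1).
    change (horner (horner (c' :: l) 1 :: quotient1 l) v) with (horner (c' :: l) 1 + v * horner (quotient1 l) v).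
    replace (horner (c' :: l) v) with (horner (c' :: l) 1 + (v - 1) * horner (quotient1 l) v) by (rewrite <- IH; ring).
    ring.
Qed.

Lemma quotient1_zero l : List.Forall (fun c : C => c = 0) (quotient1 l) -> List.Forall (fun c : C => c = 0) l.
Proof.
  induction l as [|c l IH]; intros H; [constructor|]. inversion H as [|? ? H1 H2]. subst.
  specialize (IH H2). constructor; auto. simpl in H1.
  assert (E : horner l 1 = 0). { clear - IH. induction IH; simpl; auto. rewrite H, IHIH. ring. }
  rewrite E in H1. rewrite <- H1. ring.
Qed.

Lemma horner_bounded l : exists B, (0 <= B)%R /\ forall v, (Cmod v <= 2)%R -> (Cmod (horner l v) <= B)%R.
Proof.
  induction l as [|c l (B & HB & IH)].
  - exists 0%R. split; [lra|]. intros v _. simpl. rewrite Cmod_0. lra.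
  - exists (Cmod c + 2 * B)%R. pose proof (Cmod_ge_0 c). split; [lra|]. intros v Hv. simpl.
    eapply Rle_trans; [apply Cmod_triangle|]. rewrite Cmod_mult. specialize (IH v Hv).
    pose proof (Cmod_ge_0 v). pose proof (Cmod_ge_0 (horner l v)). nra.
Qed.

(** The roots accumulate at 1 from the right. Continuity gives a root at 1, and division by v - 1
    keeps the roots v > 1 while the list of coefficients gets shorter. *)
Lemma polynomial_zero (V : R -> Prop) :
  (forall e, (0 < e)%R -> exists v, V v /\ (1 < v < 1 + e)%R) ->
  forall l, (forall v, V v -> horner l (RtoC v) = 0) -> List.Forall (fun c : C => c = 0) l.
Proof.
  intros HV l. assert (G : forall n l, length l = n -> (forall v, V v -> (1 < v)%R -> horner l (RtoC v) = 0) -> List.Forall (fun c : C => c = 0) l).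
  2: { intros H. apply (G (length l)); auto. }
  clear l. induction n as [|n IH]; intros l Hl Hv.
  - destruct l; [constructor|discriminate].
  - destruct l as [|c l]; [discriminate|]. injection Hl as Hl.
    assert (H1 : horner (c :: l) 1 = 0).
    { destruct (horner_bounded (quotient1 l)) as (B & HB & Bd).
      apply Cmod_eq_0. apply Rle_antisym; [|apply Cmod_ge_0]. apply Rnot_lt_le. intros P.
      set (p := Cmod (horner (c :: l) 1)) in *.
      (* v < 2 makes the bound B available, and (v - 1) B < p contradicts p = (v - 1) |quotient at
         v|. *)
      destruct (HV (Rmin 1 (p / (B + 1)))) as (v & Vv & Hv1).
      { apply Rmin_pos; [lra|]. apply Rdiv_lt_0_compat; lra. }
      pose proof (Rmin_l 1 (p / (B + 1))). pose proof (Rmin_r 1 (p / (B + 1))).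
      pose proof (horner_quotient1 c l (RtoC v)) as Q. rewrite (Hv v Vv ltac:(lra)) in Q.
      assert (Ep : p = ((v - 1) * Cmod (horner (quotient1 l) (RtoC v)))%R).
      { unfold p. replace (horner (c :: l) 1) with (- ((RtoC v - 1) * horner (quotient1 l) (RtoC v))) by (rewrite <- Q; ring).
        rewrite Cmod_opp, Cmod_mult. f_equal. rewrite <- RtoC_minus, Cmod_R. apply Rabs_right. lra. }
      specialize (Bd (RtoC v)). rewrite Cmod_R, Rabs_right in Bd by lra. specialize (Bd ltac:(lra)).
      assert (p / (B + 1) * (B + 1) = p)%R by (field; lra).
      pose proof (Cmod_ge_0 (horner (quotient1 l) (RtoC v))). nra. }
    assert (HQ : List.Forall (fun c : C => c = 0) (quotient1 l)).
    { apply IH.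
      - rewrite <- Hl. clear. induction l; simpl; congruence.
      - intros v Vv Hv1. pose proof (horner_quotient1 c l (RtoC v)) as Q. rewrite H1, (Hv v Vv Hv1) in Q.
        apply NNPP. intros N. apply (Cmult_neq_0 (RtoC v - 1) _) in N.
        + apply N. rewrite <- Q. ring.
        + rewrite <- RtoC_minus. intros E. apply RtoC_inj in E. lra. }
    apply quotient1_zero in HQ. constructor; auto.
    assert (E : horner l 1 = 0). { clear - HQ. induction HQ; simpl; auto. rewrite H, IHHQ. ring. }
    simpl in H1. rewrite E in H1. rewrite <- H1. ring.
Qed.

Lemma horner_seq (d : nat -> C) v n : forall s, horner (map d (seq s n)) v * v ^ s = clsum (fun j => d j * v ^ j) (seq s n).
Proof.
  induction n as [|n IH]; intros s; unfold clsum in *; simpl.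
  - ring.
  - rewrite <- IH. simpl. ring.
Qed.

Lemma ev_clsum {A} p (g : A -> list nat -> C) l : clsum (fun j => ev p (g j)) l = ev p (fun w => clsum (fun j => g j w) l).
Proof.
  induction l as [|x l IH]; unfold clsum in *; simpl.
  - unfold ev. rewrite clsum_zero; auto. intros; ring.
  - rewrite IH, <- ev_plus. reflexivity.
Qed.

Lemma clsum_indicator (a : nat) (f : nat -> C) l : NoDup l -> In a l ->
  clsum (fun j => if Nat.eq_dec a j then f j else 0) l = f a.
Proof.
  intros N I. unfold clsum. induction N as [|x l Hx N IH]; [easy|]. simpl. destruct (Nat.eq_dec a x) as [->|E].
  - fold (clsum (fun j => if Nat.eq_dec x j then f j else 0) l). rewrite clsum_zero; [ring|].
    intros w Hw. destruct (Nat.eq_dec x w); [congruence|ring].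
  - destruct I as [I|I]; [congruence|]. rewrite IH by auto. ring.
Qed.

Definition occ (i : nat) (w : list nat) : nat := count_occ Nat.eq_dec w i.
(** The modular weight, the letters 0 and 1 standing for E4 and E6. *)
Definition weight (w : list nat) : nat := (4 * occ 0 w + 6 * occ 1 w)%nat.

Lemma occ_nword a b k : occ 0 (nword a b k) = a /\ occ 1 (nword a b k) = b.
Proof.
  unfold occ, nword. rewrite !count_occ_app, !count_occ_repeat. simpl. lia.
Qed.

(** E4 / E6^(2/3) at iy, of weight 0. Its cube E4^3 / E6^2 equals j / (j - 1728); the real power is
    meaningful where E6 is positive. *)
Definition hauptmodul (y : R) : R := (A4 y * Rpower (B6 y) (- 2 / 3))%R.

Lemma hauptmodul_lim e : (0 < e)%R -> forall Y, exists y, (Y <= y)%R /\ (0 < B6 y)%R /\ (1 < hauptmodul y < 1 + e)%R.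
Proof.
  (* For e' <= 1/2 one has B6^(-2/3) < 1/B6 < 1 + 2e', and (1 + e')(1 + 2e') <= 1 + 4e' <= 1 + e. *)
  intros He Y. set (e' := Rmin (1 / 2) (e / 4)).
  assert (H1 : (0 < e')%R) by (apply Rmin_pos; lra).
  assert (H2 : (e' <= 1 / 2)%R) by apply Rmin_l. assert (H3 : (e' <= e / 4)%R) by apply Rmin_r.
  destruct (A4_B6_lim e' H1) as (Y' & _ & H). exists (Rmax Y Y').
  split; [apply Rmax_l|]. destruct (H (Rmax Y Y') (Rmax_r _ _)) as [HA HB].
  set (a := A4 (Rmax Y Y')) in *. set (b := B6 (Rmax Y Y')) in *. split; [lra|].
  unfold hauptmodul. fold a b.
  assert (L : (ln b < 0)%R) by (rewrite <- ln_1; apply ln_increasing; lra).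
  assert (P1 : (1 < Rpower b (- 2 / 3))%R).
  { unfold Rpower. rewrite <- exp_0. apply exp_increasing. lra. }
  assert (P2 : (Rpower b (- 2 / 3) < / b)%R).
  { rewrite <- (exp_ln (/ b)) by (apply Rinv_0_lt_compat; lra). rewrite ln_Rinv by lra. apply exp_increasing. lra. }
  split; [nra|].
  assert (IB : (/ b < 1 + 2 * e')%R).
  { apply Rmult_lt_reg_r with b; [lra|]. rewrite Rinv_l by lra. nra. }
  nra.
Qed.

(** A monomial of weight m is E6^(m/6) times a power of the hauptmodul; the first factor is common
    to the whole isobaric relation. *)
Lemma E4_E6_hauptmodul y a b : (0 < B6 y)%R ->
  E4 (0%R, y) ^ a * E6 (0%R, y) ^ b = RtoC (Rpower (B6 y) (INR (4 * a + 6 * b) / 6)) * RtoC (hauptmodul y) ^ a.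
Proof.
  intros HB. rewrite E4_imag, E6_imag, <- !RtoC_pow, <- !RtoC_mult. f_equal. unfold hauptmodul.
  rewrite Rpow_mult_distr, <- (Rpower_pow a (Rpower _ _)) by apply exp_pos. rewrite <- (Rpower_pow b) by auto.
  rewrite Rpower_mult.
  replace (Rpower (B6 y) (INR (4 * a + 6 * b) / 6) * (A4 y ^ a * Rpower (B6 y) (- 2 / 3 * INR a)))%R
    with (A4 y ^ a * (Rpower (B6 y) (INR (4 * a + 6 * b) / 6) * Rpower (B6 y) (- 2 / 3 * INR a)))%R by ring.
  rewrite <- Rpower_plus. f_equal. f_equal. rewrite plus_INR, !mult_INR. simpl. field.
Qed.

(* A relation between E4 and E6 may be assumed isobaric; on the imaginary axis it then becomes
   a polynomial relation for E4 / E6^(2/3), which takes infinitely many values near 1. *)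
Theorem eisenstein_independent (N : NCP) (Y : R) : normal 1 N ->
  (forall m y, (Y <= y)%R -> ev N (fun w => if Nat.eq_dec (weight w) m
     then E4 (0%R, y) ^ occ 0 w * E6 (0%R, y) ^ occ 1 w else 0) = 0) ->
  N = fun _ => 0.
Proof.
  intros HN H. funext w0. apply NNPP. intros N0.
  destruct (proj2 HN w0 N0) as (a0 & b0 & k0 & L0 & E0). replace k0 with 0%nat in E0 by lia. clear L0.
  set (m := (4 * a0 + 6 * b0)%nat).
  (* [d j] is the coefficient in N of the monomial of weight m in which E4 has exponent j; the
     weight then determines the exponent of E6. *)
  set (d := fun j => ev N (fun w => if Nat.eq_dec (weight w) m then (if Nat.eq_dec (occ 0 w) j then 1 else 0) else 0)).
  assert (D : List.Forall (fun c : C => c = 0) (map d (seq 0 (S m)))).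
  { apply (polynomial_zero (fun v => exists y, (Y <= y)%R /\ (0 < B6 y)%R /\ v = hauptmodul y)).
    - intros e He. destruct (hauptmodul_lim e He Y) as (y & A & B & C). exists (hauptmodul y). split; auto. now exists y.
    - intros v (y & Hy & HB & ->). set (v := hauptmodul y).
      replace (horner (map d (seq 0 (S m))) (RtoC v)) with (horner (map d (seq 0 (S m))) (RtoC v) * RtoC v ^ 0)
        by (simpl; ring).
      rewrite horner_seq.
      rewrite (clsum_ext _ (fun j => ev N (fun w => RtoC v ^ j * (if Nat.eq_dec (weight w) m then (if Nat.eq_dec (occ 0 w) j then 1 else 0) else 0)))).
      2: { intros j _. unfold d. rewrite ev_cmul. ring. }
      rewrite ev_clsum. specialize (H m y Hy).
      set (r := RtoC (Rpower (B6 y) (INR m / 6))).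
      assert (Nr : r <> 0).
      { intros E. apply RtoC_inj in E. pose proof (exp_pos (INR m / 6 * ln (B6 y))). unfold Rpower in E. lra. }
      (* r times the polynomial in v is the given relation of weight m, and r is not 0. *)
      apply NNPP. intros Q. apply (Cmult_neq_0 _ _ Nr Q). rewrite <- ev_cmul.
      refine (eq_trans _ H).
      apply ev_ext. intros w Hw. destruct (proj2 HN w Hw) as (a & b & k & L & E).
      destruct (Nat.eq_dec (weight w) m) as [W|W].
      + replace (weight w) with (4 * occ 0 w + 6 * occ 1 w)%nat in W by reflexivity.
        rewrite E4_E6_hauptmodul, W by auto. fold r v. f_equal.
        rewrite (clsum_ext _ (fun j => if Nat.eq_dec (occ 0 w) j then RtoC v ^ j else 0)).
        * apply clsum_indicator. apply seq_NoDup. apply in_seq. lia.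
        * intros j _. destruct (Nat.eq_dec (occ 0 w) j); ring.
      + rewrite clsum_zero. ring. intros; ring. }
  assert (E : d a0 = 0).
  { rewrite Forall_forall in D. apply D. apply in_map. apply in_seq. unfold m. lia. }
  apply N0. refine (eq_trans _ E). rewrite E0. rewrite <- (ev_indicator N (nword a0 b0 0) (proj1 HN)).
  unfold d. apply ev_ext. intros w Hw. destruct (proj2 HN w Hw) as (a & b & k & L & Ew).
  replace k with 0%nat in Ew by lia. subst w. unfold weight.
  destruct (occ_nword a b 0) as [-> ->].
  destruct (word_dec (nword a b 0) (nword a0 b0 0)) as [F|F].
  - apply nword_inj in F. destruct F as (-> & -> & _). unfold m.
    destruct (Nat.eq_dec _ _); [|congruence]. destruct (Nat.eq_dec a0 a0); congruence.
  - destruct (Nat.eq_dec (4 * a + 6 * b) m) as [G|G]; auto. destruct (Nat.eq_dec a a0) as [->|]; auto.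
    exfalso. apply F. f_equal. unfold m in G. lia.
Qed.

(** * The operator algebra R *)

Lemma isHol_ext f g : (forall z, UHP z -> f z = g z) -> isHol f -> isHol g.
Proof.
  intros E H z Hz. apply cdiff_cder. destruct (proj1 (cdiff_cder f z) (H z Hz)) as [l L].
  exists l. now apply (cder_UHP_ext f).
Qed.

Lemma isHol_const c : isHol (fun _ => c).
Proof. intros z _. apply cdiff_cder. exists 0. apply cder_const. Qed.

Lemma isHol_plus f g : isHol f -> isHol g -> isHol (fun z => f z + g z).
Proof.
  intros F G z Hz. apply cdiff_cder. destruct (proj1 (cdiff_cder f z) (F z Hz)) as [l L].
  destruct (proj1 (cdiff_cder g z) (G z Hz)) as [m M]. exists (l + m). now apply cder_plus.
Qed.

Lemma isHol_mult f g : isHol f -> isHol g -> isHol (fun z => f z * g z).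
Proof.
  intros F G z Hz. apply cdiff_cder. destruct (proj1 (cdiff_cder f z) (F z Hz)) as [l L].
  destruct (proj1 (cdiff_cder g z) (G z Hz)) as [m M]. eexists. exact (cder_mult _ _ _ _ _ L M).
Qed.

Lemma isHol_dq f : isHol f -> isHol (dq f).
Proof. intros H. apply isHol_mult. apply isHol_const. now apply hol_derivative. Qed.

Lemma isHol_Dk k f : isHol f -> isHol (Dk k f).
Proof.
  intros H. apply (isHol_ext (fun z => dq f z + - RtoC (k / 12) * (E2 z * f z))).
  - intros z _. unfold Dk. ring.
  - apply isHol_plus. now apply isHol_dq. apply isHol_mult. apply isHol_const. apply isHol_mult; auto. apply isHol_E2.
Qed.

Lemma dq_ext f g z : isHol f -> (forall z, UHP z -> f z = g z) -> UHP z -> dq f z = dq g z.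
Proof. intros F E Hz. unfold dq. f_equal. now apply cderiv_UHP_ext. Qed.

Lemma dq_const c z : dq (fun _ => c) z = 0.
Proof. unfold dq. rewrite (cder_cderiv _ _ _ (cder_const c z)). ring. Qed.

Lemma dq_plus f g z : isHol f -> isHol g -> UHP z -> dq (fun z => f z + g z) z = dq f z + dq g z.
Proof.
  intros F G Hz. destruct (proj1 (cdiff_cder f z) (F z Hz)) as [l L].
  destruct (proj1 (cdiff_cder g z) (G z Hz)) as [m M]. unfold dq.
  rewrite (cder_cderiv _ _ _ (cder_plus _ _ _ _ _ L M)), (cder_cderiv _ _ _ L), (cder_cderiv _ _ _ M). ring.
Qed.

Lemma dq_mult f g z : isHol f -> isHol g -> UHP z -> dq (fun z => f z * g z) z = dq f z * g z + f z * dq g z.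
Proof.
  intros F G Hz. destruct (proj1 (cdiff_cder f z) (F z Hz)) as [l L].
  destruct (proj1 (cdiff_cder g z) (G z Hz)) as [m M]. unfold dq.
  rewrite (cder_cderiv _ _ _ (cder_mult _ _ _ _ _ L M)), (cder_cderiv _ _ _ L), (cder_cderiv _ _ _ M). ring.
Qed.

Lemma dq_scale c f z : isHol f -> UHP z -> dq (fun z => c * f z) z = c * dq f z.
Proof.
  intros F Hz. rewrite dq_mult, dq_const by auto using isHol_const. ring.
Qed.

Lemma Dk_ext k f g z : isHol f -> (forall z, UHP z -> f z = g z) -> UHP z -> Dk k f z = Dk k g z.
Proof. intros F E Hz. unfold Dk. rewrite (dq_ext f g), (E z); auto. Qed.

Lemma Heq_refl h : Heq h h.
Proof. intros n z _. reflexivity. Qed.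
Lemma Heq_sym h h' : Heq h h' -> Heq h' h.
Proof. intros H n z Hz. symmetry. now apply H. Qed.
Lemma Heq_trans h h' h'' : Heq h h' -> Heq h' h'' -> Heq h h''.
Proof. intros H H' n z Hz. rewrite H, H'; auto. Qed.

Lemma Heq_add h h' k k' : Heq h h' -> Heq k k' -> Heq (Hadd h k) (Hadd h' k').
Proof. intros H H' n z Hz. unfold Hadd. rewrite H, H'; auto. Qed.
Lemma Heq_scale c h h' : Heq h h' -> Heq (Hscale c h) (Hscale c h').
Proof. intros H n z Hz. unfold Hscale. rewrite H; auto. Qed.

Lemma isH_ext h h' : Heq h h' -> isH h -> isH h'.
Proof.
  intros E [A [s B]]. split.
  - intros n. apply (isHol_ext (h n)); auto.
  - exists s. intros n Hn z Hz. rewrite <- E; auto.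
Qed.

Lemma isH_zero : isH Hzero.
Proof. split. intros n. apply isHol_const. exists nil. intros; reflexivity. Qed.

Lemma isH_add h h' : isH h -> isH h' -> isH (Hadd h h').
Proof.
  intros [A [s B]] [A' [s' B']]. split.
  - intros n. now apply isHol_plus.
  - exists (s ++ s'). intros n Hn z Hz. unfold Hadd. rewrite B, B'; auto; try ring; intros K; apply Hn, in_or_app; auto.
Qed.

Lemma isH_scale c h : isH h -> isH (Hscale c h).
Proof.
  intros [A [s B]]. split.
  - intros n. apply isHol_mult; auto. apply isHol_const.
  - exists s. intros n Hn z Hz. unfold Hscale. rewrite B; auto. ring.
Qed.

Lemma isH_delta h : isH h -> isH (delta h).
Proof.
  intros [A [s B]]. split.
  - intros n. now apply isHol_Dk.
  - exists (map (fun n => n + 2)%R s). intros n Hn z Hz. unfold delta.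
    rewrite (Dk_ext _ _ (fun _ => 0)); auto.
    + unfold Dk. rewrite dq_const. ring.
    + intros w Hw. apply B; auto. intros K. apply Hn. apply in_map_iff. exists (n - 2)%R. split; auto. ring.
Qed.

Lemma isH_shift_mult g k h : isHol g -> isH h -> isH (fun m z => g z * h (m - k)%R z).
Proof.
  intros G [A [s B]]. split.
  - intros n. now apply isHol_mult.
  - exists (map (fun n => n + k)%R s). intros n Hn z Hz.
    rewrite B; auto. ring. intros K. apply Hn. apply in_map_iff. exists (n - k)%R. split; auto. ring.
Qed.

(** [opeq] tests operators on elements of H only, and [Heq] looks only at the upper half plane.
    These four properties are what makes composition compatible with both equalities. *)
Record good (P : RawOp) : Prop := {
  good_isH : forall h, isH h -> isH (P h);
  good_ext : forall h h', isH h -> Heq h h' -> Heq (P h) (P h');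
  good_add : forall h h', isH h -> isH h' -> Heq (P (Hadd h h')) (Hadd (P h) (P h'));
  good_scale : forall c h, isH h -> Heq (P (Hscale c h)) (Hscale c (P h)) }.

Lemma good_inR P : inR P -> good P.
Proof.
  induction 1 as [c| | | |P Q _ [P1 P2 P3 P4] _ [Q1 Q2 Q3 Q4]|P Q _ [P1 P2 P3 P4] _ [Q1 Q2 Q3 Q4]].
  - split.
    + intros. now apply isH_scale.
    + intros h h' _ E. now apply Heq_scale.
    + intros h h' _ _ n z Hz. unfold opscale, opid, Hscale, Hadd. ring.
    + intros c' h _ n z Hz. unfold opscale, opid, Hscale. ring.
  - split.
    + apply isH_delta.
    + intros h h' [A _] E n z Hz. apply Dk_ext; auto.
    + intros h h' [A _] [A' _] n z Hz. unfold delta, Hadd, Dk. rewrite dq_plus by auto. ring.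
    + intros c h [A _] n z Hz. unfold delta, Hscale, Dk. rewrite dq_scale by auto. ring.
  - split.
    + intros h. apply isH_shift_mult, isHol_E4.
    + intros h h' _ E n z Hz. unfold e4. now rewrite E.
    + intros h h' _ _ n z Hz. unfold e4, Hadd. ring.
    + intros c h _ n z Hz. unfold e4, Hscale. ring.
  - split.
    + intros h. apply isH_shift_mult, isHol_E6.
    + intros h h' _ E n z Hz. unfold e6. now rewrite E.
    + intros h h' _ _ n z Hz. unfold e6, Hadd. ring.
    + intros c h _ n z Hz. unfold e6, Hscale. ring.
  - split.
    + intros h Hh. apply isH_add; auto.
    + intros h h' Hh E. apply Heq_add; auto.
    + intros h h' Hh Hh' n z Hz.
      change (P (Hadd h h') n z + Q (Hadd h h') n z = (P h n z + Q h n z) + (P h' n z + Q h' n z)).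
      rewrite (P3 h h' Hh Hh' n z Hz), (Q3 h h' Hh Hh' n z Hz). unfold Hadd. ring.
    + intros c h Hh n z Hz.
      change (P (Hscale c h) n z + Q (Hscale c h) n z = c * (P h n z + Q h n z)).
      rewrite (P4 c h Hh n z Hz), (Q4 c h Hh n z Hz). unfold Hscale. ring.
  - split.
    + intros h Hh. apply P1, Q1, Hh.
    + intros h h' Hh E. apply P2; auto.
    + intros h h' Hh Hh'. eapply Heq_trans; [apply P2; [|apply Q3]|apply P3]; auto. apply Q1, isH_add; auto.
    + intros c h Hh. eapply Heq_trans; [apply P2; [|apply Q4]|apply P4]; auto. apply Q1, isH_scale; auto.
Qed.

Lemma good_zero P h : good P -> Heq h Hzero -> Heq (P h) Hzero.
Proof.
  intros G E. assert (Hh : isH h) by (apply (isH_ext Hzero); [now apply Heq_sym|apply isH_zero]).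
  apply Heq_trans with (P (Hscale 0 h)).
  - apply (good_ext P G); auto. eapply Heq_trans; [exact E|]. intros n z Hz. unfold Hscale, Hzero. ring.
  - eapply Heq_trans; [apply (good_scale P G); auto|]. intros n z Hz. unfold Hscale, Hzero. ring.
Qed.

(** * The algebra map from T(V) onto R *)

Definition opletter (i : nat) : RawOp := match i with O => e4 | 1%nat => e6 | _ => delta end.

Fixpoint opword (w : list nat) : RawOp := match w with [] => opid | i :: w => opcomp (opletter i) (opword w) end.

Lemma opid_scale : opid = opscale 1 opid.
Proof.
  funext h. do 2 (apply functional_extensionality; intro). unfold opid, opscale, Hscale. ring.
Qed.

Lemma inR_opword w : inR (opword w).
Proof.
  induction w as [|i w IH]; simpl.
  - rewrite opid_scale. constructor.
  - constructor; auto. destruct i as [|[|i]]; constructor.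
Qed.

Lemma opword_app u v h : opword (u ++ v) h = opword u (opword v h).
Proof. induction u as [|i u IH]; simpl; auto. unfold opcomp. now rewrite IH. Qed.

Definition phi (p : NCP) : RawOp := fun h n z => ev p (fun w => opword w h n z).

Lemma inR_phi p : inR (phi p).
Proof.
  unfold phi, ev. generalize (supp p) as s. intros s.
  induction s as [|w s IH].
  - replace (fun h n z => clsum (fun w => p w * opword w h n z) []) with (opscale 0 opid). constructor.
    funext h. do 2 (apply functional_extensionality; intro).
    unfold opscale, Hscale, clsum. simpl. ring.
  - change (inR (opadd (opcomp (opscale (p w) opid) (opword w)) (fun h n z => clsum (fun w => p w * opword w h n z) s))).
    constructor; auto. constructor. constructor. apply inR_opword.
Qed.

Lemma phi_add p q h : isNCP p -> isNCP q -> phi (ncadd p q) h = Hadd (phi p h) (phi q h).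
Proof.
  intros P Q. do 2 (apply functional_extensionality; intro). unfold phi. now rewrite ev_add.
Qed.

Lemma phi_scale c p h : isNCP p -> phi (ncscale c p) h = Hscale c (phi p h).
Proof.
  intros P. do 2 (apply functional_extensionality; intro). unfold phi. now rewrite ev_scale.
Qed.

Lemma phi_word w : phi (ncword w) = opword w.
Proof. do 3 (apply functional_extensionality; intro). unfold phi. now rewrite ev_word. Qed.

Lemma phi_zero h : phi (fun _ => 0) h = Hzero.
Proof. do 2 (apply functional_extensionality; intro). unfold phi. now rewrite ev_zero. Qed.

Lemma good_phi P q h : good P -> isNCP q -> isH h ->
  Heq (P (phi q h)) (fun n z => ev q (fun v => P (opword v h) n z)).
Proof.
  intros G Q Hh. revert q Q. apply isNCP_ind.
  - rewrite phi_zero. eapply Heq_trans; [apply good_zero; auto; apply Heq_refl|].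
    intros n z Hz. now rewrite ev_zero.
  - intros c w q Hw Q IH. rewrite phi_add, phi_scale, phi_word by auto with ncp.
    pose proof (good_isH _ (good_inR _ (inR_opword w)) h Hh) as Hwh.
    pose proof (good_isH _ (good_inR _ (inR_phi q)) h Hh) as Hq.
    intros n z Hz. rewrite (good_add P G); auto using isH_scale. unfold Hadd. rewrite (good_scale P G) by auto.
    rewrite (IH n z Hz), ev_add, ev_scale, ev_word by auto with ncp. reflexivity.
Qed.

(** The equality is stated on elements of H, because moving the words of p inside the sum over the
    words of q uses linearity of [delta], which is available for holomorphic components. *)
Lemma phi_mul p q : isNCP p -> isNCP q -> opeq (phi (ncmul p q)) (opcomp (phi p) (phi q)).
Proof.
  intros P Q h Hh n z Hz. unfold phi at 1, opcomp. rewrite ev_mul by auto. unfold phi at 1.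
  apply ev_ext. intros u _.
  rewrite (good_phi (opword u) q h) by auto using good_inR, inR_opword.
  apply ev_ext. intros v _. now rewrite opword_app.
Qed.

Lemma e4_e6_comm h : Heq (e4 (e6 h)) (e6 (e4 h)).
Proof.
  intros n z _. unfold e4, e6. replace (n - 4 - 6)%R with (n - 6 - 4)%R by ring. ring.
Qed.

(** In Ramanujan's formula the term E2 E4 / 3 cancels the change 4/12 of the coefficient of E2
    caused by the shift of weight; only -E6/3 survives. *)
Lemma delta_e4 h : isH h -> Heq (delta (e4 h)) (Hadd (e4 (delta h)) (Hscale (- RtoC (1 / 3)) (e6 h))).
Proof.
  intros [A _] n z Hz. unfold delta, e4, e6, Hadd, Hscale, Dk.
  replace (n - 2 - 4)%R with (n - 6)%R by ring. replace (n - 4 - 2)%R with (n - 6)%R by ring.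
  rewrite dq_mult, ramanujan_E4 by auto using isHol_E4.
  replace (RtoC ((n - 6) / 12)) with (RtoC ((n - 2) / 12) - RtoC (1 / 3)) by (rewrite <- RtoC_minus; f_equal; field).
  ring.
Qed.

Lemma delta_e6 h : isH h -> Heq (delta (e6 h)) (Hadd (e6 (delta h)) (Hscale (- RtoC (1 / 2)) (e4 (e4 h)))).
Proof.
  intros [A _] n z Hz. unfold delta, e4, e6, Hadd, Hscale, Dk.
  replace (n - 2 - 6)%R with (n - 8)%R by ring. replace (n - 6 - 2)%R with (n - 8)%R by ring.
  replace (n - 4 - 4)%R with (n - 8)%R by ring.
  rewrite dq_mult, ramanujan_E6 by auto using isHol_E6.
  replace (RtoC ((n - 8) / 12)) with (RtoC ((n - 2) / 12) - RtoC (1 / 2)) by (rewrite <- RtoC_minus; f_equal; field).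
  ring.
Qed.

Lemma phi_rel j : (j < 3)%nat -> opeq (phi (rel j)) opzero.
Proof.
  intros Hj h Hh n z Hz. unfold opzero, Hzero.
  destruct j as [|[|[|j]]]; [| | |lia]; unfold rel, nccomm, ncsub, ncx, ncy, ncd;
    rewrite !ncmul_word; cbn [app]; rewrite ?phi_add, ?phi_scale, !phi_word by auto with ncp;
    unfold Hadd, Hscale; simpl opword; unfold opcomp, opid; simpl opletter.
  - rewrite (e4_e6_comm h n z Hz). ring.
  - rewrite (delta_e4 h Hh n z Hz). unfold Hadd, Hscale. ring.
  - rewrite (delta_e6 h Hh n z Hz). unfold Hadd, Hscale. ring.
Qed.

Lemma phi_inI p : inI p -> opeq (phi p) opzero.
Proof.
  induction 1 as [|a b j A B Hj|p q P IHp Q IHq]; intros h Hh.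
  - rewrite phi_zero. apply Heq_refl.
  - pose proof (isNCP_rel j) as Fr.
    pose proof (good_isH _ (good_inR _ (inR_phi b)) h Hh) as Hb.
    eapply Heq_trans; [apply phi_mul; auto with ncp|]. unfold opcomp.
    eapply Heq_trans; [apply phi_mul; auto with ncp|]. unfold opcomp.
    apply good_zero. apply good_inR, inR_phi. now apply phi_rel.
  - apply inI_NCP in P, Q. rewrite phi_add by auto.
    intros n z Hz. unfold Hadd. rewrite (IHp h Hh n z Hz), (IHq h Hh n z Hz). unfold opzero, Hzero. ring.
Qed.

Lemma phi_surjective P : inR P -> exists p, isNCP p /\ opeq (phi p) P.
Proof.
  induction 1 as [c| | | |P Q _ (p & Np & Ep) _ (q & Nq & Eq)|P Q HP (p & Np & Ep) HQ (q & Nq & Eq)].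
  - exists (ncscale c ncone). split; [auto with ncp|]. intros h _.
    rewrite phi_scale by apply isNCP_one. unfold ncone. rewrite phi_word. apply Heq_refl.
  - exists ncd. split; [apply isNCP_d|]. unfold ncd. rewrite phi_word. intros h _. apply Heq_refl.
  - exists ncx. split; [apply isNCP_x|]. unfold ncx. rewrite phi_word. intros h _. apply Heq_refl.
  - exists ncy. split; [apply isNCP_y|]. unfold ncy. rewrite phi_word. intros h _. apply Heq_refl.
  - exists (ncadd p q). split; [auto with ncp|]. intros h Hh. rewrite phi_add by auto.
    apply Heq_add; auto.
  - exists (ncmul p q). split; [auto with ncp|]. intros h Hh.
    eapply Heq_trans; [apply phi_mul; auto|]. unfold opcomp.
    eapply Heq_trans; [apply Ep|].
    + apply good_isH; auto. apply good_inR, inR_phi.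
    + apply good_ext; auto. now apply good_inR. apply good_isH; auto. apply good_inR, inR_phi.
Qed.

Lemma Cpow_hol f a : isHol f -> isHol (fun z => f z ^ a).
Proof.
  intros H. induction a as [|a IH].
  - apply (isHol_ext (fun _ => 1)); [reflexivity|apply isHol_const].
  - apply (isHol_ext (fun z => f z * f z ^ a)); [reflexivity|]. now apply isHol_mult.
Qed.

Lemma isH_single (f : C -> C) (k : R) : isHol f -> isH (fun n z => if Req_EM_T n k then f z else 0).
Proof.
  intros F. split.
  - intros n. destruct (Req_EM_T n k); auto. apply isHol_const.
  - exists [k]. intros n Hn z _. destruct (Req_EM_T n k); auto. exfalso. apply Hn. now left.
Qed.

(** Normal words carry d at the right end, so those that contain d lie in the left ideal generated
    by d. *)
Lemma split_right_d n N : normal n N -> exists N0 N1, normal 1 N0 /\ isNCP N1 /\ N = ncadd N0 (ncmul N1 ncd).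
Proof.
  revert N. apply normal_ind.
  - exists (fun _ => 0), (fun _ => 0). split; [apply normal_zero|]. split; [apply isNCP_zero|]. rewrite ncmul_zero_l. nc_lin.
  - intros c a b k p L Hp (N0 & N1 & H0 & H1 & ->). destruct k as [|k].
    + exists (ncadd (ncscale c (ncword (nword a b 0))) N0), N1. split; [|split; auto; nc_lin].
      apply normal_add; auto. apply normal_scale, normal_word. lia.
    + exists N0, (ncadd (ncscale c (ncword (nword a b k))) N1). split; auto. split.
      { apply isNCP_add; auto. apply isNCP_scale, isNCP_word, wf_nword. }
      rewrite ncmul_add_l, ncmul_scale_l. unfold ncd at 2. rewrite ncmul_word.
      replace (nword a b k ++ [2%nat]) with (nword a b (S k)). nc_lin.
      unfold nword. rewrite <- !app_assoc. do 2 f_equal. clear. induction k; simpl in *; congruence.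
Qed.

Lemma split_delta P : inR P -> exists N0 N1, normal 1 N0 /\ isNCP N1 /\ opeq P (opadd (phi N0) (opcomp (phi N1) delta)).
Proof.
  intros HP. destruct (phi_surjective P HP) as (p & Np & Ep). destruct (normal_form p Np) as (n & N & HN & EN).
  destruct (split_right_d n N HN) as (N0 & N1 & H0 & H1 & EqN). exists N0, N1. do 2 (split; [assumption|]).
  pose proof (proj1 H0) as K0. pose proof (proj1 HN) as KN.
  intros h Hh. eapply Heq_trans; [apply Heq_sym, Ep, Hh|].
  replace p with (ncadd (ncsub p N) N) by nc_lin. rewrite phi_add by auto with ncp.
  intros i z Hz. unfold Hadd at 1. rewrite (phi_inI _ EN h Hh i z Hz), EqN.
  rewrite phi_add by auto with ncp. unfold opadd, Hadd.
  rewrite (phi_mul N1 ncd) by auto with ncp. unfold opcomp at 1, ncd. rewrite phi_word.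
  unfold opzero, Hzero. change (opword [2%nat] h) with (delta h). unfold opcomp. ring.
Qed.

(** * The cyclic module generated by a form g of weight k with D_k g = 0 *)

Section Cyclic.
Variable k : nat.
Variable g : C -> C.
Hypothesis g_hol : isHol g.
Hypothesis g_delta : forall z, UHP z -> Dk (INR k) g z = 0.
Hypothesis g_imag : exists Y, forall y, (Y <= y)%R -> g (0%R, y) <> 0.

(** The basis g E4^a E6^b, placed in degree k + 4a + 6b. The cases k = 0, g = 1 and k = 12, g =
    Delta give M and S. *)
Definition mono (a b : nat) : RawH :=
  fun n z => if Req_EM_T n (INR (k + (4 * a + 6 * b))) then g z * (E4 z ^ a * E6 z ^ b) else 0.

Lemma isH_mono a b : isH (mono a b).
Proof.
  apply isH_single. apply isHol_mult; [exact g_hol|]. apply isHol_mult; apply Cpow_hol; [apply isHol_E4|apply isHol_E6].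
Qed.

Lemma mono_e4 a b : Heq (e4 (mono a b)) (mono (S a) b).
Proof.
  intros n z _. unfold e4, mono. replace (k + (4 * S a + 6 * b))%nat with (4 + (k + (4 * a + 6 * b)))%nat by lia.
  rewrite (plus_INR 4), (INR_IZR_INZ 4). simpl (IZR (Z.of_nat 4)).
  destruct (Req_EM_T _ _), (Req_EM_T _ _); try lra; rewrite ?Cpow_S; ring.
Qed.

Lemma mono_e6 a b : Heq (e6 (mono a b)) (mono a (S b)).
Proof.
  intros n z _. unfold e6, mono. replace (k + (4 * a + 6 * S b))%nat with (6 + (k + (4 * a + 6 * b)))%nat by lia.
  rewrite (plus_INR 6), (INR_IZR_INZ 6). simpl (IZR (Z.of_nat 6)).
  destruct (Req_EM_T _ _), (Req_EM_T _ _); try lra; rewrite ?Cpow_S; ring.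
Qed.

Lemma mono_delta : Heq (delta (mono 0 0)) Hzero.
Proof.
  intros n z Hz. unfold delta, Hzero. pose proof (proj1 (isH_mono 0 0) (n - 2)%R) as Hm. unfold mono in *.
  rewrite Nat.add_0_r in *. destruct (Req_EM_T (n - 2) (INR k)) as [E|E].
  - rewrite (Dk_ext _ _ g), E by (auto; intros; simpl; ring). auto.
  - unfold Dk. rewrite dq_const. ring.
Qed.

Definition span (h : RawH) : Prop :=
  exists l : list (C * nat * nat), Heq h (Rsum (map (fun t => let '(c, a, b) := t in Hscale c (mono a b)) l)).

Lemma opword_mono a b : Heq (opword (nword a b 0) (mono 0 0)) (mono a b).
Proof.
  induction a as [|a IH].
  - induction b as [|b IH]. apply Heq_refl.
    change (opword (nword 0 (S b) 0)) with (opcomp e6 (opword (nword 0 b 0))). unfold opcomp.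
    eapply Heq_trans; [|apply mono_e6]. apply good_ext; auto. apply good_inR; constructor.
    apply good_isH; [apply good_inR, inR_opword|apply isH_mono].
  - change (opword (nword (S a) b 0)) with (opcomp e4 (opword (nword a b 0))). unfold opcomp.
    eapply Heq_trans; [|apply mono_e4]. apply good_ext; auto. apply good_inR; constructor.
    apply good_isH; [apply good_inR, inR_opword|apply isH_mono].
Qed.

Lemma span_phi N : normal 1 N -> span (phi N (mono 0 0)).
Proof.
  revert N. apply normal_ind.
  - exists nil. rewrite phi_zero. apply Heq_refl.
  - intros c a b j p L Hp [l E]. replace j with 0%nat by lia. exists ((c, a, b) :: l).
    rewrite phi_add, phi_scale, phi_word by (auto using wf_nword with ncp; apply Hp).
    apply Heq_add; [|exact E]. apply Heq_scale, opword_mono.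
Qed.

Lemma span_generated m : span m -> exists P, inR P /\ Heq (P (mono 0 0)) m.
Proof.
  intros [l E]. cut (exists P, inR P /\ Heq (P (mono 0 0)) (Rsum (map (fun t => let '(c, a, b) := t in Hscale c (mono a b)) l))).
  { intros (P & HP & EP). exists P. split; auto. eapply Heq_trans; [exact EP|now apply Heq_sym]. }
  clear E m. induction l as [|[[c a] b] l (P & HP & IH)].
  - exists (opscale 0 opid). split; [constructor|]. intros n z Hz. unfold opscale, Hscale. simpl. unfold Hzero. ring.
  - exists (opadd (opcomp (opscale c opid) (opword (nword a b 0))) P). split.
    + constructor; auto. constructor. constructor. apply inR_opword.
    + simpl. apply Heq_add; auto. apply Heq_scale, opword_mono.
Qed.

(** The component of degree k + m is g times the part of weight m of N(E4, E6). Far up the imaginary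
    axis g does not vanish and can be cancelled, so [eisenstein_independent] applies. *)
Lemma polynomial_faithful N : normal 1 N -> Heq (phi N (mono 0 0)) Hzero -> N = fun _ => 0.
Proof.
  intros HN E. destruct g_imag as [Y HY]. apply (eisenstein_independent N (Rmax Y 1) HN).
  intros m y Hy. pose proof (HY y (Rle_trans _ _ _ (Rmax_l _ _) Hy)) as Ng.
  assert (U : UHP (0%R, y)) by (pose proof (Rmax_r Y 1); unfold UHP; simpl; lra).
  specialize (E (INR (k + m)) (0%R, y) U). unfold phi, Hzero in E.
  apply NNPP. intros Q. apply (Cmult_neq_0 _ _ Ng Q). refine (eq_trans _ E). rewrite <- ev_cmul.
  apply ev_ext. intros w Hw. destruct (proj2 HN w Hw) as (a & b & j & L & ->). replace j with 0%nat by lia.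
  rewrite (opword_mono a b _ _ U). unfold mono, weight. destruct (occ_nword a b 0) as [-> ->].
  destruct (Nat.eq_dec _ _) as [F|F], (Req_EM_T _ _) as [G|G]; try ring.
  - rewrite F in G. easy.
  - apply INR_eq in G. lia.
Qed.

Lemma apply_generator P N0 N1 : opeq P (opadd (phi N0) (opcomp (phi N1) delta)) ->
  Heq (P (mono 0 0)) (phi N0 (mono 0 0)).
Proof.
  intros E. eapply Heq_trans; [exact (E _ (isH_mono 0 0))|]. intros i z Hz. unfold opadd, Hadd, opcomp.
  rewrite (good_zero (phi N1) _ (good_inR _ (inR_phi N1)) mono_delta i z Hz). unfold Hzero. ring.
Qed.

Lemma span_inR P : inR P -> span (P (mono 0 0)).
Proof.
  intros HP. destruct (split_delta P HP) as (N0 & N1 & H0 & _ & E). destruct (span_phi N0 H0) as [l L].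
  exists l. eapply Heq_trans; [exact (apply_generator P N0 N1 E)|exact L].
Qed.

(** P u depends only on the polynomial part N0, because delta kills the generator u; if P u = 0 then
    N0 = 0 and only a left multiple of delta is left. *)
Lemma annihilator P : inR P ->
  (Heq (P (mono 0 0)) Hzero <-> exists Q, inR Q /\ opeq P (opcomp Q delta)).
Proof.
  intros HP. split.
  - intros Z. destruct (split_delta P HP) as (N0 & N1 & H0 & H1 & E). exists (phi N1). split; [apply inR_phi|].
    intros h Hh. eapply Heq_trans; [exact (E h Hh)|].
    rewrite (polynomial_faithful N0 H0).
    + intros i z Hz. unfold opadd, Hadd. rewrite phi_zero. unfold Hzero. ring.
    + eapply Heq_trans; [|exact Z]. apply Heq_sym. exact (apply_generator P N0 N1 E).
  - intros (Q & HQ & E). eapply Heq_trans; [apply E, isH_mono|]. exact (good_zero Q _ (good_inR Q HQ) mono_delta).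
Qed.

Lemma cyclic_module : exists psi : RawOp -> RawH,
  (forall P, inR P -> span (psi P)) /\
  (forall P Q, inR P -> inR Q -> opeq P Q -> Heq (psi P) (psi Q)) /\
  (forall P Q, inR P -> inR Q -> Heq (psi (opadd P Q)) (Hadd (psi P) (psi Q))) /\
  (forall P Q, inR P -> inR Q -> Heq (psi (opcomp P Q)) (P (psi Q))) /\
  (forall m, span m -> exists P, inR P /\ Heq (psi P) m) /\
  (forall P, inR P -> (Heq (psi P) Hzero <-> exists Q, inR Q /\ opeq P (opcomp Q delta))).
Proof.
  exists (fun P => P (mono 0 0)). split; [|split; [|split; [|split; [|split]]]].
  - exact span_inR.
  - intros P Q _ _ E. exact (E _ (isH_mono 0 0)).
  - intros P Q _ _. apply Heq_refl.
  - intros P Q _ _. apply Heq_refl.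
  - exact span_generated.
  - exact annihilator.
Qed.
End Cyclic.

(** * The modules M and S, and the Weyl algebra *)

Lemma isHol_Delta : isHol Defs.Delta.
Proof.
  apply (isHol_ext (fun z => RtoC (1 / 1728) * (E4 z * E4 z * E4 z + - (1) * (E6 z * E6 z)))).
  - intros z _. unfold Defs.Delta. ring.
  - pose proof (isHol_mult _ _ isHol_E4 isHol_E4) as H4. pose proof (isHol_mult _ _ isHol_E6 isHol_E6) as H6.
    exact (isHol_mult _ _ (isHol_const _) (isHol_plus _ _ (isHol_mult _ _ H4 isHol_E4) (isHol_mult _ _ (isHol_const _) H6))).
Qed.

Lemma dq_Delta z : UHP z -> dq Defs.Delta z = E2 z * Defs.Delta z.
Proof.
  intros Hz.
  pose proof (isHol_mult _ _ isHol_E4 isHol_E4) as H44. pose proof (isHol_mult _ _ isHol_E6 isHol_E6) as H66.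
  pose proof (isHol_mult _ _ H44 isHol_E4) as H444. pose proof (isHol_mult _ _ (isHol_const (- (1))) H66) as H66'.
  rewrite (dq_ext Defs.Delta (fun z => RtoC (1 / 1728) * ((E4 z * E4 z) * E4 z + - (1) * (E6 z * E6 z))) z isHol_Delta); auto.
  - rewrite (dq_scale _ _ _ (isHol_plus _ _ H444 H66') Hz), (dq_plus _ _ _ H444 H66' Hz), (dq_scale _ _ _ H66 Hz),
      (dq_mult _ _ _ H44 isHol_E4 Hz), (dq_mult _ _ _ isHol_E4 isHol_E4 Hz), (dq_mult _ _ _ isHol_E6 isHol_E6 Hz),
      (ramanujan_E4 z Hz), (ramanujan_E6 z Hz).
    unfold Defs.Delta.
    (* For [ring] the constants 1/3 and 1/2 are opaque; T and U are the only facts about them that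
       the computation needs. *)
    assert (T : RtoC (1 / 3) * 3 = 1) by (rewrite <- RtoC_mult; f_equal; field).
    assert (U : RtoC (1 / 2) * 2 = 1) by (rewrite <- RtoC_mult; f_equal; field).
    generalize dependent (RtoC (1 / 3)). generalize dependent (RtoC (1 / 2)). intros u U t T.
    set (k := RtoC (1 / 1728)). set (a := E4 z). set (b := E6 z). set (e := E2 z).
    transitivity (k * ((t * 3) * (e * a - b) * a * a - (u * 2) * b * (e * b - a * a))); [ring|].
    rewrite T, U. ring.
  - intros w _. unfold Defs.Delta. ring.
Qed.

Lemma Delta_imag : exists Y, forall y, (Y <= y)%R -> Defs.Delta (0%R, y) <> 0.
Proof.
  destruct (A4_B6_lim 1 Rlt_0_1) as (Y & HY & H). exists Y. intros y Hy. specialize (H y Hy).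
  unfold Defs.Delta. rewrite E4_imag, E6_imag, <- !RtoC_mult, <- RtoC_minus, <- RtoC_mult.
  intros E. apply RtoC_inj in E.
  assert (1 < A4 y * A4 y)%R by nra. assert (1 < A4 y * A4 y * A4 y)%R by nra. assert (B6 y * B6 y < 1)%R by nra. lra.
Qed.

Lemma Dk_Delta z : UHP z -> Dk (INR 12) Defs.Delta z = 0.
Proof.
  intros Hz. unfold Dk. rewrite dq_Delta by auto.
  replace (INR 12 / 12)%R with 1%R by (simpl; field). ring.
Qed.

Lemma Dk_one z : UHP z -> Dk (INR 0) (fun _ => 1) z = 0.
Proof.
  intros _. unfold Dk. rewrite dq_const. replace (INR 0 / 12)%R with 0%R by (simpl; field). ring.
Qed.

Lemma one_imag : exists Y : R, forall y, (Y <= y)%R -> (fun _ : C => RtoC 1) (0%R, y) <> 0.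
Proof. exists 0%R. intros y _ E. apply RtoC_inj in E. lra. Qed.

Lemma monoM_mono : monoM = mono 0 (fun _ => 1).
Proof.
  do 4 (apply functional_extensionality; intro). unfold monoM, mono. simpl plus. destruct (Req_EM_T _ _); ring.
Qed.

Lemma monoS_mono : monoS = mono 12 Defs.Delta.
Proof. reflexivity. Qed.

(** The kernel meets C[x,y] in 0: a polynomial that acts as zero kills in particular the constant 1
    in degree 0, and [polynomial_faithful] applies. *)
Lemma phi_kernel p : isNCP p -> opeq (phi p) opzero -> inI p.
Proof.
  intros Hp E. apply (ideal_eq_I (fun p => isNCP p /\ opeq (phi p) opzero)); auto.
  - intros q Hq. split. now apply inI_NCP. now apply phi_inI.
  - intros q r [Nq Eq] [Nr Er]. split; [auto with ncp|]. intros h Hh.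
    unfold ncsub. rewrite phi_add, phi_scale by auto with ncp.
    intros n z Hz. unfold Hadd, Hscale. rewrite (Eq h Hh n z Hz), (Er h Hh n z Hz). unfold opzero, Hzero. ring.
  - intros a q Na Nq [_ Eq]. split; [auto with ncp|]. intros h Hh.
    eapply Heq_trans; [apply phi_mul; auto|]. unfold opcomp.
    exact (good_zero (phi a) _ (good_inR _ (inR_phi a)) (Eq h Hh)).
  - intros a q Na Nq [_ Eq]. split; [auto with ncp|]. intros h Hh.
    eapply Heq_trans; [apply phi_mul; auto|]. unfold opcomp.
    exact (Eq _ (good_isH _ (good_inR _ (inR_phi a)) h Hh)).
  - intros N HN [_ EN].
    apply (polynomial_faithful 0 (fun _ => 1) (isHol_const 1) one_imag); auto.
    exact (EN _ (isH_mono 0 (fun _ => 1) (isHol_const 1) 0 0)).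
Qed.

(** * The representation of T(V)/I in the Weyl algebra *)

Definition Wd : WOp := Wadd (Wscale (- RtoC (1 / 3)) (Wcomp Wy Wdx)) (Wscale (- RtoC (1 / 2)) (Wcomp Wx (Wcomp Wx Wdy))).

Definition Wletter (i : nat) : WOp := match i with O => Wx | 1%nat => Wy | _ => Wd end.

Fixpoint Wword (w : list nat) : WOp := match w with [] => Wid | i :: w => Wcomp (Wletter i) (Wword w) end.

Definition wev (p : NCP) : WOp := fun f i j => ev p (fun w => Wword w f i j).

Definition PSzero : PS := fun _ _ => 0.
Definition PSadd (f g : PS) : PS := fun i j => f i j + g i j.
Definition PSscale (c : C) (f : PS) : PS := fun i j => c * f i j.

Ltac ps_ext := do 2 (apply functional_extensionality; intro).

(** Weyl operators are linear on all coefficient arrays, so on this side the identities are plain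
    equalities of functions, without a counterpart of [opeq]. *)
Record linear (P : WOp) : Prop := {
  lin_add : forall f g, P (PSadd f g) = PSadd (P f) (P g);
  lin_scale : forall c f, P (PSscale c f) = PSscale c (P f) }.

Lemma linear_A2 P : inA2 P -> linear P.
Proof.
  induction 1 as [c| | | | |P Q _ [P1 P2] _ [Q1 Q2]|P Q _ [P1 P2] _ [Q1 Q2]]; split; intros;
    try (unfold Wcomp; rewrite ?Q1, ?Q2, ?P1, ?P2; reflexivity);
    try (ps_ext; unfold Wadd; rewrite ?P1, ?P2, ?Q1, ?Q2; unfold PSadd, PSscale; ring);
    ps_ext; unfold Wx, Wy, Wdx, Wdy, Wscale, Wid, PSadd, PSscale; try ring.
  all: try (destruct x; ring). all: destruct x0; ring.
Qed.

Lemma inA2_Wscale c P : inA2 P -> inA2 (Wscale c P).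
Proof. intros H. change (inA2 (Wcomp (Wscale c Wid) P)). constructor; auto. constructor. Qed.

Lemma inA2_Wd : inA2 Wd.
Proof. unfold Wd. repeat (constructor || apply inA2_Wscale). Qed.

Lemma Wid_scale : Wid = Wscale 1 Wid.
Proof. funext f. ps_ext. unfold Wid, Wscale. ring. Qed.

Lemma inA2_Wword w : inA2 (Wword w).
Proof.
  induction w as [|i w IH]; simpl.
  - rewrite Wid_scale. constructor.
  - constructor; auto. destruct i as [|[|i]]; [constructor|constructor|apply inA2_Wd].
Qed.

Lemma inA2_wev p : inA2 (wev p).
Proof.
  unfold wev, ev. generalize (supp p) as s. intros s. induction s as [|w s IH].
  - replace (fun f i j => clsum (fun w => p w * Wword w f i j) []) with (Wscale 0 Wid). constructor.
    funext f. ps_ext. unfold Wscale, clsum. simpl. ring.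
  - change (inA2 (Wadd (Wscale (p w) (Wword w)) (fun f i j => clsum (fun w => p w * Wword w f i j) s))).
    constructor; auto. apply inA2_Wscale, inA2_Wword.
Qed.

Lemma Wword_app u v f : Wword (u ++ v) f = Wword u (Wword v f).
Proof. induction u as [|i u IH]; simpl; auto. unfold Wcomp. now rewrite IH. Qed.

Lemma wev_add p q f : isNCP p -> isNCP q -> wev (ncadd p q) f = PSadd (wev p f) (wev q f).
Proof. intros P Q. ps_ext. unfold wev. now rewrite ev_add. Qed.
Lemma wev_scale c p f : isNCP p -> wev (ncscale c p) f = PSscale c (wev p f).
Proof. intros P. ps_ext. unfold wev. now rewrite ev_scale. Qed.
Lemma wev_word w : wev (ncword w) = Wword w.
Proof. funext f. ps_ext. unfold wev. now rewrite ev_word. Qed.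
Lemma wev_zero f : wev (fun _ => 0) f = PSzero.
Proof. ps_ext. unfold wev. now rewrite ev_zero. Qed.

Lemma linear_zero P : linear P -> P PSzero = PSzero.
Proof.
  intros L. replace PSzero with (PSscale 0 PSzero) at 1 by (ps_ext; unfold PSscale, PSzero; ring).
  rewrite (lin_scale P L). ps_ext. unfold PSscale, PSzero. ring.
Qed.

Lemma wev_mul p q : isNCP p -> isNCP q -> wev (ncmul p q) = Wcomp (wev p) (wev q).
Proof.
  intros P Q. funext f.
  assert (L : forall A, linear A -> A (wev q f) = fun i j => ev q (fun v => A (Wword v f) i j)).
  { intros A LA. revert q Q. apply isNCP_ind.
    - rewrite wev_zero, linear_zero by auto. ps_ext. now rewrite ev_zero.
    - intros c w q Hw Q IH. rewrite wev_add, wev_scale, wev_word by auto with ncp.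
      rewrite (lin_add A LA), (lin_scale A LA), IH. ps_ext. unfold PSadd, PSscale.
      rewrite ev_add, ev_scale, ev_word by auto with ncp. reflexivity. }
  ps_ext. unfold Wcomp. unfold wev at 1. rewrite ev_mul by auto. unfold wev at 1. apply ev_ext. intros u _.
  rewrite L by apply linear_A2, inA2_Wword. apply ev_ext. intros v _. now rewrite Wword_app.
Qed.

Lemma wev_rel j : (j < 3)%nat -> forall f, wev (rel j) f = PSzero.
Proof.
  intros Hj f. ps_ext. rename x into i, x0 into k. unfold PSzero.
  destruct j as [|[|[|j]]]; [| | |lia]; unfold rel, nccomm, ncsub, ncx, ncy, ncd;
    rewrite !ncmul_word; cbn [app]; rewrite ?wev_add, ?wev_scale, !wev_word by auto with ncp;
    unfold PSadd, PSscale, Wword, Wletter, Wcomp, Wid, Wd, Wadd, Wscale, Wcomp, Wx, Wy, Wdx, Wdy.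
  - destruct i, k; ring.
  (* Small indices are separated because multiplication by x or y shifts the array and fills in
     0. *)
  - destruct i as [|[|[|i]]], k as [|[|k]]; cbv iota beta; rewrite ?S_INR, ?RtoC_plus; simpl (INR 0); ring.
  - destruct i as [|[|[|i]]], k as [|[|k]]; cbv iota beta; rewrite ?S_INR, ?RtoC_plus; simpl (INR 0); ring.
Qed.

Lemma wev_inI p : inI p -> forall f, wev p f = PSzero.
Proof.
  induction 1 as [|a b j A B Hj|p q P IHp Q IHq]; intros f.
  - apply wev_zero.
  - pose proof (isNCP_rel j) as Fr. rewrite !wev_mul by auto with ncp. unfold Wcomp. rewrite wev_rel by auto.
    apply linear_zero, linear_A2, inA2_wev.
  - apply inI_NCP in P, Q. rewrite wev_add, IHp, IHq by auto. ps_ext. unfold PSadd, PSzero. ring.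
Qed.

(** The test vector for faithfulness on C[x,y]: a polynomial in x and y applied to 1 returns its own
    coefficients. *)
Definition PSone : PS := fun i j => match i, j with O, O => 1 | _, _ => 0 end.

Lemma Wword_one a b i j : Wword (nword a b 0) PSone i j = if word_dec (nword a b 0) (nword i j 0) then 1 else 0.
Proof.
  assert (E : Wword (nword a b 0) PSone i j = if Nat.eq_dec a i then if Nat.eq_dec b j then 1 else 0 else 0).
  { revert i j. induction a as [|a IH]; intros i j.
    - revert i j. induction b as [|b IH]; intros i j.
      + simpl. unfold Wid, PSone. destruct i, j; reflexivity.
      + change (Wword (nword 0 (S b) 0)) with (Wcomp Wy (Wword (nword 0 b 0))). unfold Wcomp, Wy.
        destruct j as [|j]. { destruct (Nat.eq_dec 0 i), (Nat.eq_dec (S b) 0); auto; lia. }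
        rewrite IH. destruct (Nat.eq_dec 0 i), (Nat.eq_dec b j), (Nat.eq_dec (S b) (S j)); auto; lia.
    - change (Wword (nword (S a) b 0)) with (Wcomp Wx (Wword (nword a b 0))). unfold Wcomp, Wx.
      destruct i as [|i]. { destruct (Nat.eq_dec (S a) 0); auto; lia. }
      rewrite IH. destruct (Nat.eq_dec a i), (Nat.eq_dec (S a) (S i)); auto; lia. }
  rewrite E. destruct (word_dec _ _) as [F|F].
  - apply nword_inj in F. destruct (Nat.eq_dec a i), (Nat.eq_dec b j); auto; lia.
  - destruct (Nat.eq_dec a i), (Nat.eq_dec b j); auto. subst. congruence.
Qed.

Lemma wev_kernel p : isNCP p -> (forall f, wev p f = PSzero) -> inI p.
Proof.
  intros Hp E. apply (ideal_eq_I (fun p => isNCP p /\ forall f, wev p f = PSzero)); auto.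
  - intros q Hq. split. now apply inI_NCP. now apply wev_inI.
  - intros q r [Nq Eq] [Nr Er]. split; [auto with ncp|]. intros f.
    unfold ncsub. rewrite wev_add, wev_scale, Eq, Er by auto with ncp.
    ps_ext. unfold PSadd, PSscale, PSzero. ring.
  - intros a q Na Nq [_ Eq]. split; [auto with ncp|]. intros f. rewrite wev_mul by auto.
    unfold Wcomp. rewrite Eq. apply linear_zero, linear_A2, inA2_wev.
  - intros a q Na Nq [_ Eq]. split; [auto with ncp|]. intros f. rewrite wev_mul by auto.
    unfold Wcomp. apply Eq.
  - intros N HN [_ EN]. funext w. apply NNPP. intros N0.
    destruct (proj2 HN w N0) as (i & j & k & L & Ew). replace k with 0%nat in Ew by lia. apply N0. rewrite Ew.
    rewrite <- (ev_indicator N (nword i j 0) (proj1 HN)).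
    specialize (EN PSone). apply (f_equal (fun g => g i j)) in EN. unfold wev, PSzero in EN. refine (eq_trans _ EN).
    apply ev_ext. intros v Hv. destruct (proj2 HN v Hv) as (a & b & k' & L' & ->). replace k' with 0%nat by lia.
    now rewrite Wword_one.
Qed.

(** A preimage in T(V), which exists for P in R since [phi] is onto. The image in the Weyl algebra
    does not depend on the choice, by [wev_phi_eq]. *)
Definition rep (P : RawOp) : NCP := epsilon (inhabits (fun _ : list nat => RtoC 0)) (fun p => isNCP p /\ opeq (phi p) P).
Definition chi (P : RawOp) : WOp := wev (rep P).

(** Both kernels are I, so p - q lies in one exactly when it lies in the other. One direction makes
    [chi] well defined, the other makes it injective. *)
Lemma wev_phi_eq p q : isNCP p -> isNCP q -> (opeq (phi p) (phi q) <-> wev p = wev q).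
Proof.
  intros Hp Hq. split.
  - intros E. funext f.
    assert (I : inI (ncsub p q)).
    { apply phi_kernel; [auto with ncp|]. intros h Hh. unfold ncsub. rewrite phi_add, phi_scale by auto with ncp.
      intros n z Hz. unfold Hadd, Hscale. rewrite (E h Hh n z Hz). unfold opzero, Hzero. ring. }
    pose proof (wev_inI _ I f) as Z. replace p with (ncadd (ncsub p q) q) by nc_lin.
    rewrite wev_add, Z by auto with ncp. ps_ext. unfold PSadd, PSzero. ring.
  - intros E.
    assert (I : inI (ncsub p q)).
    { apply wev_kernel; [auto with ncp|]. intros f. unfold ncsub. rewrite wev_add, wev_scale, E by auto with ncp.
      ps_ext. unfold PSadd, PSscale, PSzero. ring. }
    intros h Hh. pose proof (phi_inI _ I h Hh) as Z. replace p with (ncadd (ncsub p q) q) by nc_lin.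
    rewrite phi_add by auto with ncp.
    intros n z Hz. unfold Hadd. rewrite (Z n z Hz). unfold opzero, Hzero. ring.
Qed.

Lemma rep_spec P : inR P -> isNCP (rep P) /\ opeq (phi (rep P)) P.
Proof. intros H. unfold rep. apply epsilon_spec. now apply phi_surjective. Qed.

Lemma chi_eq P p : inR P -> isNCP p -> opeq (phi p) P -> chi P = wev p.
Proof.
  intros HP Hp E. destruct (rep_spec P HP) as [Nr Er]. apply wev_phi_eq; auto.
  intros h Hh. eapply Heq_trans; [exact (Er h Hh)|]. apply Heq_sym. exact (E h Hh).
Qed.

Theorem theorem3p5 :
  (* (1) T(V)/I ~ R as C-algebras: a surjective C-algebra map T(V) -> R with kernel I *)
  (exists phi : NCP -> RawOp,
      (forall p, isNCP p -> inR (phi p)) /\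
      opeq (phi ncone) opid /\
      (forall p q, isNCP p -> isNCP q -> opeq (phi (ncadd p q)) (opadd (phi p) (phi q))) /\
      (forall c p, isNCP p -> opeq (phi (ncscale c p)) (opscale c (phi p))) /\
      (forall p q, isNCP p -> isNCP q -> opeq (phi (ncmul p q)) (opcomp (phi p) (phi q))) /\
      (forall P, inR P -> exists p, isNCP p /\ opeq (phi p) P) /\
      (forall p, isNCP p -> (opeq (phi p) opzero <-> inI p))) /\
  (* (2) (R (x) C)/J ~ M as left R-modules, R (x) C = R via r (x) 1 |-> r,
         J = R (delta (x) 1) = R delta *)
  (exists psi : RawOp -> RawH,
      (forall P, inR P -> inM (psi P)) /\
      (forall P Q, inR P -> inR Q -> opeq P Q -> Heq (psi P) (psi Q)) /\
      (forall P Q, inR P -> inR Q -> Heq (psi (opadd P Q)) (Hadd (psi P) (psi Q))) /\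
      (forall P Q, inR P -> inR Q -> Heq (psi (opcomp P Q)) (P (psi Q))) /\
      (forall m, inM m -> exists P, inR P /\ Heq (psi P) m) /\
      (forall P, inR P ->
         (Heq (psi P) Hzero <-> exists Q, inR Q /\ opeq P (opcomp Q delta)))) /\
  (* (3) (R (x) C Delta)/J' ~ S as left R-modules, R (x) C Delta = R via
         r (x) Delta |-> r, J' = R (delta (x) Delta) = R delta *)
  (exists psi : RawOp -> RawH,
      (forall P, inR P -> inS (psi P)) /\
      (forall P Q, inR P -> inR Q -> opeq P Q -> Heq (psi P) (psi Q)) /\
      (forall P Q, inR P -> inR Q -> Heq (psi (opadd P Q)) (Hadd (psi P) (psi Q))) /\
      (forall P Q, inR P -> inR Q -> Heq (psi (opcomp P Q)) (P (psi Q))) /\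
      (forall m, inS m -> exists P, inR P /\ Heq (psi P) m) /\
      (forall P, inR P ->
         (Heq (psi P) Hzero <-> exists Q, inR Q /\ opeq P (opcomp Q delta)))) /\
  (* (4) a C-algebra embedding R -> A_2(C) *)
  (exists chi : RawOp -> WOp,
      (forall P, inR P -> inA2 (chi P)) /\
      (forall P Q, inR P -> inR Q -> opeq P Q -> chi P = chi Q) /\
      chi (opscale (RtoC 1) opid) = Wscale (RtoC 1) Wid /\
      (forall c P, inR P -> chi (opscale c P) = Wscale c (chi P)) /\
      (forall P Q, inR P -> inR Q -> chi (opadd P Q) = Wadd (chi P) (chi Q)) /\
      (forall P Q, inR P -> inR Q -> chi (opcomp P Q) = Wcomp (chi P) (chi Q)) /\
      (forall P Q, inR P -> inR Q -> chi P = chi Q -> opeq P Q)).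
Proof.
  split; [|split; [|split]].
  - exists phi. split; [|split; [|split; [|split; [|split; [|split]]]]].
    + intros p _. apply inR_phi.
    + unfold ncone. rewrite phi_word. intros h _. apply Heq_refl.
    + intros p q Hp Hq h _. rewrite phi_add by auto. apply Heq_refl.
    + intros c p Hp h _. rewrite phi_scale by auto. apply Heq_refl.
    + intros p q Hp Hq. apply phi_mul; auto.
    + apply phi_surjective.
    + intros p Hp. split. now apply phi_kernel. apply phi_inI.
  - unfold inM. rewrite monoM_mono. exact (cyclic_module 0 (fun _ => 1) (isHol_const 1) Dk_one one_imag).
  - unfold inS. rewrite monoS_mono. exact (cyclic_module 12 Defs.Delta isHol_Delta Dk_Delta Delta_imag).
  - exists chi. split; [|split; [|split; [|split; [|split; [|split]]]]].
    + intros P _. apply inA2_wev.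
    + intros P Q HP HQ E. destruct (rep_spec Q HQ) as [Nq Eq]. apply chi_eq; auto.
      intros h Hh. eapply Heq_trans; [exact (Eq h Hh)|]. apply Heq_sym. exact (E h Hh).
    + rewrite (chi_eq _ ncone); [|constructor|apply isNCP_one|].
      * unfold ncone. rewrite wev_word. apply Wid_scale.
      * unfold ncone. rewrite phi_word, <- opid_scale. intros h _. apply Heq_refl.
    + intros c P HP. destruct (rep_spec P HP) as [Np Ep]. rewrite (chi_eq _ (ncscale c (rep P))).
      * apply functional_extensionality. intros f. rewrite wev_scale by auto. reflexivity.
      * change (inR (opcomp (opscale c opid) P)). constructor; auto. constructor.
      * auto with ncp.
      * intros h Hh. rewrite phi_scale by auto. apply Heq_scale. exact (Ep h Hh).
    + intros P Q HP HQ. destruct (rep_spec P HP) as [Np Ep]. destruct (rep_spec Q HQ) as [Nq Eq].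
      rewrite (chi_eq _ (ncadd (rep P) (rep Q))).
      * apply functional_extensionality. intros f. rewrite wev_add by auto. reflexivity.
      * now constructor.
      * auto with ncp.
      * intros h Hh. rewrite phi_add by auto. apply Heq_add; [exact (Ep h Hh)|exact (Eq h Hh)].
    + intros P Q HP HQ. destruct (rep_spec P HP) as [Np Ep]. destruct (rep_spec Q HQ) as [Nq Eq].
      rewrite (chi_eq _ (ncmul (rep P) (rep Q))).
      * now apply wev_mul.
      * now constructor.
      * auto with ncp.
      * intros h Hh. eapply Heq_trans; [apply phi_mul; auto|]. unfold opcomp.
        assert (Hq : isH (phi (rep Q) h)) by (apply good_isH; auto; apply good_inR, inR_phi).
        eapply Heq_trans; [exact (Ep _ Hq)|]. apply (good_ext P (good_inR P HP)); auto.
    + intros P Q HP HQ E. destruct (rep_spec P HP) as [Np Ep]. destruct (rep_spec Q HQ) as [Nq Eq].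
      apply wev_phi_eq in E; auto. intros h Hh.
      eapply Heq_trans; [apply Heq_sym; exact (Ep h Hh)|]. eapply Heq_trans; [exact (E h Hh)|exact (Eq h Hh)].
Qed.
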